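(* Let $f$ be a transcendental entire function with a multiply connected wandering domain $U$, let $z_0\in U$, and let $h:U\to\mathbb{R}$ be the non-constant positive harmonic function $$h(z) = \lim_{n\to \infty} \frac{\log |f^n(z)|}{\log |f^n(z_0)|}.$$ For large $n\in\mathbb{N}$ let $r_n=|f^n(z_0)|$, let $A(r_n^{a_n},r_n^{b_n})$ be the maximal annulus centred at $0$ that is contained in $U_n=f^n(U)$ and contains $f^n(z_0)$, and let $a=\lim_{n\to\infty}a_n\in[0,1)$ and $b=\lim_{n\to\infty}b_n\in(1,\infty]$. Then (a) $a=\inf_{z\in U}h(z)$ and $b=\sup_{z\in U}h(z)$; (b) the function $h$ extends continuously to $\partial U\setminus \partial_{\infty}U$ with $h(\zeta)=a$ for $\zeta\in\partial U\setminus \partial_{\infty}U$; (c) the domain $U$ is regular for the Dirichlet problem; (d) (i) if $b<\infty$, then $h(z)=a+(b-a)\,\omega(z,\partial_{\infty}U,U)$ for $z\in U$; (ii) if $b=\infty$, then $\omega(z,\partial_{\infty}U,U)=0$ for $z\in U$.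
   Context: $A(r,R)=\{z\in\mathbb{C}:r<|z|<R\}$ for $0<r<R$. A transcendental entire function is an entire function $f:\mathbb{C}\to\mathbb{C}$ that is not a polynomial; $f^n$ denotes its $n$-th iterate, and $\mathbb{N}=\{1,2,\dots\}$. The Fatou set $F(f)$ is the set of points of $\mathbb{C}$ having a neighbourhood on which the iterates $f^n$ form a normal family (locally uniform convergence to $\infty$ being allowed). A Fatou component is a connected component of $F(f)$. For a Fatou component $U$, $U_n$ denotes the Fatou component containing $f^n(U)$, with $U_0=U$; $U$ is a wandering domain if the sequence $(U_n)$ is not eventually periodic. A domain is multiply connected if it is not simply connected. By results of Baker, if $U$ is a multiply connected wandering domain then each $U_n$ is bounded and multiply connected, $U_n=f^n(U)$, for all large $n$ both $U_n$ and $0$ lie in a bounded complementary component of $U_{n+1}$, and $\mathrm{dist}(U_n,0)\to\infty$ as $n\to\infty$. The limit defining $h$ exists and is a non-constant positive harmonic function on $U$. There exists $\alpha>0$ such that, for all large $n$, the maximal annulus centred at $0$ that is contained in $U_n$ and contains $f^n(z_0)$ exists and has the form $A(r_n^{a_n},r_n^{b_n})$ with $0<a_n<1-\alpha<1+\alpha<b_n$; this defines $a_n,b_n$. The limits $a\in[0,1)$ and $b\in(1,\infty]$ exist. For a bounded domain $G$, the outer boundary component $\partial_\infty G$ is the boundary of the unbounded component of $\mathbb{C}\setminus G$. For a Borel set $E\subset\partial U$, $\omega(\cdot,E,U)$ denotes the harmonic measure of $E$ in $U$. *)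

(* Defs.v *)
From HB Require Import structures.
From mathcomp Require Import all_boot all_order all_algebra.
From mathcomp Require Import all_classical all_reals all_analysis.
From mathcomp Require Import complex.

Set Implicit Arguments.
Unset Strict Implicit.
Unset Printing Implicit Defensive.

Import Order.TTheory GRing.Theory Num.Theory.
Import numFieldNormedType.Exports.

Local Open Scope classical_set_scope.
Local Open Scope ring_scope.
Local Open Scope complex_scope.

(* The norm of this structure takes values in R[i]; the real-valued modulus is
   [Normc.normc]. *)
HB.instance Definition _ (R : realType) := NormedModule.copy R[i] R[i]^o.

(* The Borel sets of the plane. *)
Definition borelC (R : realType) := g_sigma_algebraType (@open R[i]).

Section Topology.
Variable R : realType.
Implicit Types (A G : set R[i]).

Definition frontier A : set R[i] := closure A `\` interior A.

(* Intended for domains, which are automatically path-connected. *)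
Definition simply_connected G :=
  forall gamma : R -> R[i],
    {within `[0, 1], continuous gamma} ->
    (forall t, t \in `[0, 1] -> G (gamma t)) ->
    gamma 0 = gamma 1 ->
    exists H : R * R -> R[i],
      [/\ {within `[0, 1]%classic `*` `[0, 1]%classic, continuous H},
          (forall s t, s \in `[0, 1] -> t \in `[0, 1] -> G (H (s, t))),
          (forall t, t \in `[0, 1] -> H (0, t) = gamma t),
          (forall t, t \in `[0, 1] -> H (1, t) = gamma 0) &
          (forall s, s \in `[0, 1] -> H (s, 0) = gamma 0 /\ H (s, 1) = gamma 0)].

Definition multiply_connected G := ~ simply_connected G.

(* For bounded [G] the complement has exactly one unbounded component. *)
Definition unbounded_component G : set R[i] :=
  [set z | (~` G) z /\ ~ bounded_set (connected_component (~` G) z)].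

Definition outer_boundary G : set R[i] := frontier (unbounded_component G).

Definition annulus (r1 r2 : R) : set R[i] :=
  [set z | r1 < Normc.normc z < r2].

Definition maximal_annulus G (w : R[i]) (r1 r2 : R) :=
  [/\ 0 < r1 < r2, annulus r1 r2 `<=` G, annulus r1 r2 w &
      forall s1 s2 : R, 0 < s1 < s2 ->
        annulus r1 r2 `<=` annulus s1 s2 -> annulus s1 s2 `<=` G ->
        annulus s1 s2 = annulus r1 r2].

End Topology.

Section Dynamics.
Variable R : realType.
Implicit Types (f : R[i] -> R[i]) (U V : set R[i]).

Definition entire f := forall z : R[i], derivable f z 1.

Definition transcendental_entire f :=
  entire f /\ ~ exists p : {poly R[i]}, forall z, f z = horner p z.

Definition locally_uniform_cvg V (F : nat -> R[i] -> R[i]) (g : R[i] -> R[i]) :=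
  forall z, V z -> exists2 N, nbhs z N & {uniform N, F @ \oo --> g}.

Definition locally_uniform_cvg_infty V (F : nat -> R[i] -> R[i]) :=
  forall z, V z -> exists2 N, nbhs z N &
    forall M : R, \forall k \near \oo, forall w, N w -> M < Normc.normc (F k w).

Definition normal_family V (F : nat -> R[i] -> R[i]) :=
  forall s : nat -> nat, exists2 t : nat -> nat,
    {homo t : m n / (m < n)%N} &
    (exists g, locally_uniform_cvg V (fun k => F (s (t k))) g) \/
    locally_uniform_cvg_infty V (fun k => F (s (t k))).

Definition fatou_set f : set R[i] :=
  [set z | exists2 V, open_nbhs z V & normal_family V (fun n => iter n f)].

Definition fatou_component f U :=
  exists2 z, fatou_set f z & U = connected_component (fatou_set f) z.

(* The union has a single term: the component that contains [f^n(U)]. *)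
Definition fatou_iter f U (n : nat) : set R[i] :=
  \bigcup_(V in [set V | fatou_component f V /\ iter n f @` U `<=` V]) V.

Definition wandering_domain f U :=
  fatou_component f U /\
  ~ exists N p : nat, (0 < p)%N /\
      forall n, (N <= n)%N -> fatou_iter f U (n + p) = fatou_iter f U n.

End Dynamics.

Section PotentialTheory.
Variable R : realType.
Implicit Types (U : set R[i]) (u phi : R[i] -> R).

Definition dx u (z : R[i]) : R := derive1 (fun t : R => u (z + (t +i* 0))) 0.
Definition dy u (z : R[i]) : R := derive1 (fun t : R => u (z + (0 +i* t))) 0.

Definition C1_on U u :=
  forall z, U z ->
    [/\ derivable (fun t : R => u (z + (t +i* 0))) 0 1,
        derivable (fun t : R => u (z + (0 +i* t))) 0 1,
        {for z, continuous (dx u)} & {for z, continuous (dy u)}].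

Definition harmonic_on U u :=
  [/\ C1_on U u, C1_on U (dx u), C1_on U (dy u) &
      forall z, U z -> dx (dx u) z + dy (dy u) z = 0].

Definition circle (z : R[i]) (r t : R) : R[i] :=
  z + ((r * cos t) +i* (r * sin t)).

(* Upper semicontinuous functions with values in [-oo, +oo[ that satisfy the
   local submean inequality; the constant -oo is included. *)
Definition subharmonic_on U (v : R[i] -> \bar R) :=
  forall z, U z ->
    [/\ (v z < +oo)%E,
        (forall c : R, (v z < c%:E)%E -> \forall w \near z, (v w < c%:E)%E) &
        \forall r \near (0 : R)^'+,
          (v z <= ((2 * pi)^-1)%:E *
             \int[lebesgue_measure]_(t in `[0%R, (2 * pi)%R])
               v (circle z r t))%E].

(* The Perron solution of the Dirichlet problem with boundary data [phi]. *)
Definition perron U phi (z : R[i]) : \bar R :=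
  ereal_sup [set v z | v in [set v : R[i] -> \bar R |
    subharmonic_on U v /\
    forall zeta, frontier U zeta ->
      (limf_esup v (within U (nbhs zeta)) <= (phi zeta)%:E)%E]].

(* For bounded [U] and [z] in [U] this determines [mu], by the Riesz
   representation theorem. *)
Definition is_harmonic_measure U (z : R[i]) (mu : probability (borelC R) R) :=
  mu (frontier U) = 1%E /\
  forall phi, {within frontier U, continuous phi} ->
    (\int[mu]_(zeta in frontier U) (phi zeta)%:E = perron U phi z)%E.

Definition dirichlet_regular U :=
  forall phi, {within frontier U, continuous phi} ->
    exists2 u, harmonic_on U u &
      forall zeta, frontier U zeta -> u @ within U (nbhs zeta) --> phi zeta.

End PotentialTheory.

(* Main.v *)
(* Write u_n = log|f^n| / log r_n, so that u_n -> h on U.  The annuli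
   A_n = {a_n < log|w| / log r_n < b_n} are nested in one another, otherwise an
   iterate would map a disc into itself and merge two components of the orbit of U;
   hence log r_n grows geometrically.  The three circles theorem between a fixed
   circle and the circle |w| = r_m, on which log|f^j| is almost constant by
   Harnack's inequality, shows that h is at most (1 + o(1)) u_m + o(1) where
   u_m <= 1, and similarly h is at least (1 - o(1)) u_m where u_m is in [1, b_m).
   Boundary points of U are mapped outside A_n, so the maximum principle for u_n
   produces points of U where u_n is close to a_n or b_n; with the above, this gives
   inf h <= a and sup h >= b.  Conversely h omits the values a and b: the branches of
   log f^n / log r_n would otherwise take the omitted values on the boundary of the
   maximal annulus (Harnack's inequality in the form of Hurwitz's theorem).

   A bounded complementary component of U is surrounded by a compact subset of U,
   where u_n < b_n eventually, so that u_n <= a_n on it and h -> a there.  The outer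
   boundary is connected, hence lies entirely above A_n.  This identifies
   (h - a) / (b - a) with the harmonic measure of the outer boundary, by comparison
   with the clopen boundary sets {u_n >= b_n}.  Regularity follows from weak
   barriers: h - a at inner boundary points and a limit of branches of
   - 1 / log((z - zeta) / (z - zeta')) at outer ones. *)

Require Import Defs.
From HB Require Import structures.
From mathcomp Require Import all_boot all_order all_algebra.
From mathcomp Require Import all_classical all_reals all_analysis.
From mathcomp Require Import complex.
From mathcomp Require Import ring lra.

Set Implicit Arguments.
Unset Strict Implicit.
Unset Printing Implicit Defensive.

Import Order.TTheory GRing.Theory Num.Theory.
Import numFieldNormedType.Exports.

Local Open Scope classical_set_scope.
Local Open Scope ring_scope.
Local Open Scope complex_scope.
Local Notation N := Normc.normc.
Local Notation Re := complex.Re.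
Local Notation Im := complex.Im.

(** * Complex numbers and complex derivatives *)

(** Harmonic functions are carried as continuous functions with the mean value property ([mvp]),
    which covers limits and [ln |g|] without any derivative; the Schwarz integral turns it into
    [harmonic_on] only at the end. Complex analysis enters through a single integral theorem,
    Goursat's, in logarithmic polar coordinates. The open mapping, Hurwitz and Montel arguments then
    rest on Harnack's inequality, applied to positive functions such as [ln (2 B / |g - w|)].

    The limit [h] lives on [U] only, whereas each [u_n] is continuous up to the boundary. Boundary
    statements are therefore proved for [u_n] at one large [n] and carried over to [h] by estimates
    uniform on [U]. These are sharp because Harnack's inequality is used in the logarithmic plane,
    on discs of radius proportional to [log r_m], where its constant tends to 1.

    Harmonic measure is tested on continuous boundary functions only, and the indicator of the outer
    boundary need not be continuous. The clopen sets have continuous indicators, and their measures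
    tend to that of the outer boundary. *)

Section ComplexModulus.
Context {R : realType}.
Local Notation C := R[i].
Implicit Types (a b c z w : C).

Lemma ReD a b : Re (a + b) = Re a + Re b. Proof. by case: a; case: b. Qed.
Lemma ImD a b : Im (a + b) = Im a + Im b. Proof. by case: a; case: b. Qed.
Lemma ReN a : Re (- a) = - Re a. Proof. by case: a. Qed.
Lemma ImN a : Im (- a) = - Im a. Proof. by case: a. Qed.
Lemma ReM a b : Re (a * b) = Re a * Re b - Im a * Im b.
Proof. by case: a; case: b. Qed.
Lemma ImM a b : Im (a * b) = Re a * Im b + Im a * Re b.
Proof. by case: a => ? ?; case: b => ? ? /=. Qed.

Definition ReImE := (ReD, ImD, ReN, ImN, ReM, ImM).

Lemma complexP a b : Re a = Re b -> Im a = Im b -> a = b.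
Proof. by case: a => ? ?; case: b => ? ? /= -> ->. Qed.

Lemma normE z : `|z| = (N z)%:C. Proof. by []. Qed.
Lemma N_ge0 z : 0 <= N z. Proof. by case: z => x y /=; exact: sqrtr_ge0. Qed.
Lemma NM a b : N (a * b) = N a * N b. Proof. exact: Normc.normcM. Qed.
Lemma NV a : N (a^-1) = (N a)^-1. Proof. exact: Normc.normcV. Qed.
Lemma NX a n : N (a ^+ n) = N a ^+ n.
Proof. by elim: n => [|n IH]; rewrite ?expr0 ?Normc.normc1 // !exprS NM IH. Qed.
Lemma NN a : N (- a) = N a. Proof. exact: normcN. Qed.
Lemma N0 : N (0 : C) = 0. Proof. exact: Normc.normc0. Qed.
Lemma N1 : N (1 : C) = 1. Proof. exact: Normc.normc1. Qed.
Lemma NC (x : R) : N x%:C = `|x|.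
Proof. by rewrite /= expr0n /= addr0 sqrtr_sqr. Qed.
Lemma N_eq0 z : (N z == 0) = (z == 0).
Proof. by apply/eqP/eqP => [/Normc.eq0_normc//|->]; rewrite N0. Qed.
Lemma N_gt0 z : (0 < N z) = (z != 0).
Proof. by rewrite lt_neqAle N_ge0 andbT eq_sym N_eq0. Qed.
Lemma NBC a b : N (a - b) = N (b - a). Proof. by rewrite -NN opprB. Qed.
Lemma ler_N a b : N (a + b) <= N a + N b. Proof. exact: le_normcD. Qed.
Lemma ler_NB a b : N (a - b) <= N a + N b.
Proof. by rewrite -(NN b) ler_N. Qed.
Lemma N_tri b a c : N (a - c) <= N (a - b) + N (b - c).
Proof. by apply: le_trans (ler_N _ _); rewrite addrA subrK. Qed.
Lemma N_rev a b : N a - N b <= N (a - b).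
Proof. by rewrite lerBlDr; apply: le_trans (ler_N _ _); rewrite subrK. Qed.
Lemma N_dist a b : `|N a - N b| <= N (a - b).
Proof. by rewrite ler_norml N_rev andbT NBC lerNl opprB N_rev. Qed.
Lemma N_sqr z : N z ^+ 2 = Re z ^+ 2 + Im z ^+ 2.
Proof. by case: z => x y /=; rewrite sqr_sqrtr // addr_ge0 ?sqr_ge0. Qed.
Lemma Re_le_N z : `|Re z| <= N z.
Proof.
by rewrite -ler_sqr ?nnegrE ?N_ge0 // N_sqr real_normK ?num_real// lerDl sqr_ge0.
Qed.
Lemma Im_le_N z : `|Im z| <= N z.
Proof.
by rewrite -ler_sqr ?nnegrE ?N_ge0 // N_sqr real_normK ?num_real// lerDr sqr_ge0.
Qed.
Lemma N_le_ReIm z : N z <= `|Re z| + `|Im z|.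
Proof.
rewrite -ler_sqr ?nnegrE ?N_ge0 ?addr_ge0// N_sqr sqrrD !real_normK ?num_real//.
by rewrite -addrA lerD2l lerDr mulrn_wge0 // mulr_ge0.
Qed.
Lemma Re_le_normc z : Re z <= N z.
Proof. exact: le_trans (ler_norm _) (Re_le_N z). Qed.

End ComplexModulus.

(** * Topology of the plane in terms of discs *)

Section ComplexTopology.
Context {R : realType}.
Local Notation C := R[i].
Implicit Types (a b c z w : C) (r s : R) (A B K : set C).

Definition disc c r : set C := [set w | N (w - c) < r].
Definition cdisc c r : set C := [set w | N (w - c) <= r].

Lemma nbhs_discP z A : nbhs z A <-> exists2 r, 0 < r & disc z r `<=` A.
Proof.
split.
  move/nbhs_ballP => [e /= e0 H]; exists (Re e).
    by move: e0; rewrite ltcE => /andP[].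
  move=> w hw; apply: H; rewrite /ball /= distrC normE ltcE /=.
  by rewrite [N _ < _]hw andbT; move: e0; rewrite ltcE => /andP[/eqP ->].
move=> [r r0 H]; apply/nbhs_ballP; exists r%:C => [|w]; first by rewrite /= ltcE /= eqxx.
by rewrite /ball /= distrC normE ltcR; exact: H.
Qed.

Lemma near_disc z r : 0 < r -> \forall w \near z, disc z r w.
Proof. by move=> r0; apply/nbhs_discP; exists r. Qed.

Lemma disc_center z r : 0 < r -> disc z r z.
Proof. by rewrite /disc /= subrr N0. Qed.

Lemma disc_sub z r s : r <= s -> disc z r `<=` disc z s.
Proof. by move=> rs w /lt_le_trans; apply. Qed.

Lemma open_discP A : open A <-> forall z, A z -> exists2 r, 0 < r & disc z r `<=` A.
Proof.
rewrite openE; split=> H z /H; first by move/nbhs_discP.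
by move=> ?; apply/nbhs_discP.
Qed.

Lemma disc_open c r : open (disc c r).
Proof.
apply/open_discP => z zr; exists (r - N (z - c)); first by rewrite subr_gt0.
move=> w; rewrite /disc /= ltrBrDr; apply: le_lt_trans; exact: N_tri.
Qed.

Lemma contC (u : C -> R) z : {for z, continuous u} <->
  forall e, 0 < e -> exists2 d, 0 < d & forall w, disc z d w -> `|u w - u z| < e.
Proof.
split=> [/cvgrPdist_lt H e e0|H].
  have /nbhs_discP[d d0 D] := H e e0; exists d => // w /D; by rewrite distrC.
apply/(@cvgrPdist_lt _ _ _ (nbhs z) (nbhs_filter z)) => e /H[d d0 D].
apply/nbhs_discP; exists d => // w /D.
by rewrite distrC.
Qed.

Lemma cvgCC (T : Type) (F : set_system T) (FF : Filter F) (f : T -> C) z :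
  f @ F --> z <-> forall e : R, 0 < e -> \forall t \near F, N (f t - z) < e.
Proof.
split=> [H e e0|H]; first exact: H (near_disc z e0).
move=> A /nbhs_discP[r r0 D]; apply: filterS (H r r0) => t; exact: D.
Qed.

Lemma contCC (f : C -> C) z : {for z, continuous f} <->
  forall e, 0 < e -> exists2 d, 0 < d & forall w, disc z d w -> N (f w - f z) < e.
Proof.
split=> [/cvgCC H e e0|H]; first by have /nbhs_discP[d d0 D] := H _ e0; exists d.
apply/(@cvgCC _ (nbhs z) (nbhs_filter z)) => e /H[d d0 D].
by apply/nbhs_discP; exists d.
Qed.

Lemma continuous_Re : continuous (@complex.Re R).
Proof.
move=> z; apply/contC => e e0; exists e => // w; apply: le_lt_trans.
by rewrite -ReN -ReD Re_le_N.
Qed.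

Lemma continuous_Im : continuous (@complex.Im R).
Proof.
move=> z; apply/contC => e e0; exists e => // w; apply: le_lt_trans.
by rewrite -ImN -ImD Im_le_N.
Qed.

Lemma continuous_N : continuous (@Normc.normc R).
Proof.
move=> z; apply/contC => e e0; exists e => // w; apply: le_lt_trans.
exact: N_dist.
Qed.

Lemma cvg_complex (T : Type) (F : set_system T) (FF : Filter F) (f g : T -> R) x y :
  f @ F --> x -> g @ F --> y -> (fun t => f t +i* g t) @ F --> x +i* y.
Proof.
move=> /cvgrPdist_lt hf /cvgrPdist_lt hg; apply/cvgCC => e e0.
have e2 : 0 < e / 2 by rewrite divr_gt0.
near=> t; apply: le_lt_trans (N_le_ReIm _) _; rewrite !ReImE /=.
rewrite (splitr e) ltrD // distrC; near: t; [exact: hf|exact: hg].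
Unshelve. all: by end_near. Qed.

Lemma cdisc_closed c r : closed (cdisc c r).
Proof.
have -> : cdisc c r = ~` [set z | r < N (z - c)].
  by apply/seteqP; split=> z; rewrite /cdisc /= leNgt => /negP.
rewrite closedC; apply/open_discP => z /= zr; exists (N (z - c) - r); first by rewrite subr_gt0.
move=> w; rewrite /disc /= NBC ltrBrDr -ltrBrDl => /lt_le_trans; apply.
by rewrite lerBlDr (NBC w c); exact: N_tri.
Qed.

Lemma compact_cdisc c r : compact (cdisc c r).
Proof.
pose g (p : R * R) : C := p.1 +i* p.2.
have cg : continuous g by move=> p; apply: cvg_complex; [exact: cvg_fst|exact: cvg_snd].
pose sq := `[Re c - r, Re c + r]%classic `*` `[Im c - r, Im c + r]%classic.
have : compact (g @` sq).
  apply: continuous_compact; first by apply: continuous_subspaceT.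
  by apply: compact_setX; exact: segment_compact.
move=> csq; refine (@subclosed_compact _ (cdisc c r) _ (@cdisc_closed c r) csq _).
move=> z; rewrite /cdisc /= => zr; exists (Re z, Im z); last by case: z {zr}.
split; rewrite /= in_itv /= -ler_distl -?ReN -?ImN -?ReD -?ImD.
  exact: le_trans (Re_le_N _) zr.
exact: le_trans (Im_le_N _) zr.
Qed.

Lemma compactC A r : closed A -> (forall z, A z -> N z <= r) -> compact A.
Proof.
move=> cA bA; refine (@subclosed_compact _ A _ cA (@compact_cdisc 0 r) _).
by move=> z /bA; rewrite /cdisc /= subr0.
Qed.

Lemma compact_max K (u : C -> R) : compact K -> K !=set0 ->
  (forall z, K z -> {for z, continuous u}) ->
  exists2 p, K p & forall z, K z -> u z <= u p.
Proof.
move=> cK K0 cu.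
have [|p /set_mem Kp H] := @compact_EVT_max _ _ u K K0 cK.
  apply: continuous_in_subspaceT => z /set_mem; exact: cu.
by exists p => // z Kz; apply: H; rewrite inE.
Qed.

Lemma connected_star A z0 : A z0 ->
  (forall z t, A z -> 0 <= t <= 1 -> A (z0 + t%:C * (z - z0))) -> connected A.
Proof.
move=> Az0 H.
have -> : A = \bigcup_(z in A) ((fun t : R => z0 + t%:C * (z - z0)) @` `[0, 1]).
  apply/seteqP; split=> [z Az|z [w Aw [t]]]; last first.
    by rewrite /= in_itv /= => t01 <-; apply: H.
  exists z => //; exists 1; first by rewrite /= in_itv /= ler01 lexx.
  by rewrite mul1r addrC subrK.
apply: bigcup_connected.
  exists z0 => z Az; exists 0; first by rewrite /= in_itv /= ler01 lexx.
  by rewrite mul0r addr0.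
move=> z Az; apply: connected_continuous_connected; first exact: segment_connected.
apply: continuous_subspaceT => t; apply/cvgCC => e e0.
have k0 : 0 < N (z - z0) + 1 by rewrite ltr_wpDl ?N_ge0.
near=> s; rewrite opprD addrACA subrr add0r -mulrBl NM -rmorphB NC distrC.
apply: le_lt_trans (ler_wpM2l (normr_ge0 _) (_ : _ <= N (z - z0) + 1)) _.
  by rewrite lerDl.
rewrite -ltr_pdivlMr //; near: s; apply: cvgr_dist_lt; [exact: cvg_id|].
by rewrite divr_gt0.
Unshelve. all: by end_near. Qed.

Lemma connected_disc c r : connected (disc c r).
Proof.
have [r0|r0] := ltP 0 r; last first.
  have -> : disc c r = set0.
    by rewrite -subset0 => z; rewrite /disc /= ltNge (le_trans r0) ?N_ge0.
  exact: connected0.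
apply: (@connected_star _ c); first exact: disc_center.
move=> z t; rewrite /disc /= => zr /andP[t0 t1].
rewrite addrAC subrr add0r NM NC ger0_norm //.
by apply: le_lt_trans zr; rewrite ler_piMl ?N_ge0.
Qed.

(** [A] is covered by the union [O] of the open sets on which [P] holds in [A] and the union [O'] of
    those on which it fails. Openness is phrased by neighbourhoods so that [P] can be any property;
    most connectedness arguments below take this form. *)
Lemma connected_clopen A (P : set C) : connected A -> (exists2 z, A z & P z) ->
  (forall z, A z -> P z -> \forall w \near z, A w -> P w) ->
  (forall z, A z -> ~ P z -> \forall w \near z, A w -> ~ P w) ->
  A `<=` P.
Proof.
move=> cA [z0 Az0 Pz0] oP oNP z Az.
pose O := \bigcup_(V in [set V : set C | open V /\ A `&` V `<=` P]) V.
pose O' := \bigcup_(V in [set V : set C | open V /\ A `&` V `<=` ~` P]) V.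
have oO : open O by apply: bigcup_open => ? [].
have oO' : open O' by apply: bigcup_open => ? [].
have AO w : A w -> P w -> O w.
  move=> Aw Pw; have [r r0 D] := (nbhs_discP _ _).1 (oP w Aw Pw).
  exists (disc w r); last exact: disc_center.
  by split; [exact: disc_open|move=> y [Ay /D]; apply].
have AO' w : A w -> ~ P w -> O' w.
  move=> Aw Pw; have [r r0 D] := (nbhs_discP _ _).1 (oNP w Aw Pw).
  exists (disc w r); last exact: disc_center.
  by split; [exact: disc_open|move=> y [Ay /D]; apply].
have E : A `&` O = A.
  apply: cA; first by exists z0; split=> //; apply: AO.
    by exists O.
  exists (~` O'); first exact: open_closedC.
  apply/seteqP; split=> y [Ay]; last first.
    move=> nO'; split=> //; apply: AO => //; apply: contrapT => nP.
    by apply: nO'; apply: AO'.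
  move=> [V [oV VP] Vy]; split=> //= -[V' [oV' VP'] V'y].
  by have := VP' y (conj Ay V'y); apply; apply: VP.
have [_ [V [_ VP] Vz]] : (A `&` O) z by rewrite E.
exact: VP.
Qed.

End ComplexTopology.

Section ComplexDerivative.
Context {R : realType}.
Local Notation C := R[i].
Implicit Types (a b c d z w : C) (f g : C -> C).

(** A first-order estimate instead of a quotient: [w = z] is not exceptional, and the moduli are
    real-valued. *)
Definition cderiv g z d := forall e : R, 0 < e ->
  \forall w \near z, N (g w - g z - d * (w - z)) <= e * N (w - z).

Definition cdiff g z := exists d, cderiv g z d.

Lemma near_continuous g z e : {for z, continuous g} -> 0 < e ->
  \forall w \near z, N (g w - g z) < e.
Proof. by move=> /contCC H /H[d d0 D]; apply/nbhs_discP; exists d. Qed.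

Lemma cderiv_cont g z d : cderiv g z d -> {for z, continuous g}.
Proof.
move=> H; apply/(@cvgCC _ _ (nbhs z) (nbhs_filter z)) => e e0.
have k0 : 0 < 1 + N d by rewrite ltr_pwDl ?N_ge0.
have e1 : 0 < e / (1 + N d) by rewrite divr_gt0.
apply: filterS (filterI (H 1 ltr01) (near_disc z e1)) => w [A B].
have -> : g w - g z = (g w - g z - d * (w - z)) + d * (w - z) by ring.
apply: le_lt_trans (ler_N _ _) _; rewrite NM.
apply: le_lt_trans (lerD A (lexx _)) _.
by rewrite -mulrDl mulrC -ltr_pdivlMr.
Qed.

Lemma cdiff_cont g z : cdiff g z -> {for z, continuous g}.
Proof. by move=> [d /cderiv_cont]. Qed.

Lemma near_cderiv f g z d : (\forall w \near z, f w = g w) ->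
  cderiv f z d -> cderiv g z d.
Proof.
move=> E H e /H; move: (E) => /nbhs_singleton Ez.
by apply: filterS2 E => w Ew; rewrite -Ew -Ez.
Qed.

Lemma cderiv_cst c z : cderiv (fun _ => c) z 0.
Proof.
move=> e e0; near=> w; rewrite mul0r !subrr N0 mulr_ge0 ?N_ge0 //; exact: ltW.
Unshelve. all: by end_near. Qed.

Lemma cderiv_id z : cderiv id z 1.
Proof.
move=> e e0; near=> w; rewrite mul1r subrr N0 mulr_ge0 ?N_ge0 //; exact: ltW.
Unshelve. all: by end_near. Qed.

Lemma cderivD f g z a b : cderiv f z a -> cderiv g z b ->
  cderiv (fun w => f w + g w) z (a + b).
Proof.
move=> hf hg e e0; have e2 : 0 < e / 2 by rewrite divr_gt0.
apply: filterS2 (hf _ e2) (hg _ e2) => w A B.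
have -> : f w + g w - (f z + g z) - (a + b) * (w - z) =
  (f w - f z - a * (w - z)) + (g w - g z - b * (w - z)) by ring.
apply: le_trans (ler_N _ _) _; apply: le_trans (lerD A B) _.
by rewrite -mulrDl -splitr.
Qed.

(* [f g - f g(z) - (a g + f b)(w - z)] splits into the two error terms plus
   [a (w - z) (g w - g z)], which is small by continuity. *)
Lemma cderivM f g z a b : cderiv f z a -> cderiv g z b ->
  cderiv (fun w => f w * g w) z (a * g z + f z * b).
Proof.
move=> hf hg e e0.
have cg := cderiv_cont hg.
pose k := N (g z) + 1 + N (f z) + N a + 1.
have k0 : 0 < k by have := N_ge0 (g z); have := N_ge0 (f z); have := N_ge0 a; rewrite /k; lra.
have ek : 0 < e / k by rewrite divr_gt0.
apply: filterS2 (filterI (hf _ ek) (hg _ ek))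
   (filterI (near_continuous cg ek) (near_continuous cg ltr01)) => w [A B] [D D1].
have -> : f w * g w - f z * g z - (a * g z + f z * b) * (w - z) =
  (f w - f z - a * (w - z)) * g w + f z * (g w - g z - b * (w - z)) +
  a * (w - z) * (g w - g z) by ring.
have gw : N (g w) <= N (g z) + 1.
  have -> : g w = g z + (g w - g z) by ring.
  by apply: le_trans (ler_N _ _) _; rewrite lerD2l ltW.
apply: le_trans (ler_N _ _) _.
apply: le_trans (lerD (ler_N _ _) (lexx _)) _; rewrite !NM.
have -> : e = e / k * k by rewrite divfK // gt_eqF.
move: (e / k) ek A B D => t t0 A B D.
have n0 := N_ge0 (w - z).
have H1 : N (f w - f z - a * (w - z)) * N (g w) <= t * N (w - z) * (N (g z) + 1).
  by apply: ler_pM => //; exact: N_ge0.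
have H2 : N (f z) * N (g w - g z - b * (w - z)) <= N (f z) * (t * N (w - z)).
  by apply: ler_wpM2l => //; exact: N_ge0.
have H3 : N a * N (w - z) * N (g w - g z) <= N a * N (w - z) * t.
  by apply: ler_wpM2l; rewrite ?mulr_ge0 ?N_ge0 // ltW.
apply: le_trans (lerD (lerD H1 H2) H3) _.
have -> : t * N (w - z) * (N (g z) + 1) + N (f z) * (t * N (w - z)) +
   N a * N (w - z) * t = t * N (w - z) * (k - 1) by rewrite /k; ring.
rewrite (mulrAC t k) ler_wpM2l ?mulr_ge0 ?N_ge0 ?(ltW t0) //.
by rewrite gerBl.
Qed.

Lemma cderiv_comp f g z a b : cderiv g z a -> cderiv f (g z) b ->
  cderiv (fun w => f (g w)) z (b * a).
Proof.
move=> hg hf e e0.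
pose k := N a + 1 + N b + 1.
have k0 : 0 < k by rewrite ltr_wpDl // !addr_ge0 ?N_ge0.
have ek : 0 < e / k by rewrite divr_gt0.
have cg := cderiv_cont hg.
apply: filterS2 (filterI (hg _ ek) (hg _ ltr01)) (cg _ (hf _ ek)) => w [A A1].
rewrite /= => B.
have -> : f (g w) - f (g z) - b * a * (w - z) =
  (f (g w) - f (g z) - b * (g w - g z)) + b * (g w - g z - a * (w - z)) by ring.
have gw : N (g w - g z) <= (N a + 1) * N (w - z).
  have -> : g w - g z = (g w - g z - a * (w - z)) + a * (w - z) by ring.
  apply: le_trans (ler_N _ _) _; rewrite NM mulrDl addrC lerD2l.
  exact: A1.
apply: le_trans (ler_N _ _) _; rewrite NM.
have -> : e = e / k * k by rewrite divfK // gt_eqF.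
move: (e / k) ek A B => t t0 A B.
have n0 := N_ge0 (w - z).
have H1 : t * N (g w - g z) <= t * ((N a + 1) * N (w - z)).
  by apply: ler_wpM2l => //; exact: ltW.
have H2 : N b * N (g w - g z - a * (w - z)) <= N b * (t * N (w - z)).
  by apply: ler_wpM2l => //; exact: N_ge0.
apply: le_trans (lerD (le_trans B H1) H2) _.
have -> : t * ((N a + 1) * N (w - z)) + N b * (t * N (w - z)) =
  t * N (w - z) * (k - 1) by rewrite /k; ring.
rewrite (mulrAC t k) ler_wpM2l ?mulr_ge0 ?N_ge0 ?(ltW t0) //.
by rewrite gerBl.
Qed.

Lemma cderivV z : z != 0 -> cderiv (fun w => w^-1) z (- (z^-1 ^+ 2)).
Proof.
move=> z0 e e0.
have nz : 0 < N z by rewrite N_gt0.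
have d1 : 0 < N z / 2 by rewrite divr_gt0.
have d2 : 0 < e * (N z ^+ 3 / 2) by rewrite mulr_gt0 // divr_gt0 // exprn_gt0.
apply: filterS2 (near_disc z d1) (near_disc z d2) => w A B.
have wn : N z / 2 <= N w.
  have := N_rev z w; rewrite NBC => H; have := le_lt_trans H A.
  by move=> ?; rewrite ltW //; lra.
have w0 : w != 0 by rewrite -N_gt0; apply: lt_le_trans wn.
(* The remainder is exactly [(w - z)^2 / (w z^2)], and [d1] has kept [|w|] above [|z| / 2]. *)
have -> : w^-1 - z^-1 - - z^-1 ^+ 2 * (w - z) = (w - z) * (w - z) * (w^-1 * z^-1 ^+ 2).
  by field; rewrite w0 z0.
have -> : N ((w - z) * (w - z) * (w^-1 * z^-1 ^+ 2)) =
  N (w - z) * ((N w)^-1 * (N z)^-1 ^+ 2) * N (w - z).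
  by rewrite !NM !NV; ring.
apply: ler_wpM2r; first exact: N_ge0.
 apply: le_trans (_ : N (w - z) * ((N z / 2)^-1 * (N z)^-1 ^+ 2) <= _).
  apply: ler_wpM2l; rewrite ?N_ge0 //; apply: ler_wpM2r; first by rewrite exprn_ge0 // invr_ge0 N_ge0.
  by rewrite lef_pV2 // posrE // N_gt0.
have -> : (N z / 2)^-1 * (N z)^-1 ^+ 2 = (N z ^+ 3 / 2)^-1.
  by field; rewrite gt_eqF.
by rewrite ler_pdivrMr ?divr_gt0 ?exprn_gt0 //; exact: ltW.
Qed.

Lemma cdiff_cst c z : cdiff (fun _ => c) z.
Proof. by exists 0; exact: cderiv_cst. Qed.
Lemma cdiff_id z : cdiff id z. Proof. by exists 1; exact: cderiv_id. Qed.
Lemma cdiffD f g z : cdiff f z -> cdiff g z -> cdiff (fun w => f w + g w) z.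
Proof. by move=> [a ?] [b ?]; exists (a + b); apply: cderivD. Qed.
Lemma cdiffM f g z : cdiff f z -> cdiff g z -> cdiff (fun w => f w * g w) z.
Proof. by move=> [a ?] [b ?]; eexists; apply: cderivM; eassumption. Qed.
Lemma cdiff_comp f g z : cdiff g z -> cdiff f (g z) -> cdiff (fun w => f (g w)) z.
Proof. by move=> [a ?] [b ?]; eexists; apply: cderiv_comp; eassumption. Qed.
Lemma cdiffV g z : cdiff g z -> g z != 0 -> cdiff (fun w => (g w)^-1) z.
Proof.
by move=> hg g0; apply: (@cdiff_comp (fun w => w^-1) g) => //; eexists; exact: cderivV.
Qed.
Lemma cdiffN g z : cdiff g z -> cdiff (fun w => - g w) z.
Proof.
move=> hg; have := cdiffM (cdiff_cst (-1) z) hg.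
by congr cdiff; apply/funext => w; rewrite mulN1r.
Qed.
Lemma cdiffB f g z : cdiff f z -> cdiff g z -> cdiff (fun w => f w - g w) z.
Proof. by move=> hf hg; apply: cdiffD => //; apply: cdiffN. Qed.
Lemma cdiff_div f g z : cdiff f z -> cdiff g z -> g z != 0 ->
  cdiff (fun w => f w / g w) z.
Proof. by move=> hf hg g0; apply: cdiffM => //; apply: cdiffV. Qed.

Lemma derivable_cdiff f z : derivable f z 1 -> cdiff f z.
Proof.
move=> /cvg_ex[/= d /cvgCC H]; exists d => e e0.
have /nbhs_discP[r r0 D] := H e e0.
apply/nbhs_discP; exists r => // w wr.
have [->|wz] := eqVneq w z; first by rewrite !subrr mulr0 subrr N0 mulr0.
have wz0 : w - z != 0 by rewrite subr_eq0.
have : N ((w - z)^-1 *: (f ((w - z) *: 1 + z) - f z) - d) < e.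
  by apply: D => //; rewrite /disc /= subr0.
have -> : (w - z) *: (1 : C) + z = w by rewrite /GRing.scale /= mulr1 subrK.
rewrite /GRing.scale /= => K.
have -> : f w - f z - d * (w - z) = ((w - z)^-1 * (f w - f z) - d) * (w - z).
  by field.
by rewrite NM ler_wpM2r ?N_ge0 // ltW.
Qed.

End ComplexDerivative.

(** * The exponential and a branch of the logarithm *)

Section ComplexExponential.
Context {R : realType}.
Local Notation C := R[i].
Implicit Types (a b z w : C).

Lemma is_derive_approx (f : R -> R) (x d : R) : is_derive x 1 f d ->
  forall e, 0 < e ->
  exists2 r, 0 < r & forall s, `|s| < r -> `|f (s + x) - f x - d * s| <= e * `|s|.
Proof.
move=> [/cvg_ex[/= l H] <-] e e0.
have E : 'D_1 f x = l by exact: cvg_lim H.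
move/cvgrPdist_lt: H => /(_ e e0)/nbhs_ballP[r /= r0 D].
exists r => // s sr; rewrite E.
have [->|s0] := eqVneq s 0; first by rewrite add0r subrr mulr0 subrr normr0 mulr0.
have : `|l - s^-1 *: (f (s *: 1 + x) - f x)| < e.
  by apply: D => //=; rewrite /ball /= sub0r normrN.
have -> : s *: (1 : R) + x = s + x by rewrite /GRing.scale /= mulr1.
rewrite /GRing.scale /= distrC => K.
have -> : f (s + x) - f x - l * s = (s^-1 * (f (s + x) - f x) - l) * s by field.
by rewrite normrM ler_wpM2r // ltW.
Qed.

Definition cexp z : C := (expR (Re z) * cos (Im z)) +i* (expR (Re z) * sin (Im z)).

Lemma cexp0 : cexp 0 = 1.
Proof. by rewrite /cexp /= expR0 cos0 sin0 !mul1r. Qed.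

Lemma cexpD a b : cexp (a + b) = cexp a * cexp b.
Proof.
by apply: complexP; rewrite !ReImE /cexp /= !ReImE expRD ?cosD ?sinD; ring.
Qed.

Lemma N_cexp z : N (cexp z) = expR (Re z).
Proof.
rewrite /cexp /= !exprMn -mulrDr cos2Dsin2 mulr1 sqrtr_sqr ger0_norm //.
Qed.

Lemma cexp_neq0 z : cexp z != 0.
Proof. by rewrite -N_gt0 N_cexp expR_gt0. Qed.

Lemma cderiv_cexp0 : cderiv cexp 0 1.
Proof.
(* The error terms below add up to [7 * t * N w]. *)
move=> e e0; pose t := Num.min (e / 8) 1.
have t0 : 0 < t by rewrite lt_min divr_gt0 //=.
have t1 : t <= 1 by rewrite ge_min lexx orbT.
have te : t <= e / 8 by rewrite ge_min lexx.
have [r1 r10 H1] := is_derive_approx (is_derive_expR (0 : R)) t0.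
have [r2 r20 H2] := is_derive_approx (is_derive_cos (0 : R)) t0.
have [r3 r30 H3] := is_derive_approx (is_derive_sin (0 : R)) t0.
apply: filterS2 (filterI (near_disc 0 r10) (near_disc 0 r20))
  (filterI (near_disc 0 r30) (near_disc 0 t0)) => w [].
rewrite /disc /= !subr0 => A1 A2 [A3 A4].
have rew := Re_le_N w; have imw := Im_le_N w.
have {}H1 := H1 (Re w) (le_lt_trans rew A1).
have {}H2 := H2 (Im w) (le_lt_trans imw A2).
have {}H3 := H3 (Im w) (le_lt_trans imw A3).
move: H1 H2 H3; rewrite !addr0 expR0 mul1r cos0 sin0 oppr0 mul0r !subr0 !mul1r ?addr0 => H1 H2 H3.
apply: le_trans (N_le_ReIm _) _; rewrite cexp0 !ReImE /cexp /= !oppr0 !addr0.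
have -> : expR (Re w) * cos (Im w) + -1 - Re w =
  (expR (Re w) - 1 - Re w) * cos (Im w) + (1 + Re w) * (cos (Im w) - 1) by ring.
have -> : expR (Re w) * sin (Im w) - Im w =
  (expR (Re w) - 1 - Re w) * sin (Im w) + Re w * sin (Im w) + (sin (Im w) - Im w) by ring.
have nw := N_ge0 w.
have c1 : `|cos (Im w)| <= 1 by rewrite ler_norml cos_geN1 cos_le1.
have s1 : `|sin (Im w)| <= 1 by rewrite ler_norml sin_geN1 sin_le1.
have H1' : `|expR (Re w) - 1 - Re w| <= t * N w.
  by apply: le_trans H1 _; rewrite ler_wpM2l // ltW.
have H2' : `|cos (Im w) - 1| <= t * N w.
  by apply: le_trans H2 _; rewrite ler_wpM2l // ltW.
have H3' : `|sin (Im w) - Im w| <= t * N w.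
  by apply: le_trans H3 _; rewrite ler_wpM2l // ltW.
have q1 : `|1 + Re w| <= 2.
  apply: le_trans (ler_normD _ _) _; rewrite normr1.
  by have := le_trans rew (le_trans (ltW A4) t1); lra.
have re1 : `|Re w| <= t by apply: le_trans rew (ltW A4).
have sw : `|sin (Im w)| <= 2 * N w.
  have -> : sin (Im w) = (sin (Im w) - Im w) + Im w by ring.
  apply: le_trans (ler_normD _ _) _.
  have : t * N w <= N w by rewrite ler_piMl.
  lra.
have B1 : `|(expR (Re w) - 1 - Re w) * cos (Im w)| <= t * N w.
  by rewrite normrM -[leRHS]mulr1; apply: ler_pM.
have B2 : `|(1 + Re w) * (cos (Im w) - 1)| <= 2 * (t * N w).
  by rewrite normrM; apply: ler_pM.
have B3 : `|(expR (Re w) - 1 - Re w) * sin (Im w)| <= t * N w.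
  by rewrite normrM -[leRHS]mulr1; apply: ler_pM.
have B4 : `|Re w * sin (Im w)| <= t * (2 * N w) by rewrite normrM; apply: ler_pM.
apply: le_trans (lerD (ler_normD _ _) (ler_normD _ _)) _.
apply: le_trans (lerD (lerD B1 B2) (lerD (ler_normD _ _) H3')) _.
apply: le_trans (lerD (lexx _) (lerD (lerD B3 B4) (lexx _))) _.
have := ler_wpM2r nw te; have := mulr_ge0 (ltW e0) nw; lra.
Qed.

Lemma cderiv_cexp z : cderiv cexp z (cexp z).
Proof.
have H : cderiv (fun w => w - z) z (1 + 0) by apply: cderivD; [exact: cderiv_id|exact: cderiv_cst].
have H1 : cderiv (fun w => cexp (w - z)) z (1 * (1 + 0)).
  by apply: (cderiv_comp H); rewrite subrr; exact: cderiv_cexp0.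
have := cderivM (cderiv_cst (cexp z) z) H1.
rewrite mul0r add0r !mul1r addr0 mulr1; apply: near_cderiv; near=> w.
by rewrite -cexpD addrC subrK.
Unshelve. all: by end_near. Qed.

Lemma cdiff_cexp z : cdiff cexp z.
Proof. by exists (cexp z); exact: cderiv_cexp. Qed.

(** The [atan] formula is the principal argument in the right half-plane only; it is applied to
    quotients within distance 1 of 1. *)
Definition clog z : C := ln (N z) +i* atan (Im z / Re z).

Lemma clogK z : 0 < Re z -> cexp (clog z) = z.
Proof.
move=> x0; have nz : 0 < N z.
  by rewrite N_gt0; apply: contraTneq x0 => ->; rewrite ltxx.
have E : Num.sqrt (1 + (Im z / Re z) ^+ 2) = N z / Re z.
  rewrite -[RHS]ger0_norm ?divr_ge0 ?N_ge0 ?(ltW x0)// -sqrtr_sqr; congr Num.sqrt.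
  by rewrite !expr_div_n N_sqr; field; rewrite gt_eqF.
have c : cos (atan (Im z / Re z)) = Re z / N z by rewrite cos_atan E invf_div.
have c0 : cos (atan (Im z / Re z)) != 0.
  by rewrite c mulf_neq0 ?invr_eq0 ?gt_eqF.
have s : sin (atan (Im z / Re z)) = Im z / N z.
  have := atanK (Im z / Re z); rewrite /tan => /(congr1 ( *%R^~ (cos (atan (Im z / Re z))))).
  rewrite divfK // c => ->; field.
  by rewrite !gt_eqF.
apply: complexP; rewrite /cexp /clog /= lnK ?posrE // ?c ?s; field; exact: lt0r_neq0.
Qed.

Lemma continuous_clog z : 0 < Re z -> {for z, continuous clog}.
Proof.
move=> x0; have nz : 0 < N z.
  by rewrite N_gt0; apply: contraTneq x0 => ->; rewrite ltxx.
apply: (@cvg_complex _ _ (nbhs z) (nbhs_filter z)).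
  apply: (@continuous_comp _ _ _ (@Normc.normc R) (@ln R)).
    exact: continuous_N.
  exact: continuous_ln.
apply: (@continuous_comp _ _ _ (fun w : C => Im w / Re w) (@atan R)).
  apply: (@cvgM _ _ (nbhs z) (nbhs_filter z) (fun w : C => Im w) (fun w => (Re w)^-1)).
    exact: continuous_Im.
  apply: (@cvgV _ _ (nbhs z) (nbhs_filter z)); first by rewrite gt_eqF.
  exact: continuous_Re.
exact: continuous_atan.
Qed.

(** Inverse function rule: the estimate for [cexp] at [clog z] has an error proportional to the
    increment [l] of [clog]. With [t <= 1 / 2] that error is absorbed, [N l] is at most
    [2 * N (w - z) / N z], and the error becomes one in [w - z]. *)
Lemma cderiv_clog z : 0 < Re z -> cderiv clog z z^-1.
Proof.
move=> x0; have nz : z != 0 by apply: contraTneq x0 => ->; rewrite ltxx.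
have Nz : 0 < N z by rewrite N_gt0.
move=> e e0.
pose t := Num.min (1 / 2) (e * N z / 2).
have t0 : 0 < t by rewrite lt_min !divr_gt0 // mulr_gt0.
have t1 : t <= 1 / 2 by rewrite ge_min lexx.
have te : t <= e * N z / 2 by rewrite ge_min lexx orbT.
have cl : clog x @[x --> z] --> clog z := continuous_clog x0.
have A : \forall w \near z, N (cexp (clog w) - cexp (clog z) - cexp (clog z) * (clog w - clog z)) <= t * N z * N (clog w - clog z).
  by apply: (cl _ (@cderiv_cexp (clog z) (t * N z) _)); rewrite mulr_gt0.
have Re0 : \forall w \near z, 0 < Re w.
  have /contC H := @continuous_Re R z.
  have [d d0 D] := H _ x0; apply/nbhs_discP; exists d => // w /D.
  by rewrite ltr_norml => /andP[]; lra.
apply: filterS2 A Re0 => w + rw.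
rewrite !clogK // => A.
set l := clog w - clog z in A *.
have El : z^-1 * (w - z - z * l) = - (l - z^-1 * (w - z)) by field.
have B : N (l - z^-1 * (w - z)) <= t * N l.
  rewrite -NN -El NM NV mulrC ler_pdivrMr //.
  by apply: le_trans A _; rewrite mulrAC.
have C1 : N l <= 2 * ((N z)^-1 * N (w - z)).
  have : N l <= N (l - z^-1 * (w - z)) + N (z^-1 * (w - z)).
    by apply: le_trans (ler_N _ _); rewrite subrK.
  rewrite (NM z^-1) NV.
  have := N_ge0 l.
  have : t * N l <= 1 / 2 * N l by rewrite ler_wpM2r ?N_ge0.
  move: ((N z)^-1 * N (w - z)) => q; lra.
apply: le_trans B _; apply: le_trans (ler_wpM2l (ltW t0) C1) _.
have := ler_wpM2r (N_ge0 (w - z)) te.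
have -> : t * (2 * ((N z)^-1 * N (w - z))) = t * N (w - z) * (2 / N z) by ring.
move=> H; have := ler_wpM2r (_ : 0 <= 2 / N z) H.
rewrite divr_ge0 ?N_ge0 // => /(_ isT) /le_trans; apply.
by rewrite le_eqVlt; apply/orP; left; apply/eqP; field; rewrite gt_eqF.
Qed.

Lemma cdiff_clog z : 0 < Re z -> cdiff clog z.
Proof. by exists z^-1; exact: cderiv_clog. Qed.

(** The bound on the argument makes the later estimates uniform over all points of a circle. *)
Lemma polar z : z != 0 -> exists2 t : R, `|t| <= pi & z = cexp (ln (N z) +i* t).
Proof.
move=> z0; have nz : 0 < N z by rewrite N_gt0.
pose x := Re z / N z; pose y := Im z / N z.
have xy : x ^+ 2 + y ^+ 2 = 1.
  by rewrite /x /y !expr_div_n -mulrDl -N_sqr divff // expf_neq0 // gt_eqF.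
have x1 : -1 <= x <= 1.
  by rewrite -ler_norml -(expr_le1 (n:=2)) // real_normK ?num_real// -xy lerDl sqr_ge0.
have sy : Num.sqrt (1 - x ^+ 2) = `|y|.
  by rewrite -xy addrAC subrr add0r sqrtr_sqr.
have E t : cos t = x -> sin t = y -> z = cexp (ln (N z) +i* t).
  move=> c s; apply: complexP; rewrite /cexp /= lnK ?posrE // ?c ?s /x /y mulrC divfK //.
    by rewrite gt_eqF.
  by rewrite gt_eqF.
have p0 := acos_ge0 x1; have p1 := acos_lepi x1.
have [y0|y0] := leP 0 y.
  exists (acos x); first by rewrite ger0_norm.
  by apply: E; rewrite ?acosK ?in_itv //= sin_acos // sy ger0_norm.
exists (- acos x); first by rewrite normrN ger0_norm.
by apply: E; rewrite ?cosN ?sinN ?acosK ?in_itv //= sin_acos // sy ltr0_norm ?opprK.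
Qed.

End ComplexExponential.

(** * Mean value property and maximum principle *)

Section IntervalIntegral.
Context {R : realType}.
Local Notation mu := (@lebesgue_measure R).
Implicit Types (a b c m r s t : R) (k l : R -> R).

Definition Int a b k : R := \int[mu]_(t in `[a, b]) k t.

Definition ig a b k := mu.-integrable `[a, b] (EFin \o k).

Lemma eq_eps a b : (forall e, 0 < e -> `|a - b| <= e) -> a = b.
Proof.
move=> H; apply/eqP; rewrite -subr_eq0 -normr_le0; apply/ler_addgt0Pr => e e0.
by rewrite add0r; exact: H.
Qed.

Lemma cont_ig a b k : (forall t, a <= t <= b -> {for t, continuous k}) -> ig a b k.
Proof.
move=> ck; apply: continuous_compact_integrable; first exact: segment_compact.
by apply: continuous_in_subspaceT => t /set_mem; rewrite /= in_itv /=; exact: ck.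
Qed.

Lemma igD a b k l : ig a b k -> ig a b l -> ig a b (fun t => k t + l t).
Proof. by move=> hk hl; apply: (integrableD _ hk hl). Qed.

Lemma igZ a b c k : ig a b k -> ig a b (fun t => c * k t).
Proof. by move=> hk; apply: (integrableZl _ c hk). Qed.

Lemma igN a b k : ig a b k -> ig a b (fun t => - k t).
Proof.
move=> hk; have := @igZ a b (-1) k hk; congr ig; apply/funext => t.
by rewrite mulN1r.
Qed.

Lemma igB a b k l : ig a b k -> ig a b l -> ig a b (fun t => k t - l t).
Proof. by move=> hk hl; apply: igD => //; exact: igN. Qed.

Lemma ig_cst a b c : ig a b (fun _ => c).
Proof. by apply: cont_ig => t _; exact: cst_continuous. Qed.

Lemma IntD a b k l : ig a b k -> ig a b l ->
  Int a b (fun t => k t + l t) = Int a b k + Int a b l.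
Proof. by move=> hk hl; apply: RintegralD. Qed.

Lemma IntB a b k l : ig a b k -> ig a b l ->
  Int a b (fun t => k t - l t) = Int a b k - Int a b l.
Proof. by move=> hk hl; apply: RintegralB. Qed.

Lemma IntZ a b c k : ig a b k -> Int a b (fun t => c * k t) = c * Int a b k.
Proof. by move=> hk; apply: RintegralZl. Qed.

Lemma eq_Int a b k l : (forall t, a <= t <= b -> k t = l t) -> Int a b k = Int a b l.
Proof.
by move=> H; apply: eq_Rintegral => t /set_mem; rewrite /= in_itv /=; exact: H.
Qed.

Lemma Int_cst a b c : a <= b -> Int a b (fun _ => c) = c * (b - a).
Proof.
move=> ab; rewrite /Int Rintegral_cst //.
have E := @lebesgue_measure_itv R `[a, b]; rewrite /= lte_fin in E.
congr (c * _); transitivity (fine (if (a < b)%R then (b - a)%:E else 0%E)).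
  by congr fine; exact: E.
case: ltP => //= ba; suff -> : a = b by rewrite subrr.
by apply/eqP; rewrite eq_le ab ba.
Qed.

Lemma le_Int a b k l : ig a b k -> ig a b l ->
  (forall t, a <= t <= b -> k t <= l t) -> Int a b k <= Int a b l.
Proof.
move=> hk hl H; apply: le_Rintegral => // t; rewrite /= in_itv /=; exact: H.
Qed.

Lemma ig_norm a b k : ig a b k -> ig a b (fun t => `|k t|).
Proof. by move=> hk; apply: integrable_norm. Qed.

Lemma Int_norm a b k : ig a b k -> `|Int a b k| <= Int a b (fun t => `|k t|).
Proof. by move=> hk; apply: le_normr_Rintegral. Qed.

Lemma Int_bound a b k m : a <= b -> ig a b k ->
  (forall t, a <= t <= b -> `|k t| <= m) -> `|Int a b k| <= m * (b - a).
Proof.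
move=> ab hk H; apply: le_trans (Int_norm hk) _; rewrite -Int_cst //.
by apply: le_Int => //; [exact: ig_norm|exact: ig_cst].
Qed.

Lemma Int_approx a b k c m : a <= b -> ig a b k ->
  (forall t, a <= t <= b -> `|k t - c| <= m) ->
  `|Int a b k - c * (b - a)| <= m * (b - a).
Proof.
move=> ab hk H; rewrite -Int_cst // -IntB //; last exact: ig_cst.
by apply: Int_bound => //; apply: igB => //; exact: ig_cst.
Qed.

Lemma Int_split a m b k : a <= m <= b -> ig a b k -> Int a b k = Int a m k + Int m b k.
Proof.
move=> /andP[am mb] hk.
have := @Rintegral_itvB R k (BLeft a) (BRight b) m hk.
rewrite !bnd_simp => /(_ am mb) /eqP; rewrite subr_eq => /eqP E.
rewrite /Int E addrC; congr (_ + _).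
rewrite Rintegral_itv_obnd_cbnd //.
by apply: integrableS hk => //; apply: subset_itv; rewrite bnd_simp.
Qed.

End IntervalIntegral.

(** Arithmetic for the choice of [e] in [goursat_rect]; the [+ 1] keeps the denominator positive for
    a degenerate rectangle. *)
Lemma quarter_bound {R : realFieldType} (J a : R) : 0 < J -> 0 <= a ->
  2 * (J / (4 * (a + 1) ^+ 2)) * a ^+ 2 < J.
Proof.
move=> J0 a0; have a1 : 0 < (a + 1) ^+ 2 by rewrite exprn_gt0 // ltr_wpDl.
have -> : 2 * (J / (4 * (a + 1) ^+ 2)) * a ^+ 2 = J * (a ^+ 2 / (2 * (a + 1) ^+ 2)).
  by field; rewrite gt_eqF // ltr_wpDl.
by rewrite gtr_pMr // ltr_pdivrMr ?mul1r; [nra|exact: mulr_gt0].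
Qed.

(** * Goursat's theorem on a rectangle *)

Section Goursat.
Context {R : realType}.
Implicit Types (P Q : R -> R -> R) (s t w h : R).

(* [P ds + Q dt] is closed to first order at [(s0, t0)]. *)
Definition closed_at P Q s0 t0 := exists A B D : R, forall e, 0 < e ->
  exists2 r, 0 < r & forall s t, `|s - s0| < r -> `|t - t0| < r ->
    `|P s t - P s0 t0 - A * (s - s0) - B * (t - t0)| <= e * (`|s - s0| + `|t - t0|) /\
    `|Q s t - Q s0 t0 - B * (s - s0) - D * (t - t0)| <= e * (`|s - s0| + `|t - t0|).

Lemma lin_cont (k : R -> R) x0 A :
  (exists2 r, 0 < r & forall x, `|x - x0| < r -> `|k x - k x0 - A * (x - x0)| <= `|x - x0|) ->
  {for x0, continuous k}.
Proof.
move=> [r r0 H]; apply/(@cvgrPdist_lt _ _ _ (nbhs x0) (nbhs_filter x0)) => e e0.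
have k0 : 0 < `|A| + 1 by rewrite ltr_wpDl.
have q0 : 0 < e / (`|A| + 1) by rewrite divr_gt0.
near=> x; rewrite distrC.
have xr : `|x - x0| < r.
  by rewrite distrC; near: x; apply: cvgr_dist_lt => //; exact: cvg_id.
have xe : `|x - x0| < e / (`|A| + 1).
  by rewrite distrC; near: x; apply: cvgr_dist_lt => //; exact: cvg_id.
have -> : k x - k x0 = (k x - k x0 - A * (x - x0)) + A * (x - x0) by ring.
apply: le_lt_trans (ler_normD _ _) _.
apply: le_lt_trans (lerD (H x xr) (lexx _)) _; rewrite normrM.
have -> : `|x - x0| + `|A| * `|x - x0| = `|x - x0| * (`|A| + 1) by ring.
by rewrite -ltr_pdivlMr.
Unshelve. all: by end_near. Qed.

(** The integral of [P ds + Q dt] along the boundary, counterclockwise. *)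
Definition rect_form P Q s t w h :=
  Int s (s + w) (P ^~ t) - Int s (s + w) (P ^~ (t + h)) +
  (Int t (t + h) (Q (s + w)) - Int t (t + h) (Q s)).

Section Rect.
Variables (P Q : R -> R -> R) (s0 t0 w0 h0 : R).
Hypothesis w00 : 0 <= w0.
Hypothesis h00 : 0 <= h0.
Hypothesis cl : forall s t, s0 <= s <= s0 + w0 -> t0 <= t <= t0 + h0 -> closed_at P Q s t.

Let Pig s t w : s0 <= s -> s + w <= s0 + w0 -> t0 <= t <= t0 + h0 -> ig s (s + w) (P ^~ t).
Proof.
move=> sl sr th; apply: cont_ig => x /andP[x1 x2].
have [|A [B [D H]]] := @cl x t _ th; first by rewrite (le_trans sl x1) (le_trans x2 sr).
apply: (@lin_cont _ _ A); have [r r0 K] := H 1 ltr01; exists r => // y yr.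
have [] := K y t yr; first by rewrite subrr normr0.
by rewrite subrr normr0 mulr0 subr0 addr0 mul1r.
Qed.

Let Qig s t h : t0 <= t -> t + h <= t0 + h0 -> s0 <= s <= s0 + w0 -> ig t (t + h) (Q s).
Proof.
move=> tl tr sh; apply: cont_ig => x /andP[x1 x2].
have [|A [B [D H]]] := @cl s x sh; first by rewrite (le_trans tl x1) (le_trans x2 tr).
apply: (@lin_cont _ _ D); have [r r0 K] := H 1 ltr01; exists r => // y yr.
have [|_] := K s y _ yr; first by rewrite subrr normr0.
by rewrite subrr normr0 mulr0 subr0 add0r mul1r.
Qed.

Let inside s t w h := [/\ 0 <= w, 0 <= h, s0 <= s /\ s + w <= s0 + w0 &
   t0 <= t /\ t + h <= t0 + h0].

(** The integrals over the inner edges of the four quarters cancel. *)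
Let rect_split s t w h : inside s t (w * 2) (h * 2) ->
  rect_form P Q s t (w * 2) (h * 2) =
  rect_form P Q s t w h + rect_form P Q (s + w) t w h +
  (rect_form P Q s (t + h) w h + rect_form P Q (s + w) (t + h) w h).
Proof.
move=> [w2 h2 [s1 s2] [t1 t2]]; rewrite /rect_form.
have w0' : 0 <= w by lra.
have h0' : 0 <= h by lra.
have -> : s + w * 2 = s + w + w by ring.
have -> : t + h * 2 = t + h + h by ring.
rewrite (@Int_split _ s (s + w) (s + w + w) (P ^~ t)); last 2 first.
- by apply/andP; split; lra.
- by rewrite -addrA; apply: Pig; lra.
rewrite (@Int_split _ s (s + w) (s + w + w) (P ^~ (t + h + h))); last 2 first.
- by apply/andP; split; lra.
- by rewrite -(addrA s); apply: Pig; lra.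
rewrite (@Int_split _ t (t + h) (t + h + h) (Q s)); last 2 first.
- by apply/andP; split; lra.
- by rewrite -(addrA t); apply: Qig; lra.
rewrite (@Int_split _ t (t + h) (t + h + h) (Q (s + w + w))); last 2 first.
- by apply/andP; split; lra.
- by rewrite -(addrA t); apply: Qig; lra.
ring.
Qed.

(* The linear parts of [P] and [Q] contribute [- B h w] and [B w h]. *)
Let rect_small s t w h x y e A B D : inside s t w h ->
  s <= x <= s + w -> t <= y <= t + h -> 0 < e ->
  (forall u v, s <= u <= s + w -> t <= v <= t + h ->
    `|P u v - P x y - A * (u - x) - B * (v - y)| <= e * (`|u - x| + `|v - y|) /\
    `|Q u v - Q x y - B * (u - x) - D * (v - y)| <= e * (`|u - x| + `|v - y|)) ->
  `|rect_form P Q s t w h| <= 2 * e * (w + h) ^+ 2.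
Proof.
move=> [w0' h0' [s1 s2] [t1 t2]] /andP[x1 x2] /andP[y1 y2] e0 H.
have near_P u v : s <= u <= s + w -> t <= v <= t + h ->
  `|P u v - P x y - A * (u - x) - B * (v - y)| <= e * (w + h).
  move=> hu hv; have [H1 _] := H u v hu hv; apply: le_trans H1 _.
  rewrite ler_pM2l //; move: hu hv => /andP[? ?] /andP[? ?].
  by apply: lerD; rewrite ler_norml; apply/andP; split; lra.
have near_Q u v : s <= u <= s + w -> t <= v <= t + h ->
  `|Q u v - Q x y - B * (u - x) - D * (v - y)| <= e * (w + h).
  move=> hu hv; have [_ H1] := H u v hu hv; apply: le_trans H1 _.
  rewrite ler_pM2l //; move: hu hv => /andP[? ?] /andP[? ?].
  by apply: lerD; rewrite ler_norml; apply/andP; split; lra.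
have P1 : ig s (s + w) (P ^~ t) by apply: Pig; lra.
have P2 : ig s (s + w) (P ^~ (t + h)) by apply: Pig; lra.
have Q1 : ig t (t + h) (Q (s + w)) by apply: Qig; lra.
have Q2 : ig t (t + h) (Q s) by apply: Qig; lra.
rewrite /rect_form -!IntB //.
have sw : s <= s + w by lra.
have th : t <= t + h by lra.
have I1 : `|Int s (s + w) (fun u => P u t - P u (t + h)) - (- B * h) * (s + w - s)|
  <= (2 * e * (w + h)) * (s + w - s).
  apply: Int_approx => //; first exact: igB.
  move=> u hu; have := near_P u t hu; rewrite lexx th => /(_ isT) k1.
  have := near_P u (t + h) hu; rewrite lexx th => /(_ isT) k2.
  have -> : P u t - P u (t + h) - - B * h =
    (P u t - P x y - A * (u - x) - B * (t - y)) -
    (P u (t + h) - P x y - A * (u - x) - B * (t + h - y)) by ring.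
  by apply: le_trans (ler_normB _ _) _; lra.
have I2 : `|Int t (t + h) (fun v => Q (s + w) v - Q s v) - (B * w) * (t + h - t)|
  <= (2 * e * (w + h)) * (t + h - t).
  apply: Int_approx => //; first exact: igB.
  move=> v hv; have := near_Q s v; rewrite lexx sw => /(_ isT hv) k1.
  have := near_Q (s + w) v; rewrite lexx sw => /(_ isT hv) k2.
  have -> : Q (s + w) v - Q s v - B * w =
    (Q (s + w) v - Q x y - B * (s + w - x) - D * (v - y)) -
    (Q s v - Q x y - B * (s - x) - D * (v - y)) by ring.
  by apply: le_trans (ler_normB _ _) _; lra.
move: I1 I2; set I1 := Int s _ _; set I2 := Int t _ _ => H1 H2.
have -> : I1 + I2 = (I1 - - B * h * (s + w - s)) + (I2 - B * w * (t + h - t)) by ring.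
apply: le_trans (ler_normD _ _) _; apply: le_trans (lerD H1 H2) _.
by rewrite le_eqVlt; apply/orP; left; apply/eqP; ring.
Qed.

(** Goursat's bisection. Of a nonzero integral, some quarter always carries at least a fourth; the
    nested quarters shrink to a point, where closedness to first order makes the integral small
    compared with the square of the side, that is, with [1 / 4 ^ n]. *)
Lemma goursat_rect : rect_form P Q s0 t0 w0 h0 = 0.
Proof.
apply/eqP; rewrite -normr_eq0; apply/negPn/negP => J0.
have {}J0 : 0 < `|rect_form P Q s0 t0 w0 h0| by rewrite lt_def normr_ge0 J0.
set J := `|_| in J0.
pose W n := w0 / 2 ^+ n; pose H n := h0 / 2 ^+ n.
have W0 n : 0 <= W n by rewrite divr_ge0 // exprn_ge0.
have H0 n : 0 <= H n by rewrite divr_ge0 // exprn_ge0.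
have W2 n : W n = W n.+1 * 2 by rewrite /W exprS invfM; field; rewrite expf_neq0.
have H2 n : H n = H n.+1 * 2 by rewrite /H exprS invfM; field; rewrite expf_neq0.
pose bad n (p : R * R) := inside p.1 p.2 (W n) (H n) /\
  J / 4 ^+ n <= `|rect_form P Q p.1 p.2 (W n) (H n)|.
(* The hypothesis [bad] sits inside the existential, so that [choice] gives a selection function
   defined on all pairs. *)
have step (np : nat * (R * R)) : exists q : R * R, bad np.1 np.2 -> bad np.1.+1 q /\
  (np.2.1 <= q.1 <= np.2.1 + W np.1.+1 /\ np.2.2 <= q.2 <= np.2.2 + H np.1.+1).
  case: np => n [s t] /=; have [bd|nb] := pselect (bad n (s, t)); last first.
    by exists (0, 0) => /nb.
  suff [q Hq] : exists q, bad n.+1 q /\ (s <= q.1 <= s + W n.+1 /\ t <= q.2 <= t + H n.+1).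
    by exists q.
  case: bd => ins /=; have := W2 n; have := H2 n.
  have := W0 n.+1; have := H0 n.+1; move: ins.
  rewrite /bad; move: (W n.+1) (H n.+1) => w h ins h0' w0' E1 E2.
  rewrite /= E1 E2 in ins *.
  rewrite (rect_split ins) => HJ.
  move: (ins) => [_ _ /= [? ?] [? ?]].
  have E4 : J / 4 ^+ n = J / 4 ^+ n.+1 * 4 by rewrite exprS invfM; field; rewrite expf_neq0.
  rewrite E4 in HJ.
  apply: contrapT => none.
  have small q1 q2 : s <= q1 <= s + w -> t <= q2 <= t + h ->
    `|rect_form P Q q1 q2 w h| < J / 4 ^+ n.+1.
    move=> /andP[? ?] /andP[? ?]; rewrite ltNge; apply/negP => K; apply: none.
    by exists (q1, q2); split; [split => //; split => //=; split; lra|split; apply/andP; split].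
  have := small s t; have := small (s + w) t; have := small s (t + h).
  have := small (s + w) (t + h).
  rewrite !lexx !lerDl w0' h0' => /(_ isT isT) k1 /(_ isT isT) k2 /(_ isT isT) k3 /(_ isT isT) k4.
  move: HJ; apply/negP; rewrite -ltNge.
  apply: le_lt_trans (ler_normD _ _) _.
  apply: le_lt_trans (lerD (ler_normD _ _) (ler_normD _ _)) _; lra.
have [f Hf] := choice step.
pose fix q n := if n is n'.+1 then f (n', q n') else (s0, t0).
have badq n : bad n (q n).
  elim: n => [|n IH]; last by case: (Hf (n, q n) IH).
  by rewrite /bad /W /H expr0 !divr1 /=; split=> //; split => //; split.
have q1 n m : (n <= m)%N -> (q n).1 <= (q m).1 /\ (q m).1 + W m <= (q n).1 + W n.
  move=> /subnK <-; elim: (m - n)%N => [|k IH]; first by rewrite add0n.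
  rewrite addSn; have [_ [/andP[/= A B] _]] := Hf (_, q (k + n)%N) (badq (k + n)%N).
  have := W2 (k + n)%N => /=; move: A B IH => /=; lra.
have q2 n m : (n <= m)%N -> (q n).2 <= (q m).2 /\ (q m).2 + H m <= (q n).2 + H n.
  move=> /subnK <-; elim: (m - n)%N => [|k IH]; first by rewrite add0n.
  rewrite addSn; have [_ [_ /andP[/= A B]]] := Hf (_, q (k + n)%N) (badq (k + n)%N).
  have := H2 (k + n)%N => /=; move: A B IH => /=; lra.
(* Nested intervals: the supremum of the left endpoints lies in all of them. *)
have lim (g : nat -> R) (V : nat -> R) : (forall n, 0 <= V n) ->
  (forall n m, (n <= m)%N -> g n <= g m /\ g m + V m <= g n + V n) ->
  exists x, forall n, g n <= x <= g n + V n.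
  move=> V0 gV; exists (sup (range g)) => n.
  have ub k : g k <= g n + V n.
    have [nk|/ltnW kn] := leqP n k.
      by have [_] := gV _ _ nk; have := V0 k; lra.
    by have [+ _] := gV _ _ kn; have := V0 n; lra.
  have hs : has_sup (range g).
    by split; [exists (g n); exists n|exists (g n + V n) => _ [k _ <-]].
  apply/andP; split; first by apply: ub_le_sup; [exact: hs.2|exists n].
  by apply: ge_sup; [exact: hs.1|move=> _ [k _ <-]].
have [x Hx] := lim (fun n => (q n).1) W W0 q1.
have [y Hy] := lim (fun n => (q n).2) H H0 q2.
have [A [B [D HA]]] : closed_at P Q x y.
  apply: cl; first by have := Hx 0%N; rewrite /W expr0 divr1.
  by have := Hy 0%N; rewrite /H expr0 divr1.
have wh : 0 < w0 + h0 + 1 by rewrite ltr_wpDl // addr_ge0.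
have wW : w0 <= w0 + h0 + 1 by rewrite -addrA lerDl addr_ge0.
have hW : h0 <= w0 + h0 + 1 by rewrite addrAC lerDr addr_ge0.
pose e := J / (4 * (w0 + h0 + 1) ^+ 2).
have e0 : 0 < e by rewrite divr_gt0 // mulr_gt0 // exprn_gt0.
have [r r0 Hr] := HA e e0.
have [n Hn] : exists n, (w0 + h0 + 1) / 2 ^+ n < r.
  have k0 : 0 <= (w0 + h0 + 1) / r by rewrite divr_ge0 // ltW.
  exists (Num.bound ((w0 + h0 + 1) / r)).
  rewrite ltr_pdivrMr ?exprn_gt0 // mulrC -ltr_pdivrMr //.
  apply: lt_le_trans (archi_boundP k0) _.
  by rewrite -natrX ler_nat ltnW // ltn_expl.
have [ins HJ] := badq n.
have := @rect_small (q n).1 (q n).2 (W n) (H n) x y e A B D ins (Hx n) (Hy n) e0.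
have p2 : 0 < (2 : R) ^+ n by rewrite exprn_gt0.
have WHr : W n < r /\ H n < r.
  by split; apply: le_lt_trans Hn; rewrite ler_pM2r ?invr_gt0 // (wW, hW).
case: WHr => Wr Hrr.
have {}Hx := Hx n; have {}Hy := Hy n.
have sml u v : (q n).1 <= u <= (q n).1 + W n -> (q n).2 <= v <= (q n).2 + H n ->
    `|P u v - P x y - A * (u - x) - B * (v - y)| <= e * (`|u - x| + `|v - y|) /\
    `|Q u v - Q x y - B * (u - x) - D * (v - y)| <= e * (`|u - x| + `|v - y|).
  move=> /andP[u1 u2] /andP[v1 v2]; move: Hx Hy => /andP[x1 x2] /andP[y1 y2].
  apply: Hr; rewrite ltr_norml; apply/andP.
    by move: u1 u2 x1 x2 Wr; clear; split; lra.
  by move: v1 v2 y1 y2 Hrr; clear; split; lra.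
move=> /(_ sml); apply/negP; rewrite -ltNge; apply: lt_le_trans HJ.
have -> : W n + H n = (w0 + h0) / 2 ^+ n by rewrite /W /H mulrDl.
have -> : (4 : R) ^+ n = 2 ^+ n ^+ 2 by rewrite -exprM mulnC exprM expr2 -natrM.
rewrite expr_div_n mulrA ltr_pM2r ?invr_gt0 ?exprn_gt0 //.
by apply: quarter_bound => //; rewrite addr_ge0.
Qed.

End Rect.

End Goursat.

(** * Means over circles and the mean value property *)

Section CircleMean.
Context {R : realType}.
Local Notation C := R[i].
Implicit Types (c p z w : C) (r s t : R) (u v : C -> R) (U : set C).

Definition cmean u p r : R := (2 * pi)^-1 * Int 0 (2 * pi) (fun t => u (circle p r t)).

Lemma twopi_gt0 : 0 < 2 * pi :> R. Proof. by rewrite mulr_gt0 // pi_gt0. Qed.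

Lemma circleE p r t : 0 < r -> circle p r t = p + cexp (ln r +i* t).
Proof. by move=> r0; rewrite /circle /cexp /= lnK. Qed.

Lemma N_circle p r t : N (circle p r t - p) = `|r|.
Proof.
rewrite /circle addrAC subrr add0r /= !exprMn -mulrDr cos2Dsin2 mulr1.
exact: sqrtr_sqr.
Qed.

Lemma N_circle0 p r t : 0 <= r -> N (circle p r t - p) = r.
Proof. by move=> r0; rewrite N_circle ger0_norm. Qed.

Lemma continuous_circle p r : continuous (circle p r).
Proof.
move=> t; apply/cvgCC => e e0.
have H : (fun s => (r * cos s) +i* (r * sin s)) s @[s --> t] --> (r * cos t) +i* (r * sin t).
  apply: cvg_complex; (apply: cvgM; first exact: cvg_cst).
    exact: continuous_cos.
  exact: continuous_sin.
move/cvgCC: H => /(_ e e0); apply: filterS => s; congr (N _ < _).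
by rewrite /circle /=; ring.
Qed.

Lemma cont_circle u p r : (forall t, {for circle p r t, continuous u}) ->
  continuous (fun t => u (circle p r t)).
Proof.
move=> H t; apply: (@continuous_comp _ _ _ (circle p r) u) => //.
exact: continuous_circle.
Qed.

Lemma cont_circle_ig u p r : (forall t, {for circle p r t, continuous u}) ->
  ig 0 (2 * pi) (fun t => u (circle p r t)).
Proof. by move=> H; apply: cont_ig => t _; exact: cont_circle. Qed.

(** Cauchy's formula in the coordinates [p + exp (s + i t)]: [P ds + Q dt] is the imaginary part of
    [g(z) dz / (z - p)], closed in [(s, t)] and periodic in [t]. Goursat on [[s, ln r] x [0, 2 pi]]
    shows that the mean does not depend on the radius, and continuity at [p] evaluates it for small
    radii. *)
Lemma holo_mean (g : C -> C) p r0 r : 0 < r -> r < r0 ->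
  (forall z, disc p r0 z -> cdiff g z) -> cmean (fun z => Re (g z)) p r = Re (g p).
Proof.
move=> rp rr0 dg.
pose G (s t : R) : C := g (p + cexp (s +i* t)).
pose P s t := Im (G s t); pose Q s t := Re (G s t).
have cl s t : s <= ln r -> closed_at P Q s t.
  move=> sr.
  have inD : disc p r0 (p + cexp (s +i* t)).
    rewrite /disc /= addrAC subrr add0r N_cexp /=; apply: le_lt_trans rr0.
    by rewrite -[r]lnK ?posrE // ler_expR.
  have : cdiff (fun z => g (p + cexp z)) (s +i* t).
    apply: (@cdiff_comp _ g (fun z => p + cexp z)); last exact: dg.
    by apply: cdiffD; [exact: cdiff_cst|exact: cdiff_cexp].
  (* Cauchy-Riemann equations: the same coefficient [Re d] occurs in both expansions. *)
  move=> [d Hd]; exists (Im d), (Re d), (- Im d) => e e0.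
  have /nbhs_discP[k k0 D] := Hd e e0; exists (k / 2); first by rewrite divr_gt0.
  move=> s' t' hs ht.
  have Nst : N ((s' +i* t') - (s +i* t)) <= `|s' - s| + `|t' - t|.
    by apply: le_trans (N_le_ReIm _) _; rewrite !ReImE.
  have : disc (s +i* t) k (s' +i* t').
    by apply: le_lt_trans Nst _; rewrite (splitr k) ltrD.
  move=> /D H.
  have {}H := le_trans H (ler_wpM2l (ltW e0) Nst).
  split; apply: le_trans H.
    apply: le_trans (Im_le_N _); rewrite !ReImE /= -/(G s' t') -/(G s t).
    by rewrite le_eqVlt; apply/orP; left; apply/eqP; congr `|_|; rewrite /P; ring.
  apply: le_trans (Re_le_N _); rewrite !ReImE /= -/(G s' t') -/(G s t).
  by rewrite le_eqVlt; apply/orP; left; apply/eqP; congr `|_|; rewrite /Q; ring.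
have twopi0 := ltW twopi_gt0.
have per s : s <= ln r -> Int 0 (2 * pi) (Q s) = Int 0 (2 * pi) (Q (ln r)).
  move=> sr.
  have := @goursat_rect R P Q s 0 (ln r - s) (2 * pi) _ twopi0.
  rewrite subr_ge0 => /(_ sr) /(_ _)/= H.
  have {H} : rect_form P Q s 0 (ln r - s) (2 * pi) = 0.
    apply: H => s' t' /andP[_ sl] _; apply: cl; lra.
  rewrite /rect_form add0r (addrC s) subrK.
  have -> : P ^~ (2 * pi) = P ^~ 0.
    apply/funext => x; rewrite /P /G; congr (Im (g (p + _))).
    by rewrite /cexp /= mulr_natl cos2pi sin2pi cos0 sin0.
  by move: (Int s _ _) (Int 0 _ _) (Int 0 _ _) => X Y Z; clear; lra.
have igQ s : s <= ln r -> ig 0 (2 * pi) (Q s).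
  move=> sr; apply: cont_ig => x _.
  have [A [B [D H]]] := cl s x sr.
  apply: (@lin_cont _ _ _ D); have [k k0 K] := H 1 ltr01; exists k => // y yr.
  have [|_] := K s y _ yr; first by rewrite subrr normr0.
  by rewrite subrr normr0 mulr0 subr0 add0r mul1r.
have E : Int 0 (2 * pi) (Q (ln r)) = Re (g p) * (2 * pi).
  apply: eq_eps => e e0.
  have e1 : 0 < e / (2 * pi) by rewrite divr_gt0 // twopi_gt0.
  have [k k0 K] := (contCC _ _).1 (cdiff_cont (dg p (disc_center p (lt_trans rp rr0)))) _ e1.
  pose s := ln (Num.min r (k / 2)).
  have m0 : 0 < Num.min r (k / 2) by rewrite lt_min rp divr_gt0.
  have sr : s <= ln r by rewrite ler_ln ?posrE // ge_min lexx.
  rewrite -(per s sr) -{2}(subr0 (2 * pi)).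
  apply: le_trans (Int_approx (m := e / (2 * pi)) twopi0 (igQ s sr) _) _.
    move=> t _; rewrite /Q -ReN -ReD; apply: le_trans (Re_le_N _) _; apply/ltW/K.
    rewrite /disc /= addrAC subrr add0r N_cexp /= lnK // gt_min.
    by apply/orP; right; rewrite ltr_pdivrMr // ltr_pMr // ltr1n.
  by rewrite subr0 divfK // gt_eqF // twopi_gt0.
rewrite /cmean (_ : (fun t => _) = Q (ln r)); last first.
  by apply/funext => t; rewrite circleE.
by rewrite E mulrC mulfK // gt_eqF // twopi_gt0.
Qed.

(** The working notion of harmonicity. The radii may depend on the point, so the property is local
    and survives gluing; [mvp_harmonic] recovers the differential definition. *)
Definition mvp U u := forall z, U z ->
  {for z, continuous u} /\ \forall r \near (0 : R)^'+, u z = cmean u z r.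

Definition smvp U u := forall z, U z ->
  {for z, continuous u} /\ \forall r \near (0 : R)^'+, u z <= cmean u z r.

Lemma near_small (P : R -> Prop) d : 0 < d -> (forall r, 0 < r < d -> P r) ->
  \forall r \near (0 : R)^'+, P r.
Proof.
move=> d0 H; near=> r; apply: H; apply/andP; split; near: r.
  exact: nbhs_right_gt.
exact: nbhs_right_lt.
Unshelve. all: by end_near. Qed.

Lemma mvp_smvp U u : mvp U u -> smvp U u.
Proof.
by move=> H z /H[cu mu]; split=> //; apply: filterS mu => r ->.
Qed.

Lemma mvp_sub U V u : U `<=` V -> mvp V u -> mvp U u.
Proof. by move=> UV H z /UV/H. Qed.

Lemma open_disc U z : open U -> U z -> exists2 r, 0 < r & disc z r `<=` U.
Proof. by move=> /open_discP; apply. Qed.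

Lemma Re_mvp U (g : C -> C) : open U -> (forall z, U z -> cdiff g z) ->
  mvp U (fun z => Re (g z)).
Proof.
move=> oU dg z Uz; split.
  apply: (@continuous_comp _ _ _ g (@complex.Re R)); last exact: continuous_Re.
  exact: cdiff_cont (dg z Uz).
have [d d0 D] := open_disc oU Uz.
apply: (near_small d0) => r /andP[r0 rd].
by rewrite (@holo_mean g z d r) // => w /D; exact: dg.
Qed.

Lemma Im_mvp U (g : C -> C) : open U -> (forall z, U z -> cdiff g z) ->
  mvp U (fun z => Im (g z)).
Proof.
move=> oU dg; have -> : (fun z => Im (g z)) = (fun z => Re ((0 -i* 1) * g z)).
  by apply/funext => z; rewrite ReM /=; ring.
apply: Re_mvp => // z Uz; apply: cdiffM; [exact: cdiff_cst|exact: dg].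
Qed.

Lemma circle_near U z : open U -> U z -> \forall r \near (0 : R)^'+, forall t, U (circle z r t).
Proof.
move=> oU /(open_disc oU)[d d0 D]; apply: (near_small d0) => r /andP[r0 rd] t.
by apply: D; rewrite /disc /= N_circle gtr0_norm.
Qed.

Lemma near_mvp U u v : open U -> (forall z, U z -> u z = v z) -> mvp U u -> mvp U v.
Proof.
move=> oU E H z Uz; have [cu mu] := H z Uz; split.
  apply/contC => e e0; have [d d0 D] := (contC _ _).1 cu e e0.
  have [r r0 Ur] := open_disc oU Uz.
  exists (Num.min d r) => [|w wdr]; first by rewrite lt_min d0.
  rewrite -!E //; first by apply: D; apply: disc_sub wdr; rewrite ge_min lexx.
  by apply: Ur; apply: disc_sub wdr; rewrite ge_min lexx orbT.
apply: filterS2 mu (circle_near oU Uz) => r; rewrite E // => -> cU.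
by congr (_ * _); apply: eq_Int => t _; rewrite E.
Qed.

Lemma mvp_local U u : (forall z, U z -> exists2 V, open_nbhs z V & mvp V u) -> mvp U u.
Proof. by move=> H z /H[V [oV Vz] mV]; exact: mV. Qed.

Lemma mvp_cst U (k : R) : mvp U (fun _ => k).
Proof.
move=> z _; split; first exact: cst_continuous.
near=> r; rewrite /cmean Int_cst ?(ltW twopi_gt0) // subr0 mulrC mulfK //.
by rewrite gt_eqF // twopi_gt0.
Unshelve. all: by end_near. Qed.

Lemma mvpD U u v : open U -> mvp U u -> mvp U v -> mvp U (fun z => u z + v z).
Proof.
move=> oU hu hv z Uz; have [cu mu] := hu z Uz; have [cv mv] := hv z Uz; split.
  exact: (@cvgD _ _ _ (nbhs z) (nbhs_filter z)).
apply: filterS3 mu mv (circle_near oU Uz) => r -> -> cU.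
rewrite /cmean -mulrDr IntD //; apply: cont_circle_ig => t.
  by case: (hu _ (cU t)).
by case: (hv _ (cU t)).
Qed.

Lemma mvpZ U k u : open U -> mvp U u -> mvp U (fun z => k * u z).
Proof.
move=> oU hu z Uz; have [cu mu] := hu z Uz; split.
  by apply: (@cvgM _ _ (nbhs z) (nbhs_filter z)) => //; exact: cvg_cst.
apply: filterS2 mu (circle_near oU Uz) => r -> cU.
rewrite /cmean IntZ; first by rewrite mulrCA.
by apply: cont_circle_ig => t; case: (hu _ (cU t)).
Qed.

Lemma mvpN U u : open U -> mvp U u -> mvp U (fun z => - u z).
Proof.
move=> oU hu; apply: near_mvp (mvpZ (-1) oU hu) => // z _; by rewrite mulN1r.
Qed.

Lemma mvpB U u v : open U -> mvp U u -> mvp U v -> mvp U (fun z => u z - v z).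
Proof. by move=> oU hu hv; apply: mvpD => //; exact: mvpN. Qed.

Lemma smvpD U u v : open U -> smvp U u -> smvp U v -> smvp U (fun z => u z + v z).
Proof.
move=> oU hu hv z Uz; have [cu mu] := hu z Uz; have [cv mv] := hv z Uz; split.
  exact: (@cvgD _ _ _ (nbhs z) (nbhs_filter z)).
apply: filterS3 mu mv (circle_near oU Uz) => r h1 h2 cU.
apply: le_trans (lerD h1 h2) _; rewrite /cmean -mulrDr IntD //.
  by apply: cont_circle_ig => t; case: (hu _ (cU t)).
by apply: cont_circle_ig => t; case: (hv _ (cU t)).
Qed.

Lemma le_cmean u v z r : (forall t, {for circle z r t, continuous u}) ->
  (forall t, {for circle z r t, continuous v}) ->
  (forall t, u (circle z r t) <= v (circle z r t)) -> cmean u z r <= cmean v z r.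
Proof.
move=> cu cv uv; rewrite /cmean ler_pM2l ?invr_gt0 ?twopi_gt0 //.
by apply: le_Int => [||t _]; [exact: cont_circle_ig|exact: cont_circle_ig|exact: uv].
Qed.

Lemma cont_max u v z : {for z, continuous u} -> {for z, continuous v} ->
  {for z, continuous (fun w => Num.max (u w) (v w))}.
Proof.
move=> cu cv; have -> : (fun w => Num.max (u w) (v w)) = u \max v by [].
exact: continuous_max.
Qed.

Lemma smvp_max U u v : open U -> smvp U u -> smvp U v ->
  smvp U (fun z => Num.max (u z) (v z)).
Proof.
move=> oU hu hv z Uz; have [cu mu] := hu z Uz; have [cv mv] := hv z Uz; split.
  exact: cont_max.
apply: filterS3 mu mv (circle_near oU Uz) => r h1 h2 cU.
have cuU t : {for circle z r t, continuous u} by case: (hu _ (cU t)).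
have cvU t : {for circle z r t, continuous v} by case: (hv _ (cU t)).
rewrite ge_max; apply/andP; split.
  apply: le_trans h1 _; apply: le_cmean => // t; first exact: cont_max.
  by rewrite le_max lexx.
apply: le_trans h2 _; apply: le_cmean => // t; first exact: cont_max.
by rewrite le_max lexx orbT.
Qed.

(* Locally [ln |g|] is the real part of a branch of [log g]. *)
Lemma lnN_mvp U (g : C -> C) : open U -> (forall z, U z -> cdiff g z) ->
  (forall z, U z -> g z != 0) -> mvp U (fun z => ln (N (g z))).
Proof.
move=> oU dg g0; apply: mvp_local => z Uz.
have [d d0 D] := open_disc oU Uz.
have Ng : 0 < N (g z) by rewrite N_gt0 g0.
have [d1 d10 D1] := (contCC _ _).1 (cdiff_cont (dg z Uz)) _ Ng.
pose r := Num.min d d1.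
have r0 : 0 < r by rewrite lt_min d0.
have inU w : disc z r w -> U w by move=> wr; apply: D; apply: disc_sub wr; rewrite ge_min lexx.
have Re0 w : disc z r w -> 0 < Re (g w / g z).
  move=> wr; have {}wr : disc z d1 w by apply: disc_sub wr; rewrite ge_min lexx orbT.
  have := D1 w wr => H.
  have : N (g w / g z - 1) < 1.
    have -> : g w / g z - 1 = (g w - g z) / g z by field; exact: g0.
    by rewrite NM NV ltr_pdivrMr // mul1r.
  move=> /(le_lt_trans (Re_le_N _)); rewrite !ReImE /= ltr_norml => /andP[]; lra.
exists (disc z r); first by split; [exact: disc_open|exact: disc_center].
have oD : open (disc z r) by exact: disc_open.
have := mvpD oD (mvp_cst (U:=disc z r) (ln (N (g z)))) (@Re_mvp (disc z r) (fun w => clog (g w / g z)) oD _).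
move=> H; apply: near_mvp (H _) => //.
  move=> w wr /=; rewrite NM NV lnM ?posrE ?invr_gt0 //; last by rewrite N_gt0 g0 //; apply: inU.
  by rewrite lnV ?posrE // addrCA subrr addr0.
move=> w wr; apply: (@cdiff_comp _ _ (fun w => g w / g z)).
  apply: cdiffM; first by apply: dg; apply: inU.
  exact: cdiff_cst.
by apply: cdiff_clog; apply: Re0.
Qed.

End CircleMean.

Import HBNNSimple.

(** * Subharmonic functions and the maximum principle *)

Section MaximumPrinciple.
Context {R : realType}.
Local Notation C := R[i].
Local Notation mu := (@lebesgue_measure R).
Implicit Types (c p z w : C) (r s t : R) (u : C -> R) (v : C -> \bar R) (U : set C).

(* The integral of a nonnegative function is a supremum over the simple functions
   below it, measurable or not. *)
Lemma integral_mono d (T : measurableType d) (m : {measure set T -> \bar R})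
    (D : set T) (f g : T -> \bar R) : (forall x, D x -> (f x <= g x)%E) ->
  (\int[m]_(x in D) f x <= \int[m]_(x in D) g x)%E.
Proof.
move=> fg; rewrite /integral.
have sub (a b : T -> \bar R) : (forall x, (a x <= b x)%E) ->
  (ereal_sup [set sintegral m h | h in [set h : {nnsfun T >-> R} | forall x, ((h x)%:E <= a x)%E]] <=
  ereal_sup [set sintegral m h | h in [set h : {nnsfun T >-> R} | forall x, ((h x)%:E <= b x)%E]])%E.
  move=> ab; apply: ge_ereal_sup => _ [h /= ha <-]; apply: ereal_sup_ubound.
  by exists h => //= x; apply: le_trans (ha x) _.
have fg' x : ((f \_ D) x <= (g \_ D) x)%E.
  by rewrite /patch; case: ifPn => // /set_mem; exact: fg.
apply: leeB; apply: sub => x; rewrite ?funeposE ?funenegE.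
  by rewrite ge_max !le_max fg' lexx orbT.
by rewrite ge_max !le_max leeN2 fg' lexx orbT.
Qed.

Lemma Int_EFin a b (k : R -> R) : ig a b k ->
  (\int[mu]_(t in `[a, b]) (k t)%:E)%E = (Int a b k)%:E.
Proof.
by move=> hk; rewrite /Int /Rintegral fineK //; apply: integrable_fin_num.
Qed.

Lemma smvp_subharmonic U u : open U -> smvp U u -> subharmonic_on U (fun z => (u z)%:E).
Proof.
move=> oU hu z Uz; have [cu mu'] := hu z Uz; split; first exact: ltry.
  move=> c; rewrite lte_fin => uc.
  have cz : 0 < c - u z by rewrite subr_gt0.
  have [d d0 D] := (contC _ _).1 cu _ cz.
  by apply/nbhs_discP; exists d => // w /D; rewrite lte_fin ltr_norml => /andP[]; lra.
apply: filterS2 mu' (circle_near oU Uz) => r h1 cU.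
rewrite Int_EFin; last by apply: cont_circle_ig => t; case: (hu _ (cU t)).
by rewrite -EFinM lee_fin.
Qed.

(** On the circle, [|z|^2] equals [|p|^2 + r^2] plus twice the real part of a linear function that
    vanishes at [p]. *)
Lemma cmean_sqr p r : 0 < r -> cmean (fun z => N z ^+ 2) p r = N p ^+ 2 + r ^+ 2.
Proof.
move=> r0; have -> : cmean (fun z => N z ^+ 2) p r =
    cmean (fun z => (N p ^+ 2 + r ^+ 2) + 2 * Re (p^* * (z - p))) p r.
  congr (_ * _); apply: eq_Int => t _.
  have -> : r ^+ 2 = N (circle p r t - p) ^+ 2 by rewrite N_circle0 // ltW.
  by rewrite !N_sqr; move: (circle p r t) => w; case: p; case: w => /= *; ring.
have dl : forall z, disc p (r + 1) z -> cdiff (fun z => p^* * (z - p)) z.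
  move=> z _; apply: cdiffM; first exact: cdiff_cst.
  by apply: cdiffB; [exact: cdiff_id|exact: cdiff_cst].
have rr : r < r + 1 by rewrite ltrDl.
have E : cmean (fun z => Re (p^* * (z - p))) p r = 0.
  by rewrite (holo_mean r0 rr dl) subrr mulr0.
have cl t : {for circle p r t, continuous (fun z => Re (p^* * (z - p)))}.
  apply: (@continuous_comp _ _ _ (fun z => p^* * (z - p)) (@complex.Re R)).
    by apply/cdiff_cont/dl; rewrite /disc /= N_circle0 // ltW.
  exact: continuous_Re.
move: E; rewrite /cmean IntD; last first.
- by apply: igZ; exact: cont_circle_ig cl.
- exact: ig_cst.
rewrite IntZ; last exact: cont_circle_ig cl.
rewrite Int_cst ?(ltW twopi_gt0) // subr0 => E; rewrite mulrDr.
by rewrite [X in _ + X]mulrCA E mulr0 addr0 mulrC mulfK // gt_eqF // twopi_gt0.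
Qed.

Lemma continuous_sqrN z : {for z, continuous (fun w : C => N w ^+ 2)}.
Proof.
have -> : (fun w : C => N w ^+ 2) = (fun w : C => N w * N w) by [].
by apply: (@cvgM _ _ (nbhs z) (nbhs_filter z)); exact: continuous_N.
Qed.

Lemma frontierE U z : open U -> closure U z -> ~ U z -> frontier U z.
Proof. by move=> oU cU nU; split=> //= /interior_subset. Qed.

Lemma near_closureN U z : ~ closure U z -> \forall w \near z, ~ U w.
Proof.
move=> nc; have oC : open (~` closure U) by rewrite openC; refine (@closed_closure _ U).
by apply: filterS (open_nbhs_nbhs (conj oC nc)) => w /= nw Uw; apply: nw; exact: subset_closure.
Qed.

Lemma bounded_closure_compact U M : (forall z, U z -> N z <= M) -> compact (closure U).
Proof.
move=> bU; apply: (@compactC _ _ M); first by refine (@closed_closure _ U).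
move=> z cz; have : closure (cdisc 0 M) z.
  by apply: closure_subset cz => w /bU; rewrite /cdisc /= subr0.
rewrite -(closure_id _).1; last exact: cdisc_closed.
by rewrite /cdisc /= subr0.
Qed.

(* A semicontinuous analogue of the extreme value theorem: the filter of the
   points [y] of [U] with [g y] above a given value has no cluster point. *)
Lemma usc_max U M (g : C -> \bar R) z1 : open U -> (forall z, U z -> N z <= M) -> U z1 ->
  (forall z d, U z -> (g z < d)%E -> \forall w \near z, U w -> (g w < d)%E) ->
  (forall z, frontier U z -> \forall w \near z, U w -> (g w < g z1)%E) ->
  exists2 p, U p & forall z, U z -> (g z <= g p)%E.
Proof.
move=> oU bU Uz1 usc bd; apply: contrapT => none.
have H p : U p -> exists2 p', U p' & (g p < g p')%E.
  move=> Up; apply: contrapT => nn; apply: none; exists p => // z Uz.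
  by rewrite leNgt; apply/negP => gz; apply: nn; exists z.
pose F := filter_from U (fun y0 => [set y | U y /\ (g y0 <= g y)%E]).
have FF : ProperFilter F.
  apply: filter_from_proper; last by move=> y0 Uy0; exists y0; split.
  apply: filter_from_filter; first by exists z1.
  move=> y1 y2 Uy1 Uy2; have [le|/ltW le] := leP (g y1) (g y2).
    by exists y2 => // y [Uy gy]; split; split=> //; exact: le_trans le gy.
  by exists y1 => // y [Uy gy]; split; split=> //; exact: le_trans le gy.
have K := (compact_near_coveringP _).1 (bounded_closure_compact bU).
have near_up y0 : U y0 -> \forall y \near F, U y /\ (g y0 <= g y)%E.
  by move=> Uy0; exists y0.
have : \forall y \near F, closure U `<=` [set x | U x -> (g x < g y)%E].
  apply: K => x cx; have [Ux|nUx] := pselect (U x).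
    have [p' Up' gp'] := H x Ux.
    exists ([set w | U w -> (g w < g p')%E], [set y | U y /\ (g p' <= g y)%E]) => /=.
      by split; [exact: usc|exact: near_up].
    by move=> [w y] /= [h1 [_ h2]] Uw; apply: lt_le_trans (h1 Uw) h2.
  exists ([set w | U w -> (g w < g z1)%E], [set y | U y /\ (g z1 <= g y)%E]) => /=.
    by split; [apply: bd; exact: frontierE|exact: near_up].
  by move=> [w y] /= [h1 [_ h2]] Uw; apply: lt_le_trans (h1 Uw) h2.
move=> L; have [y [Ly [Uy _]]] := filter_ex (filterI L (near_up z1 Uz1)).
by have := Ly y (subset_closure Uy) Uy; rewrite ltxx.
Qed.

(* Otherwise [v - u + e |z|^2] has an interior maximum for small [e], against
   the sub-mean value property, as [|z|^2] is strictly subharmonic. *)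
Lemma max_principle U M u v : open U -> (forall z, U z -> N z <= M) ->
  subharmonic_on U v -> mvp U u ->
  (forall zeta, frontier U zeta -> forall e : R, 0 < e ->
     \forall w \near zeta, U w -> (v w <= (u w + e)%:E)%E) ->
  forall z, U z -> (v z <= (u z)%:E)%E.
Proof.
move=> oU bU sv mu' bd z1 Uz1; rewrite leNgt; apply/negP => gt1.
have [vy _ _] := sv z1 Uz1.
have [r1 E1] : exists r1, v z1 = r1%:E.
  by case: (v z1) gt1 vy => [r||] // _ _; exists r.
move: gt1; rewrite E1 lte_fin => gt1.
pose c := r1 - u z1; have c0 : 0 < c by rewrite subr_gt0.
have M2 : 0 < 4 * (M ^+ 2 + 1) by rewrite mulr_gt0 // ltr_wpDl ?sqr_ge0.
(* With this [e] the perturbation [e |z|^2] is at most [c / 4] on [U], a fraction of the excess [c]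
   at [z1]. *)
pose e := c / (4 * (M ^+ 2 + 1)); have e0 : 0 < e by rewrite divr_gt0.
have eM z : U z -> e * N z ^+ 2 <= c / 4.
  move=> Uz; have NM' : N z ^+ 2 <= M ^+ 2 by rewrite lerXn2r ?nnegrE ?N_ge0 ?(le_trans (N_ge0 _) (bU z Uz)) ?bU.
  rewrite /e mulrAC ler_pdivrMr //.
  have -> : c / 4 * (4 * (M ^+ 2 + 1)) = c * (M ^+ 2 + 1) by field.
  by rewrite ler_pM2l // ler_wpDr.
pose k z := u z - e * N z ^+ 2.
have ck z : U z -> {for z, continuous k}.
  move=> Uz; have [cu _] := mu' z Uz.
  apply: (@cvgB _ _ _ (nbhs z) (nbhs_filter z)) => //.
  apply: (@cvgM _ _ (nbhs z) (nbhs_filter z)); first exact: cvg_cst.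
  exact: continuous_sqrN.
pose g z := (v z - (k z)%:E)%E.
have gE z d : (g z < d%:E)%E = (v z < (d + k z)%:E)%E.
  by rewrite /g lteBlDr // EFinD.
have [||p Up pmax] := @usc_max U M g z1 oU bU Uz1.
- move=> z d Uz gd.
  have [c1 gc1 c1d] : exists2 c1 : R, (g z < c1%:E)%E & (c1%:E <= d)%E.
    have [vzy _ _] := sv z Uz.
    have gy : (g z < +oo)%E by rewrite /g; case: (v z) vzy => [x||] //= _; rewrite ltry.
    case: d gd => [d||] gd; first by exists d.
      case: (g z) gy => [x||] // _; first by exists (x + 1); rewrite ?lte_fin ?ltrDl // leey.
      by exists 0; rewrite ?ltNyr // leey.
    by rewrite ltNge leNye in gd.
  rewrite gE in gc1.
  have [c2 vc2 c2c] : exists2 c2 : R, (v z < c2%:E)%E & c2 < c1 + k z.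
    case: (v z) gc1 => [x||] //; last by exists (c1 + k z - 1); rewrite ?ltNyr // ltrBlDr ltrDl.
    rewrite lte_fin => xc; exists ((x + (c1 + k z)) / 2); rewrite ?lte_fin; first by rewrite midf_lt.
    by rewrite midf_lt.
  have [_ /(_ _ vc2) near1 _] := sv z Uz.
  have cz : 0 < c1 + k z - c2 by rewrite subr_gt0.
  have [d1 d10 D1] := (contC _ _).1 (ck z Uz) _ cz.
  apply: filterS2 near1 (near_disc z d10) => w vw /D1 + Uw.
  rewrite ltr_norml => /andP[kw _]; apply: lt_le_trans c1d; rewrite gE.
  by apply: lt_trans vw _; rewrite lte_fin; lra.
(* Near the boundary [g] is at most [c / 8 + c / 4], which is below [c / 2], while [g z1] is at
   least [c]. *)
- move=> z fz; have c8 : 0 < c / 8 by rewrite divr_gt0.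
  have := bd z fz _ c8; apply: filterS => w H Uw.
  have gz1 : ((c / 2)%:E < g z1)%E.
    rewrite /g E1 -EFinB lte_fin /k; have := e0.
    have : 0 <= e * N z1 ^+ 2 by rewrite mulr_ge0 ?(ltW e0) ?sqr_ge0.
    by rewrite /c; lra.
  apply: lt_trans gz1; rewrite gE; apply: le_lt_trans (H Uw) _; rewrite lte_fin /k.
  by have := eM w Uw; lra.
have [vpy _ submean] := sv p Up.
have gp1 : (c%:E <= g p)%E.
  apply: le_trans (pmax z1 Uz1); rewrite /g E1 -EFinB lee_fin /k /c.
  have : 0 <= e * N z1 ^+ 2 by rewrite mulr_ge0 ?(ltW e0) ?sqr_ge0.
  lra.
have [G EG] : exists G, v p = (G + k p)%:E.
  move: gp1; rewrite /g; case: (v p) vpy => [x _ _|//|//].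
  by exists (x - k p); rewrite subrK.
have gpE : g p = G%:E by rewrite /g EG -EFinB addrK.
have [_ mean_u] := mu' p Up.
have r0 : \forall r \near (0 : R)^'+, 0 < r by exact: nbhs_right_gt.
have [r [[h1 h2] [h3 cU]]] := @filter_ex _ (0 : R)^'+ _ _ (filterI (filterI submean mean_u) (filterI r0 (circle_near oU Up))).
have cku t : {for circle p r t, continuous k} by exact: ck.
have cuu t : {for circle p r t, continuous u} by case: (mu' _ (cU t)).
have igk : ig 0 (2 * pi) (fun t => G + k (circle p r t)).
  by apply: igD; [exact: ig_cst|exact: cont_circle_ig].
have : (v p <= ((2 * pi)^-1)%:E * (Int 0 (2 * pi) (fun t => G + k (circle p r t)))%:E)%E.
  apply: le_trans h1 _; apply: lee_wpmul2l; first by rewrite lee_fin invr_ge0 ltW // twopi_gt0.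
  rewrite -Int_EFin //; apply: integral_mono => t _.
  have := pmax _ (cU t); rewrite gpE /g leeBlDr // -EFinD; exact.
rewrite EG -EFinM lee_fin; apply/negP; rewrite -ltNge.
(* The mean of [k] on the circle is [k p - e * r ^+ 2], strictly below [k p]: this is the
   contradiction. *)
have -> : (2 * pi)^-1 * Int 0 (2 * pi) (fun t => G + k (circle p r t)) =
    G + (cmean u p r - e * cmean (fun z => N z ^+ 2) p r).
  have ig2 : ig 0 (2 * pi) (fun t => N (circle p r t) ^+ 2).
    by apply: (@cont_circle_ig _ (fun z => N z ^+ 2)) => t; exact: continuous_sqrN.
  have ig1 : ig 0 (2 * pi) (fun t => u (circle p r t)) by exact: cont_circle_ig.
  have igk' : ig 0 (2 * pi) (fun t => k (circle p r t)) by exact: cont_circle_ig.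
  have Ek : Int 0 (2 * pi) (fun t => k (circle p r t)) =
      Int 0 (2 * pi) (fun t => u (circle p r t)) -
      e * Int 0 (2 * pi) (fun t => N (circle p r t) ^+ 2).
    by rewrite -IntZ // -IntB //; exact: igZ.
  rewrite /cmean IntD ?Ek //; last exact: ig_cst.
  rewrite Int_cst ?(ltW twopi_gt0) // subr0 mulrDr mulrBr (mulrCA _ e).
  by rewrite [_ * (G * _)]mulrC mulfK // gt_eqF // twopi_gt0.
rewrite -h2 cmean_sqr // /k ltrD2l; have := mulr_gt0 e0 (exprn_gt0 2 h3); lra.
Qed.

Lemma max_principle_real U M u (v : C -> R) : open U -> (forall z, U z -> N z <= M) ->
  smvp U v -> mvp U u ->
  (forall zeta, frontier U zeta -> forall e : R, 0 < e ->
     \forall w \near zeta, U w -> v w <= u w + e) ->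
  forall z, U z -> v z <= u z.
Proof.
move=> oU bU sv mu' bd z Uz; rewrite -lee_fin.
by apply: (@max_principle U M u (fun z => (v z)%:E)) => //; exact: smvp_subharmonic.
Qed.

(** Since [ln 0 = 0], the value at a zero of [g] is set to [-oo] explicitly; this makes [ln |g|]
    subharmonic across its zeros. *)
Definition elnN (g : C -> C) z : \bar R := if g z == 0 then -oo%E else (ln (N (g z)))%:E.

Lemma elnN_subharmonic U (g : C -> C) : open U -> (forall z, U z -> cdiff g z) ->
  subharmonic_on U (elnN g).
Proof.
move=> oU dg z Uz; have [g0|g0] := eqVneq (g z) 0.
  have Ez : elnN g z = -oo%E by rewrite /elnN g0 eqxx.
  rewrite Ez; split => //; last by apply: nearW => r; exact: leNye.
  move=> c _.
  have [d d0 D] := (contCC _ _).1 (cdiff_cont (dg z Uz)) _ (expR_gt0 c).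
  apply/nbhs_discP; exists d => // w /D; rewrite g0 subr0 /elnN.
  case: ifPn => [_ _|gw]; first exact: ltNyr.
  by move=> H; rewrite lte_fin -[ltRHS]expRK ltr_ln // posrE ?N_gt0 // expR_gt0.
pose V := U `&` g @^-1` (~` [set 0]).
have oV : open V.
  rewrite openE => w [Uw gw].
  have gw0 : 0 < N (g w) by rewrite N_gt0; apply/eqP.
  have [d d0 D] := (contCC _ _).1 (cdiff_cont (dg w Uw)) _ gw0.
  apply: filterS2 (open_nbhs_nbhs (conj oU Uw)) (near_disc w d0) => y Uy /D H.
  by split=> // gy; move: H; rewrite gy sub0r NN ltxx.
have sub : subharmonic_on V (fun z => (ln (N (g z)))%:E).
  apply/smvp_subharmonic/mvp_smvp/lnN_mvp => // w [Uw gw]; first exact: dg.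
  exact/eqP.
have Vz : V z by split=> //; exact/eqP.
have EV w : V w -> elnN g w = (ln (N (g w)))%:E.
  by move=> [_ /= /eqP/negbTE gw]; rewrite /elnN gw.
have [h1 h2 h3] := sub z Vz; rewrite EV //; split=> //.
  move=> c /h2 H; apply: filterS2 H (open_nbhs_nbhs (conj oV Vz)) => w ? Vw; by rewrite EV.
apply: filterS2 h3 (circle_near oV Vz) => r H cV; apply: le_trans H _.
apply: lee_wpmul2l; first by rewrite lee_fin invr_ge0 ltW // twopi_gt0.
by apply: integral_mono => t _; rewrite EV.
Qed.

Lemma limf_esup_le (F : set_system C) (FF : Filter F) v (c : R) :
  (limf_esup v F <= c%:E)%E <-> forall e : R, 0 < e -> \forall w \near F, (v w <= (c + e)%:E)%E.
Proof.
split=> [H e e0|H].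
  have : (limf_esup v F < (c + e)%:E)%E by apply: le_lt_trans H _; rewrite lte_fin ltrDl.
  move=> /ereal_inf_lt[_ [V FV <-]] lt; apply: filterS FV => w Vw.
  by apply: le_trans (ltW lt); apply: ereal_sup_ubound; exists w.
apply/lee_addgt0Pr => e e0; rewrite -EFinD.
have := H e e0 => He; apply: (@le_trans _ _ (ereal_sup (v @` [set w | (v w <= (c + e)%:E)%E]))).
  by apply: ereal_inf_lbound; exists [set w | (v w <= (c + e)%:E)%E].
by apply: ge_ereal_sup => _ [w /= hw <-].
Qed.

End MaximumPrinciple.

(** * Poisson integrals and harmonic functions *)

Section ComplexIntegral.
Context {R : realType}.
Local Notation C := R[i].
Implicit Types (k l : R -> C) (d : C) (phi : R -> R).

Definition CI k : C := Int 0 (2 * pi) (fun t => Re (k t)) +i* Int 0 (2 * pi) (fun t => Im (k t)).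

Definition cig k := ig 0 (2 * pi) (fun t => Re (k t)) /\ ig 0 (2 * pi) (fun t => Im (k t)).

Lemma CID k l : cig k -> cig l -> CI (fun t => k t + l t) = CI k + CI l.
Proof.
move=> [k1 k2] [l1 l2]; apply: complexP; rewrite ReImE /= -IntD //.
  by apply: eq_Int => t _; rewrite ReD.
by apply: eq_Int => t _; rewrite ImD.
Qed.

Lemma CIZ d k : cig k -> CI (fun t => d * k t) = d * CI k.
Proof.
move=> [k1 k2]; apply: complexP; rewrite ReImE /= -!IntZ //.
  by rewrite -IntB; [apply: eq_Int => t _; rewrite ReM|exact: igZ|exact: igZ].
by rewrite -IntD; [apply: eq_Int => t _; rewrite ImM|exact: igZ|exact: igZ].
Qed.

Lemma cigZ d k : cig k -> cig (fun t => d * k t).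
Proof.
move=> [k1 k2]; split.
  have -> : (fun t => Re (d * k t)) = (fun t => Re d * Re (k t) - Im d * Im (k t)).
    by apply/funext => t; rewrite ReM.
  by apply: igB; exact: igZ.
have -> : (fun t => Im (d * k t)) = (fun t => Re d * Im (k t) + Im d * Re (k t)).
  by apply/funext => t; rewrite ImM.
by apply: igD; exact: igZ.
Qed.

Lemma cigD k l : cig k -> cig l -> cig (fun t => k t + l t).
Proof.
move=> [k1 k2] [l1 l2]; split.
  have -> : (fun t => Re (k t + l t)) = (fun t => Re (k t) + Re (l t)).
    by apply/funext => t; rewrite ReD.
  exact: igD.
have -> : (fun t => Im (k t + l t)) = (fun t => Im (k t) + Im (l t)).
  by apply/funext => t; rewrite ImD.
exact: igD.
Qed.

Lemma N_CI k (B : R) : cig k -> (forall t, N (k t) <= B) -> N (CI k) <= 2 * B * (2 * pi).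
Proof.
move=> [k1 k2] kB; apply: le_trans (N_le_ReIm _) _ => /=.
have p0 := ltW (@twopi_gt0 R).
have -> : 2 * B * (2 * pi) = B * (2 * pi - 0) + B * (2 * pi - 0) by rewrite subr0 mulr2n mulrDl mul1r mulrDl.
apply: lerD; apply: Int_bound => // t _; apply: le_trans (kB t).
  exact: Re_le_N.
exact: Im_le_N.
Qed.

(** Data on a circle are only measurable and bounded, because the barrier argument integrates the
    indicator of an open set. *)
Definition bmeas phi (M : R) := measurable_fun `[0, 2 * pi]%classic phi /\ forall t, `|phi t| <= M.

Lemma bmeas_ig phi M : bmeas phi M -> ig 0 (2 * pi) phi.
Proof.
move=> [mphi bphi]; apply: measurable_bounded_integrable => //.
  by apply: compact_finite_measure; exact: segment_compact.
by exists M; split; rewrite ?num_real // => x Mx t _; apply: le_trans (bphi t) (ltW Mx).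
Qed.

Lemma bmeasM phi (l : R -> R) M B : bmeas phi M -> continuous l -> (forall t, `|l t| <= B) ->
  bmeas (fun t => phi t * l t) (M * B).
Proof.
move=> [mphi bphi] cl bl; split; last first.
  by move=> t; rewrite normrM ler_pM.
apply: measurable_realfun.measurable_funM => //; apply: measurable_funTS.
exact: measurable_realfun.continuous_measurable_fun.
Qed.

Lemma cont_bmeas phi M : continuous phi -> (forall t, `|phi t| <= M) -> bmeas phi M.
Proof.
by move=> cphi bphi; split=> //; apply: measurable_funTS; exact: measurable_realfun.continuous_measurable_fun.
Qed.

Lemma bmeas_cig phi M k B : bmeas phi M -> continuous k -> (forall t, N (k t) <= B) ->
  cig (fun t => (phi t)%:C * k t).
Proof.
move=> bphi ck bk; split.
  have -> : (fun t => Re ((phi t)%:C * k t)) = (fun t => phi t * Re (k t)).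
    by apply/funext => t; rewrite ReM /= mul0r subr0.
  apply: (@bmeas_ig _ (M * B)); apply: bmeasM => // [t|t].
    by apply: (@continuous_comp _ _ _ k (@complex.Re R)); [exact: ck|exact: continuous_Re].
  exact: le_trans (Re_le_N _) (bk t).
have -> : (fun t => Im ((phi t)%:C * k t)) = (fun t => phi t * Im (k t)).
  by apply/funext => t; rewrite ImM /= mul0r addr0.
apply: (@bmeas_ig _ (M * B)); apply: bmeasM => // [t|t].
  by apply: (@continuous_comp _ _ _ k (@complex.Im R)); [exact: ck|exact: continuous_Im].
exact: le_trans (Im_le_N _) (bk t).
Qed.

End ComplexIntegral.

(** * The Poisson kernel and the Schwarz integral *)

Section PoissonKernel.
Context {R : realType}.
Local Notation C := R[i].

Lemma N_nat n : N (n%:R : C) = n%:R.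
Proof. by rewrite -(rmorph_nat (real_complex R)) NC ger0_norm // ler0n. Qed.

Let conj_ratio (d x : C) : d != 0 -> d - x != 0 ->
  d * conjc d / (d * conjc d - conjc x * d) = conjc (d * (d - x)^-1).
Proof.
move=> e0 ne; rewrite rmorphM fmorphV rmorphB.
rewrite (mulrC (conjc x)) -mulrBr -mulf_div divff // mul1r.
by [].
Qed.

Variables (c : C) (rho : R).
Hypothesis rho0 : 0 < rho.
Implicit Types (z w x : C) (t : R) (F : C -> R).

Let e t : C := circle c rho t - c.

Let Ne t : N (e t) = rho. Proof. by rewrite /e N_circle gtr0_norm. Qed.

Let ce : continuous e.
Proof.
move=> t; apply: cvgB; last exact: cvg_cst.
exact: continuous_circle.
Qed.

Let dist_e z t : rho - N (z - c) <= N (e t - (z - c)).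
Proof. by rewrite -{1}(Ne t) N_rev. Qed.

Let e_neq z t : disc c rho z -> e t - (z - c) != 0.
Proof.
by rewrite /disc /= => zr; rewrite -N_gt0; apply: lt_le_trans (dist_e z t); rewrite subr_gt0.
Qed.

Let cker z : disc c rho z -> continuous (fun t => (e t - (z - c))^-1).
Proof.
move=> zr t; apply: (@cvgV _ _ (nbhs t) (nbhs_filter t)); first exact: e_neq.
by apply: cvgB; [exact: ce|exact: cvg_cst].
Qed.

Let Nker z t : disc c rho z -> N (e t - (z - c))^-1 <= (rho - N (z - c))^-1.
Proof.
rewrite /disc /= => zr; rewrite NV lef_pV2 ?posrE ?subr_gt0 ?N_gt0 ?e_neq //.
Qed.

Variables (F : C -> R) (M : R).
Hypothesis bF : bmeas (fun t => F (circle c rho t)) M.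

Let phi t := F (circle c rho t).

Let M0 : 0 <= M. Proof. by case: bF => _ /(_ 0); apply: le_trans. Qed.

(** Cauchy-type integrals: differentiation in [z] sends [KI m] to [m KI (m + 1)]. The exponents 1,
    2, 3 give the Schwarz integral and its first two derivatives. *)
Definition KI m z : C := CI (fun t => (phi t)%:C * (e t * ((e t - (z - c))^-1) ^+ m)).

Let cpow z m : disc c rho z -> continuous (fun t => e t * ((e t - (z - c))^-1) ^+ m).
Proof.
move=> zr; elim: m => [|m IH] t.
  by apply: (@cvgM _ _ (nbhs t) (nbhs_filter t)); [exact: ce|exact: cvg_cst].
under eq_fun do rewrite exprSr mulrA.
by apply: (@cvgM _ _ (nbhs t) (nbhs_filter t)); [exact: IH|exact: cker].
Qed.

Let Npow z m t : disc c rho z ->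
  N (e t * ((e t - (z - c))^-1) ^+ m) <= rho * (rho - N (z - c))^-1 ^+ m.
Proof.
move=> zr; rewrite NM Ne NX ler_pM2l //; apply: lerXn2r; rewrite ?nnegrE ?N_ge0 //.
  by rewrite invr_ge0 subr_ge0 ltW.
exact: Nker.
Qed.

Let cigKI m z : disc c rho z -> cig (fun t => (phi t)%:C * (e t * ((e t - (z - c))^-1) ^+ m)).
Proof.
move=> zr; apply: (bmeas_cig bF); first exact: cpow.
by move=> t; apply: Npow.
Qed.

(** Taylor remainder of [x ^+ m] for the two kernels [x = 1 / (e - (w - c))] and
    [y = 1 / (e - (z - c))], which satisfy [x - y = h x y] with [h = w - z]. The coefficients add up
    to 1, 3, 6 for [m] = 1, 2, 3. *)
Let pow_rem (h x y : C) (B : R) m : (0 < m < 4)%N -> x - y = h * x * y ->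
  N x <= B -> N y <= B ->
  N (x ^+ m - y ^+ m - m%:R * h * y ^+ m.+1) <= 6 * N h ^+ 2 * B ^+ m.+2.
Proof.
move=> m4 E xB yB.
have nx := N_ge0 x; have ny := N_ge0 y; have B0 := le_trans nx xB.
have Ex : x = y + h * x * y by rewrite -E; ring.
have h2 : 0 <= N h ^+ 2 by rewrite exprn_ge0 // N_ge0.
have mon i j : N (x ^+ i * y ^+ j) <= B ^+ (i + j).
  by rewrite NM !NX exprD ler_pM ?exprn_ge0 // lerXn2r ?nnegrE.
case: m m4 => [|[|[|[|m]]]] // _.
- have -> : x ^+ 1 - y ^+ 1 - 1%:R * h * y ^+ 2 = h ^+ 2 * (x ^+ 1 * y ^+ 2).
    have -> : x ^+ 1 - y ^+ 1 - 1%:R * h * y ^+ 2 = (x - y) - h * y * y by ring.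
    rewrite E; have -> : h * x * y - h * y * y = h * y * (x - y) by ring.
    by rewrite E; ring.
  rewrite NM NX; apply: le_trans (ler_wpM2l h2 (mon 1 2)%N) _.
  by apply: ler_wpM2r; rewrite ?exprn_ge0 // ler_peMl // ler1n.
- have -> : x ^+ 2 - y ^+ 2 - 2%:R * h * y ^+ 3 =
     h ^+ 2 * (x ^+ 2 * y ^+ 2 + 2%:R * (x ^+ 1 * y ^+ 3)).
    have -> : x ^+ 2 - y ^+ 2 - 2%:R * h * y ^+ 3 = (x - y) * (x + y) - 2%:R * h * y ^+ 3 by ring.
    rewrite E; have -> : h * x * y * (x + y) - 2%:R * h * y ^+ 3 =
      h * y * ((x - y) * (x + 2%:R * y)) by ring.
    by rewrite E; ring.
  rewrite NM NX -(mulrA 6) (mulrCA 6); apply: ler_wpM2l => //.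
  apply: le_trans (ler_N _ _) _; rewrite (NM 2%:R) N_nat.
  have := mon 2%N 2%N; have := mon 1%N 3%N => /=; have := exprn_ge0 4 B0; lra.
have -> : x ^+ 3 - y ^+ 3 - 3%:R * h * y ^+ 4 =
   h ^+ 2 * (x ^+ 3 * y ^+ 2 + 2%:R * (x ^+ 2 * y ^+ 3) + 3%:R * (x ^+ 1 * y ^+ 4)).
  have -> : x ^+ 3 - y ^+ 3 - 3%:R * h * y ^+ 4 =
    (x - y) * (x ^+ 2 + x * y + y ^+ 2) - 3%:R * h * y ^+ 4 by ring.
  rewrite E; have -> : h * x * y * (x ^+ 2 + x * y + y ^+ 2) - 3%:R * h * y ^+ 4 =
    h * y * ((x - y) * (x ^+ 2 + 2%:R * x * y + 3%:R * y ^+ 2)) by ring.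
  by rewrite E; ring.
rewrite NM NX -(mulrA 6) (mulrCA 6); apply: ler_wpM2l => //.
apply: le_trans (ler_N _ _) _; apply: le_trans (lerD (ler_N _ _) (lexx _)) _.
rewrite !(NM _%:R) !N_nat.
have := mon 3%N 2%N; have := mon 2%N 3%N; have := mon 1%N 4%N => /=; have := exprn_ge0 5 B0; lra.
Qed.

Lemma cderiv_KI m z : (0 < m < 4)%N -> disc c rho z -> cderiv (KI m) z (m%:R * KI m.+1 z).
Proof.
move=> m4 zr eps eps0.
pose dl := (rho - N (z - c)) / 2.
have dl0 : 0 < dl by rewrite divr_gt0 // subr_gt0.
have d0 : 0 < rho - N (z - c) by rewrite subr_gt0.
pose B := dl^-1; have B0 : 0 < B by rewrite invr_gt0.
(* [K - 1] is the constant of the quadratic remainder under the integral; adding 1 makes [K]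
   positive. *)
pose K := 2 * (M * (rho * (6 * B ^+ m.+2))) * (2 * pi) + 1.
have K0 : 0 < K.
  rewrite ltr_wpDl // mulr_ge0 ?(ltW (@twopi_gt0 R)) // mulr_ge0 // mulr_ge0 //.
  by rewrite mulr_ge0 ?(ltW rho0) // mulr_ge0 // exprn_ge0 // ltW.
have q0 : 0 < Num.min dl (eps / K) by rewrite lt_min dl0 divr_gt0.
apply: filterS (near_disc z q0) => w; rewrite /disc /= lt_min => /andP[wd we].
have wr : disc c rho w.
  rewrite /disc /=; apply: le_lt_trans (N_tri z _ _) _.
  by apply: lt_le_trans (ltr_leD wd (lexx _)) _; rewrite /dl; move: zr; rewrite /disc /=; lra.
have zN : rho - N (z - c) = 2 * dl by rewrite /dl; field.
have wN : dl <= rho - N (w - c).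
  have := N_tri z w c; rewrite -/(disc _ _ _); move: zN wd; lra.
have E : KI m w - KI m z - m%:R * KI m.+1 z * (w - z) =
  CI (fun t => (phi t)%:C * (e t * (((e t - (w - c))^-1) ^+ m - ((e t - (z - c))^-1) ^+ m
     - m%:R * (w - z) * ((e t - (z - c))^-1) ^+ m.+1))).
  have -> : KI m w - KI m z - m%:R * KI m.+1 z * (w - z) =
    KI m w + (-1) * KI m z + (- (m%:R * (w - z))) * KI m.+1 z.
    by move: (KI m w) (KI m z) (KI m.+1 z) => k1 k2 k3; clear; ring.
  rewrite /KI -!CIZ; try exact: cigKI.
  rewrite -!CID; try (do ?apply: cigD; try apply: cigZ; exact: cigKI).
  by congr CI; apply/funext => t; ring.
have cigE : cig (fun t => (phi t)%:C * (e t * (((e t - (w - c))^-1) ^+ m - ((e t - (z - c))^-1) ^+ m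
     - m%:R * (w - z) * ((e t - (z - c))^-1) ^+ m.+1))).
  have := cigD (cigD (cigKI m wr) (cigZ (-1) (cigKI m zr))) (cigZ (- (m%:R * (w - z))) (cigKI m.+1 zr)).
  by congr cig; apply/funext => t; ring.
rewrite E.
apply: le_trans (N_CI (B := M * (rho * (6 * N (w - z) ^+ 2 * B ^+ m.+2))) cigE _) _.
  move=> t; rewrite NM NC; apply: ler_pM; rewrite ?N_ge0 //; first by case: bF => _; apply.
  rewrite NM Ne ler_pM2l //; apply: pow_rem => //.
  - by field; rewrite !e_neq.
  - by apply: le_trans (Nker t wr) _; rewrite lef_pV2 // posrE; apply: lt_le_trans wN.
  - apply: le_trans (Nker t zr) _; rewrite zN lef_pV2 ?posrE ?mulr_gt0 //.
    by rewrite ler_peMl ?(ltW dl0) // ler1n.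
have -> : 2 * (M * (rho * (6 * N (w - z) ^+ 2 * B ^+ m.+2))) * (2 * pi) =
  (K - 1) * N (w - z) * N (w - z) by rewrite /K; ring.
apply: ler_wpM2r; first exact: N_ge0.
apply: le_trans (_ : K * N (w - z) <= _).
  by apply: ler_wpM2r; [exact: N_ge0|rewrite gerBl].
by rewrite mulrC -ler_pdivlMr // ltW.
Qed.

(** The Schwarz integral, with its kernel [(e + x) / (e - x)] written as [2 e / (e - x) - 1], where
    [x = z - c]; the next two definitions are its derivatives. *)
Definition schwarz z : C := ((2 * pi)^-1)%:C * (2%:R * KI 1 z - CI (fun t => (phi t)%:C * 1)).
Definition schwarz1 z : C := ((2 * pi)^-1)%:C * (2%:R * KI 2 z).
Definition schwarz2 z : C := ((2 * pi)^-1)%:C * (2%:R * (2%:R * KI 3 z)).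

Lemma cderivZ k (g : C -> C) z a : cderiv g z a -> cderiv (fun w => k * g w) z (k * a).
Proof.
by move=> hg; have := cderivM (cderiv_cst k z) hg; rewrite mul0r add0r.
Qed.

Lemma cderiv_schwarz z : disc c rho z -> cderiv schwarz z (schwarz1 z).
Proof.
move=> zr; apply: cderivZ; rewrite -[X in cderiv _ _ X]addr0; apply: cderivD.
  by rewrite -[KI 2 z]mul1r; apply: cderivZ; exact: (@cderiv_KI 1).
exact: cderiv_cst.
Qed.

Lemma cderiv_schwarz1 z : disc c rho z -> cderiv schwarz1 z (schwarz2 z).
Proof.
by move=> zr; apply: cderivZ; apply: cderivZ; exact: (@cderiv_KI 2).
Qed.

Lemma cdiff_schwarz2 z : disc c rho z -> cdiff schwarz2 z.
Proof.
move=> zr; eexists; apply: cderivZ; apply: cderivZ; apply: cderivZ.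
by apply: (@cderiv_KI 3).
Qed.

Definition poisson z : R := Re (schwarz z).

Definition pker z t : R := (rho ^+ 2 - N (z - c) ^+ 2) / N (circle c rho t - z) ^+ 2.

Let pkerE z t : disc c rho z -> pker z t = Re (2%:R * (e t * (e t - (z - c))^-1) - 1).
Proof.
move=> zr; have ne := e_neq t zr.
have -> : 2%:R * (e t * (e t - (z - c))^-1) - 1 = (e t + (z - c)) / (e t - (z - c)).
  by field.
have ez : circle c rho t - z = e t - (z - c) by rewrite /e; ring.
have nn : N (e t - (z - c)) ^+ 2 != 0 by rewrite expf_neq0 // N_eq0.
rewrite /pker ez -(Ne t); move: (e t) (z - c) nn => a b nn.
have -> : ((a - b)^-1 : C) = conjc (a - b) * ((N (a - b) ^+ 2)^-1)%:C.
  by rewrite invc_norm normE mulrC -rmorphXn fmorphV.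
rewrite mulrA ReM /= mulr0 subr0.
by congr (_ / _); rewrite !N_sqr; case: a {nn}; case: b => /= *; ring.
Qed.

Lemma poissonE z : disc c rho z ->
  poisson z = (2 * pi)^-1 * Int 0 (2 * pi) (fun t => F (circle c rho t) * pker z t).
Proof.
move=> zr; have c1 : cig (fun t => (phi t)%:C * 1).
  by apply: (bmeas_cig (B := 1) bF) => [t|t]; [exact: cvg_cst|rewrite N1].
have -> : poisson z = Re (((2 * pi)^-1)%:C * CI (fun t => 2%:R * ((phi t)%:C * (e t * ((e t - (z - c))^-1) ^+ 1)) + (-1) * ((phi t)%:C * 1))).
  rewrite CID; [|by apply: cigZ; exact: cigKI|exact: cigZ].
  by rewrite !CIZ //; [rewrite /poisson /schwarz /KI mulN1r|exact: cigKI].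
rewrite ReM /= mul0r subr0; congr (_ * _); apply: eq_Int => t _.
have -> : 2%:R * ((phi t)%:C * (e t * (e t - (z - c))^-1 ^+ 1)) + -1 * ((phi t)%:C * 1) =
  (phi t)%:C * (2%:R * (e t * (e t - (z - c))^-1) - 1) by ring.
by rewrite ReM -pkerE //= mul0r subr0.
Qed.

Lemma pker_cont z : disc c rho z -> continuous (pker z).
Proof.
move=> zr t; rewrite /pker.
apply: (@cvgM _ _ (nbhs t) (nbhs_filter t)); first exact: cvg_cst.
have ez : circle c rho t - z != 0.
  have -> : circle c rho t - z = e t - (z - c) by rewrite /e; ring.
  exact: e_neq.
apply: (@cvgV _ _ (nbhs t) (nbhs_filter t)); first by rewrite expf_neq0 // N_eq0.
apply: (@continuous_comp _ _ _ (circle c rho) (fun w => N (w - z) ^+ 2)).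
  exact: continuous_circle.
apply: (@continuous_comp _ _ _ (fun w => w - z) (fun w => N w ^+ 2)); last exact: continuous_sqrN.
by apply/cdiff_cont/cdiffB; [exact: cdiff_id|exact: cdiff_cst].
Qed.

Lemma pker_bounds z t : disc c rho z ->
  (rho - N (z - c)) / (rho + N (z - c)) <= pker z t <= (rho + N (z - c)) / (rho - N (z - c)).
Proof.
rewrite /disc /= /pker => zr; have n0 := N_ge0 (z - c).
have ez : circle c rho t - z = e t - (z - c) by rewrite /e; ring.
rewrite ez; have l1 := dist_e z t; have l2 := ler_NB (e t) (z - c).
rewrite Ne in l2; move: (N (z - c)) (N (e t - (z - c))) n0 zr l1 l2 => d m n0 zr l1 l2.
have m0 : 0 < m by lra.
have d1 : 0 < rho - d by lra.
have d2 : 0 < rho + d by lra.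
have -> : (rho - d) / (rho + d) = (rho ^+ 2 - d ^+ 2) / (rho + d) ^+ 2.
  by field; rewrite gt_eqF.
have -> : (rho + d) / (rho - d) = (rho ^+ 2 - d ^+ 2) / (rho - d) ^+ 2.
  by field; rewrite gt_eqF.
have n2 : 0 <= rho ^+ 2 - d ^+ 2 by rewrite subr_sqr mulr_ge0 // ltW.
apply/andP; split; (apply: ler_wpM2l => //); rewrite lef_pV2 ?posrE ?exprn_gt0 //.
  by rewrite lerXn2r ?nnegrE // ltW.
by rewrite lerXn2r ?nnegrE // ltW.
Qed.

Lemma pker_ge0 z t : disc c rho z -> 0 <= pker z t.
Proof.
move=> zr; have /andP[+ _] := pker_bounds t zr; apply: le_trans.
by rewrite divr_ge0 ?subr_ge0 ?(ltW zr) // addr_ge0 ?N_ge0 // ltW.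
Qed.

Lemma pker_ig z : disc c rho z -> ig 0 (2 * pi) (pker z).
Proof. by move=> zr; apply: cont_ig => t _; exact: pker_cont. Qed.

(* On the circle the kernel is also the real part of
   [- 1 + 2 rho^2 / (rho^2 - conj (z - c) (w - c))], which is holomorphic in [w]. *)
Lemma pker_int z : disc c rho z -> (2 * pi)^-1 * Int 0 (2 * pi) (pker z) = 1.
Proof.
move=> zr; set x := z - c.
pose g w : C := 2%:R * ((rho ^+ 2)%:C / ((rho ^+ 2)%:C - conjc x * (w - c))) - 1.
(* If [x] is not 0, the pole is at distance [rho ^+ 2 / N x] from [c]; [r0] lies strictly between
   [rho] and that distance. *)
pose r0 := 2 * rho ^+ 2 / (rho + N x).
have nx := N_ge0 x.
have xr : N x < rho by [].
have rx : 0 < rho + N x by lra.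
have r1 : rho < r0.
  by rewrite /r0 ltr_pdivlMr // expr2 mulrCA ltr_pM2l //; lra.
have dg w : disc c r0 w -> cdiff g w.
  rewrite /disc /= => wr; apply: cdiffB; last exact: cdiff_cst.
  apply: cdiffM; first exact: cdiff_cst.
  apply: cdiff_div; first exact: cdiff_cst.
    apply: cdiffB; first exact: cdiff_cst.
    apply: cdiffM; first exact: cdiff_cst.
    by apply: cdiffB; [exact: cdiff_id|exact: cdiff_cst].
  rewrite subr_eq0; apply/eqP => E.
  have : N ((rho ^+ 2)%:C : C) = N x * N (w - c) by rewrite E NM; congr (_ * _); case: (x) => a b /=; rewrite sqrrN.
  rewrite NC ger0_norm ?sqr_ge0 // => E2.
  have : N x * N (w - c) <= N x * r0 by apply: ler_wpM2l => //; exact: ltW.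
  rewrite -E2 /r0 mulrA ler_pdivlMr //.
  have : 0 < rho ^+ 2 by rewrite exprn_gt0.
  nra.
have := holo_mean rho0 r1 dg; rewrite /g subrr mulr0 subr0 divff; last first.
  by rewrite -N_eq0 NC normr_eq0 expf_neq0 // gt_eqF.
move=> E; transitivity (Re (2%:R * (1 : C) - 1)); last by rewrite /=; ring.
rewrite -E /cmean; congr (_ * _); apply: eq_Int => t _.
rewrite pkerE // -/x.
have ee : (rho ^+ 2)%:C = e t * conjc (e t) :> C.
  by rewrite -(Ne t); have := sqr_normc (e t); rewrite normE -rmorphXn => ->.
rewrite -/(e t) ee.
have ne := e_neq t zr; rewrite -/x in ne.
have e0 : e t != 0 by rewrite -N_gt0 Ne.
rewrite conj_ratio //; move: (e t / (e t - x)).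
by case=> a b; rewrite !ReImE /=; ring.
Qed.

Lemma poisson_mvp : mvp (disc c rho) poisson.
Proof.
apply: Re_mvp; first exact: disc_open.
by move=> z zr; exists (schwarz1 z); exact: cderiv_schwarz.
Qed.

Lemma poisson_center : poisson c = (2 * pi)^-1 * Int 0 (2 * pi) (fun t => F (circle c rho t)).
Proof.
rewrite poissonE; last exact: disc_center.
congr (_ * _); apply: eq_Int => t _.
rewrite /pker subrr N0 expr0n subr0 N_circle gtr0_norm // divff ?mulr1 //.
by rewrite expf_neq0 // gt_eqF.
Qed.

(** This normalization lets [omit_log_value] compare the branch at the centre with a chosen
    logarithm. *)
Lemma schwarz_center : Im (schwarz c) = 0.
Proof.
rewrite /schwarz; have -> : KI 1 c = CI (fun t => (phi t)%:C * 1).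
  congr CI; apply/funext => t; rewrite expr1 subrr subr0 divff //.
  by rewrite -N_gt0 Ne.
have I0 : Im (CI (fun t => (phi t)%:C * 1)) = 0.
  rewrite /CI [LHS]/=; rewrite (@eq_Int R _ _ _ (fun _ => 0)); first by rewrite Int_cst ?(ltW twopi_gt0) // mul0r.
  by move=> t _; rewrite mulr0 mul0r addr0.
move: (CI _) I0 => X I0; have -> : 2%:R * X - X = X by ring.
by rewrite ImM I0 [Im _%:C]/= mulr0 mul0r addr0.
Qed.

(** On the half disc [|e / (e - x)|] is at most 2, and [N_CI] loses a factor 2; the two terms give
    [8 * M] and [2 * M]. *)
Lemma schwarz_bound z : N (z - c) <= rho / 2 -> N (schwarz z) <= 10 * M.
Proof.
move=> zr; have r0 := rho0; have m0 := M0.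
have zd : disc c rho z by rewrite /disc /=; lra.
have p0 := @twopi_gt0 R.
have b1 : N (KI 1 z) <= 2 * (2 * M) * (2 * pi).
  apply: N_CI; first exact: cigKI.
  move=> t; rewrite NM NC; case: bF => _ /(_ t) bt.
  rewrite mulrC; apply: ler_pM; rewrite ?N_ge0 //.
  apply: le_trans (Npow 1 t zd) _; rewrite expr1 ler_pdivrMr; lra.
have b2 : N (CI (fun t => (phi t)%:C * 1)) <= 2 * M * (2 * pi).
  apply: N_CI; last by move=> t; rewrite mulr1 NC; have [_] := bF; apply.
  by apply: (bmeas_cig (B := 1) bF) => [|t]; [exact: cst_continuous|rewrite N1].
rewrite /schwarz NM NC ger0_norm ?invr_ge0 ?(ltW p0) // mulrC ler_pdivrMr //.
apply: le_trans (ler_NB _ _) _; rewrite NM N_nat; move: p0 b1 b2; set q := 2 * pi; lra.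
Qed.

Lemma pkerF_ig z : disc c rho z -> ig 0 (2 * pi) (fun t => F (circle c rho t) * pker z t).
Proof.
move=> zr; apply: bmeas_ig (bmeasM (B := (rho + N (z - c)) / (rho - N (z - c))) bF (pker_cont zr) _).
move=> t; rewrite ger0_norm ?pker_ge0 //.
by have /andP[] := pker_bounds t zr.
Qed.

(** The hypothesis concerns the data near one point of the circle, since in [bouligand] they are an
    indicator, continuous only at some points. *)
Lemma poisson_limit (zeta : C) (L : R) : N (zeta - c) = rho ->
  (forall eps : R, 0 < eps -> exists2 d, 0 < d & forall t, N (circle c rho t - zeta) < d ->
     `|F (circle c rho t) - L| <= eps) ->
  forall eps : R, 0 < eps -> \forall z \near zeta, disc c rho z -> `|poisson z - L| <= eps.
Proof.
move=> zc H eps eps0.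
have e2 : 0 < eps / 2 by rewrite divr_gt0.
have [d d0 D] := H _ e2.
(* Away from [zeta] the kernel is at most [2 * rho * N (z - zeta)] over [(d / 2) ^+ 2], and the data
   differ from [L] by at most [M + |L|]. *)
pose K := (M + `|L|) * (2 * rho * (d / 2)^-1 ^+ 2) + 1.
have K0 : 0 < K.
  by rewrite ltr_wpDl // mulr_ge0 ?addr_ge0 // !mulr_ge0 ?(ltW rho0) ?exprn_ge0 ?invr_ge0 ?divr_ge0 ?(ltW d0).
have q0 : 0 < Num.min (d / 2) (eps / 2 / K) by rewrite lt_min !divr_gt0.
apply: filterS (near_disc zeta q0) => z; rewrite /disc /= lt_min => /andP[zd ze] zr.
have p2 := @twopi_gt0 R.
have kig := pker_ig zr.
have -> : poisson z - L = (2 * pi)^-1 * Int 0 (2 * pi) (fun t => F (circle c rho t) * pker z t - L * pker z t).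
  rewrite IntB; [|exact: pkerF_ig|exact: igZ].
  by rewrite IntZ // mulrBr -poissonE // mulrCA pker_int // mulr1.
rewrite normrM ger0_norm ?invr_ge0 ?(ltW p2) //.
rewrite mulrC ler_pdivrMr //.
have igd : ig 0 (2 * pi) (fun t => F (circle c rho t) * pker z t - L * pker z t).
  by apply: igB; [exact: pkerF_ig|exact: igZ].
apply: le_trans (Int_norm igd) _.
pose Q := (M + `|L|) * ((2 * rho * N (z - zeta)) / (d / 2) ^+ 2).
have igr : ig 0 (2 * pi) (fun t => eps / 2 * pker z t + Q).
  by apply: igD; [exact: igZ|exact: ig_cst].
have bound t : `|F (circle c rho t) * pker z t - L * pker z t| <= eps / 2 * pker z t + Q.
  rewrite -mulrBl normrM (ger0_norm (pker_ge0 t zr)).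
  have k0 := pker_ge0 t zr.
  have n0 := N_ge0 (z - zeta).
  have ML : `|F (circle c rho t) - L| <= M + `|L|.
    by apply: le_trans (ler_normB _ _) _; rewrite lerD2r; case: bF.
  have ML0 : 0 <= M + `|L| by rewrite addr_ge0.
  have [near_z|far] := ltP (N (circle c rho t - zeta)) d.
    apply: le_trans (ler_wpM2r k0 (D t near_z)) _; rewrite lerDl.
    by rewrite !mulr_ge0 ?divr_ge0 ?invr_ge0 ?exprn_ge0 ?mulr_ge0 ?(ltW rho0)// ltW.
  apply: le_trans (ler_wpM2r k0 ML) _; apply: ler_wpDl.
    by rewrite mulr_ge0 // ltW.
  apply: ler_wpM2l => //; rewrite /pker.
  have far' : d / 2 <= N (circle c rho t - z).
    by have := N_tri z (circle c rho t) zeta; move: zd far; lra.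
  have rz : rho - N (z - c) <= N (z - zeta).
    by have := N_tri z zeta c; rewrite zc (NBC zeta z); lra.
  have num : rho ^+ 2 - N (z - c) ^+ 2 <= 2 * rho * N (z - zeta).
    have nn := N_ge0 (z - c).
    by rewrite subr_sqr mulrC; apply: ler_pM; lra.
  have num0 : 0 <= rho ^+ 2 - N (z - c) ^+ 2.
    have nn := N_ge0 (z - c).
    by rewrite subr_sqr mulr_ge0 //; lra.
  apply: ler_pM => //; first by rewrite invr_ge0 exprn_ge0 // N_ge0.
  have d20 : 0 < d / 2 by rewrite divr_gt0.
  rewrite lef_pV2 ?posrE ?exprn_gt0 //; last by apply: lt_le_trans far'.
  by rewrite lerXn2r ?nnegrE ?N_ge0 // ltW.
apply: le_trans (le_Int (ig_norm igd) igr (fun t _ => bound t)) _.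
rewrite IntD; [|exact: igZ|exact: ig_cst].
rewrite IntZ // Int_cst ?(ltW p2) // subr0.
have -> : Int 0 (2 * pi) (pker z) = 2 * pi.
  by have := pker_int zr => /(congr1 ( *%R (2 * pi))); rewrite mulVKf ?gt_eqF // mulr1.
rewrite -mulrDl ler_pM2r // -[leRHS](divfK (_ : 2 != 0)) // mulr2n mulrDr mulr1 lerD2l.
have -> : Q = (K - 1) * N (z - zeta) by rewrite /Q /K exprVn; ring.
apply: le_trans (_ : K * N (z - zeta) <= _).
  by apply: ler_wpM2r; [exact: N_ge0|rewrite gerBl].
by rewrite mulrC -ler_pdivlMr // ltW.
Qed.

End PoissonKernel.

(** * Harnack's inequality and limits of harmonic functions *)

Section HarmonicFunctions.
Context {R : realType}.
Local Notation C := R[i].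
Implicit Types (c p z w : C) (r s t M : R) (u v : C -> R) (U : set C).

Lemma cdisc_bound u c r : (forall z, cdisc c r z -> {for z, continuous u}) ->
  exists M, forall z, cdisc c r z -> `|u z| <= M.
Proof.
move=> cu; have [r0|r0] := ltP r 0.
  by exists 0 => z; rewrite /cdisc /= => /(le_trans (N_ge0 _)); rewrite leNgt r0.
have ne : cdisc c r !=set0 by exists c; rewrite /cdisc /= subrr N0.
have cv z : cdisc c r z -> {for z, continuous (fun w => `|u w|)}.
  move=> /cu cz; apply: (@continuous_comp _ _ _ u (fun x => `|x|)) => //.
  exact: norm_continuous.
have [p _ H] := compact_max (@compact_cdisc R c r) ne cv.
by exists `|u p|.
Qed.

Lemma frontier_disc c r z : 0 < r -> frontier (disc c r) z -> N (z - c) = r.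
Proof.
move=> r0 [cz nz].
have : closure (cdisc c r) z by apply: closure_subset cz => w /ltW.
rewrite -(closure_id _).1; last exact: cdisc_closed.
rewrite /cdisc /= le_eqVlt => /predU1P[//|zr]; exfalso; apply: nz.
by apply: open_nbhs_nbhs; split=> //; exact: disc_open.
Qed.

Lemma disc_bounded c r z : disc c r z -> N z <= N c + r.
Proof.
rewrite /disc /= => zr; have -> : z = c + (z - c) by ring.
by apply: le_trans (ler_N _ _) _; rewrite lerD2l ltW.
Qed.

Lemma circle_cdisc c r t : 0 <= r -> cdisc c r (circle c r t).
Proof. by move=> r0; rewrite /cdisc /= N_circle0. Qed.

Section Representation.
Variables (u : C -> R) (c : C) (rho : R).
Hypothesis rho0 : 0 < rho.
Hypothesis cu : forall z, cdisc c rho z -> {for z, continuous u}.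

Lemma cont_circle_bmeas : exists M, bmeas (fun t => u (circle c rho t)) M.
Proof.
have [M HM] := cdisc_bound cu; exists M; apply: cont_bmeas.
  by apply: cont_circle => t; apply: cu; apply: circle_cdisc; exact: ltW.
by move=> t; apply: HM; apply: circle_cdisc; exact: ltW.
Qed.

Lemma poisson_boundary zeta : N (zeta - c) = rho -> forall e : R, 0 < e ->
  \forall z \near zeta, disc c rho z -> `|poisson c rho u z - u zeta| <= e.
Proof.
move=> zc; have [M bM] := cont_circle_bmeas.
apply: (poisson_limit rho0 bM zc) => e e0.
have cz : cdisc c rho zeta by rewrite /cdisc /= zc.
have [d d0 D] := (contC _ _).1 (cu cz) e e0.
by exists d => // t /D/ltW.
Qed.

Lemma near_cont zeta (e : R) : cdisc c rho zeta -> 0 < e ->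
  \forall z \near zeta, `|u z - u zeta| <= e.
Proof.
move=> cz e0; have [d d0 D] := (contC _ _).1 (cu cz) e e0.
by apply/nbhs_discP; exists d => // z /D/ltW.
Qed.

Lemma poisson_repr : mvp (disc c rho) u ->
  forall z, disc c rho z -> u z = poisson c rho u z.
Proof.
move=> mu z zr; have [M bM] := cont_circle_bmeas.
have mP := poisson_mvp rho0 bM.
have oD : open (disc c rho) by exact: disc_open.
apply/eqP; rewrite eq_le; apply/andP; split.
  apply: (max_principle_real oD (@disc_bounded c rho) (mvp_smvp mu) mP _ zr).
  move=> zeta fz e e0; have zc := frontier_disc rho0 fz.
  have e2 : 0 < e / 2 by rewrite divr_gt0.
  have cz : cdisc c rho zeta by rewrite /cdisc /= zc.
  apply: filterS2 (poisson_boundary zc e2) (near_cont cz e2) => w H1 H2 /H1.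
  by move: H2; rewrite !ler_norml => /andP[? ?] /andP[? ?]; lra.
apply: (max_principle_real oD (@disc_bounded c rho) (mvp_smvp mP) mu _ zr).
move=> zeta fz e e0; have zc := frontier_disc rho0 fz.
have e2 : 0 < e / 2 by rewrite divr_gt0.
have cz : cdisc c rho zeta by rewrite /cdisc /= zc.
apply: filterS2 (poisson_boundary zc e2) (near_cont cz e2) => w H1 H2 /H1.
by move: H2; rewrite !ler_norml => /andP[? ?] /andP[? ?]; lra.
Qed.

Lemma mvp_mean : mvp (disc c rho) u -> u c = cmean u c rho.
Proof.
move=> mu; have [M bM] := cont_circle_bmeas.
by rewrite (poisson_repr mu (disc_center c rho0)) (poisson_center rho0 bM).
Qed.

Lemma harnack z : mvp (disc c rho) u -> (forall z, cdisc c rho z -> 0 <= u z) ->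
  disc c rho z ->
  (rho - N (z - c)) / (rho + N (z - c)) * u c <= u z <=
  (rho + N (z - c)) / (rho - N (z - c)) * u c.
Proof.
move=> mu u0 zr; have [M bM] := cont_circle_bmeas.
rewrite (poisson_repr mu zr) (poissonE rho0 bM zr) (mvp_mean mu) /cmean !(mulrCA _ (2 * pi)^-1).
have p2 : 0 < (2 * pi : R)^-1 by rewrite invr_gt0 twopi_gt0.
rewrite !ler_pM2l //.
have igu : ig 0 (2 * pi) (fun t => u (circle c rho t)) by exact: bmeas_ig bM.
have igk := pkerF_ig rho0 bM zr.
rewrite -!IntZ //.
have uc t : 0 <= u (circle c rho t) by apply: u0; apply: circle_cdisc; exact: ltW.
apply/andP; split; (apply: le_Int; try exact: igZ; try exact: igk) => t _;
  have /andP[k1 k2] := pker_bounds rho0 t zr.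
  by rewrite mulrC ler_wpM2l.
by rewrite (mulrC (_ / _)) ler_wpM2l.
Qed.

Lemma harnack_half z : mvp (disc c rho) u -> (forall z, cdisc c rho z -> 0 <= u z) ->
  N (z - c) <= rho / 2 -> u c / 3 <= u z <= 3 * u c.
Proof.
move=> mu u0 zr; have n0 := N_ge0 (z - c); have r0 := rho0.
have zd : disc c rho z by apply: le_lt_trans zr _; rewrite ltr_pdivrMr // ltr_pMr // ltr1n.
have uc : 0 <= u c by apply: u0; rewrite /cdisc /= subrr N0 ltW.
have /andP[h1 h2] := harnack mu u0 zd.
apply/andP; split.
  apply: le_trans h1; rewrite mulrC; apply: ler_wpM2r => //.
  by rewrite ler_pdivlMr; lra.
apply: le_trans h2 _; apply: ler_wpM2r => //.
by rewrite ler_pdivrMr; lra.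
Qed.

End Representation.

(** Harnack's inequality for the nonnegative function [u + M]: for [d <= rho / 2] both factors are
    within [4 * d / rho] of 1, and the value at the centre is at most [2 * M]. *)
Lemma mvp_lipschitz u c rho M z : 0 < rho ->
  (forall z, cdisc c rho z -> {for z, continuous u}) ->
  mvp (disc c rho) u -> (forall z, cdisc c rho z -> `|u z| <= M) ->
  N (z - c) <= rho / 2 -> `|u z - u c| <= 8 * M / rho * N (z - c).
Proof.
move=> rho0 cu mu uM zr; have n0 := N_ge0 (z - c).
have zd : disc c rho z by apply: le_lt_trans zr _; rewrite ltr_pdivrMr // ltr_pMr // ltr1n.
have oD : open (disc c rho) by exact: disc_open.
pose v w := u w + M.
have cv w : cdisc c rho w -> {for w, continuous v}.
  by move=> /cu ?; apply: (@cvgD _ _ _ (nbhs w) (nbhs_filter w)) => //; exact: cvg_cst.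
have mv : mvp (disc c rho) v by apply: mvpD => //; exact: mvp_cst.
have v0 w : cdisc c rho w -> 0 <= v w.
  by move=> /uM; rewrite ler_norml /v => /andP[]; lra.
have cc : cdisc c rho c by rewrite /cdisc /= subrr N0 ltW.
have := uM c cc; rewrite ler_norml => /andP[uc1 uc2].
have M0 : 0 <= M by lra.
have vc : 0 <= v c <= 2 * M by rewrite /v; apply/andP; split; lra.
have := harnack rho0 cv mv v0 zd.
move: vc; have -> : u z - u c = v z - v c by rewrite /v; ring.
move: (v c) (v z) (N (z - c)) n0 zr => a b d d0 dr /andP[a0 aM] /andP[h1 h2].
have rd : rho / 2 <= rho - d by lra.
have r2 : 0 < rho - d by lra.
have r3 : 0 < rho + d by lra.
have k1 : (rho + d) / (rho - d) <= 1 + 4 * d / rho.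
  rewrite ler_pdivrMr // -subr_ge0.
  have -> : (1 + 4 * d / rho) * (rho - d) - (rho + d) = 2 * d * (rho - 2 * d) / rho.
    by field; rewrite gt_eqF.
  by rewrite divr_ge0 ?(ltW rho0) // mulr_ge0 //; lra.
have k2 : 1 - 4 * d / rho <= (rho - d) / (rho + d).
  rewrite ler_pdivlMr // -subr_ge0.
  have -> : (rho - d) - (1 - 4 * d / rho) * (rho + d) = 2 * d * (rho + 2 * d) / rho.
    by field; rewrite gt_eqF.
  by rewrite divr_ge0 ?(ltW rho0) // mulr_ge0 //; lra.
have q0 : 0 <= 4 * d / rho by rewrite divr_ge0 ?(ltW rho0) // mulr_ge0.
have -> : 8 * M / rho * d = 4 * d / rho * (2 * M) by ring.
have := ler_wpM2r a0 k1; have := ler_wpM2r a0 k2; have := ler_wpM2l q0 aM.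
by move: h1 h2; rewrite ler_norml => ? ? ? ? ?; apply/andP; split; lra.
Qed.

(* Locally bounded harmonic functions are equicontinuous, so pointwise
   convergence along any filter is locally uniform. *)
Lemma mvp_limit (I : Type) (F : set_system I) (FF : ProperFilter F) (u : I -> C -> R)
    (x : C -> R) c r M : 0 < r ->
  (\forall i \near F, mvp (disc c (3 * r)) (u i) /\ forall z, disc c (3 * r) z -> `|u i z| <= M) ->
  (forall z, disc c (3 * r) z -> (fun i => u i z) @ F --> x z) ->
  (forall e : R, 0 < e -> \forall i \near F, forall z, cdisc c r z -> `|u i z - x z| <= e) /\
  mvp (disc c r) x.
Proof.
move=> r0 Hu Hx.
pose L := 8 * M / r + 1.
have M0 : 0 <= M.
  have [i [_ Hi]] := filter_ex Hu; apply: le_trans (Hi c _); first exact: normr_ge0.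
  by apply: disc_center; rewrite mulr_gt0.
have L0 : 0 < L by rewrite ltr_wpDl // divr_ge0 ?(ltW r0) // mulr_ge0.
have sub z w : cdisc c r z -> cdisc z r w -> disc c (3 * r) w.
  rewrite /cdisc /disc /= => zr wr; apply: le_lt_trans (N_tri z _ _) _.
  by apply: le_lt_trans (lerD wr zr) _; lra.
have lip i z w : mvp (disc c (3 * r)) (u i) -> (forall z, disc c (3 * r) z -> `|u i z| <= M) ->
    cdisc c r z -> N (w - z) <= r / 2 -> `|u i w - u i z| <= L * N (w - z).
  move=> mu bu zr wz; apply: le_trans (mvp_lipschitz r0 _ _ _ wz) _.
  - by move=> y yz; case: (mu y (sub _ _ zr yz)).
  - by apply: mvp_sub mu => y /ltW yz; exact: sub zr yz.
  - by move=> y yz; apply: bu; exact: sub zr yz.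
  by apply: ler_wpM2r; rewrite ?N_ge0 // lerDl.
have lipx z w : cdisc c r z -> N (w - z) <= r / 2 -> `|x w - x z| <= L * N (w - z).
  move=> zr wz; apply/ler_addgt0Pr => e e0.
  have e2 : 0 < e / 2 by rewrite divr_gt0.
  have wr : disc c (3 * r) w.
    by apply: sub zr _; rewrite /cdisc /=; apply: le_trans wz _; lra.
  have zr' : disc c (3 * r) z by apply: sub zr _; rewrite /cdisc /= subrr N0 ltW.
  have /cvgrPdist_lt/(_ _ e2) B := Hx w wr.
  have /cvgrPdist_lt/(_ _ e2) A := Hx z zr'.
  have [i [[hi1 hi2] [hz hw]]] := filter_ex (filterI Hu (filterI A B)).
  have := lip i z w hi1 hi2 zr wz.
  have -> : x w - x z = (x w - u i w) + (u i w - u i z) - (x z - u i z) by ring.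
  move=> H; apply: le_trans (ler_normB _ _) _.
  apply: le_trans (lerD (ler_normD _ _) (lexx _)) _; lra.
have unif e : 0 < e -> \forall i \near F, forall z, cdisc c r z -> `|u i z - x z| <= e.
  move=> e0; have e3 : 0 < e / 3 by rewrite divr_gt0.
  apply: ((compact_near_coveringP _).1 (@compact_cdisc R c r) I F (fun i z => `|u i z - x z| <= e)) => z zr.
  have d0 : 0 < Num.min (r / 2) (e / 3 / L) by rewrite lt_min !divr_gt0.
  have zr' : disc c (3 * r) z by apply: sub zr _; rewrite /cdisc /= subrr N0 ltW.
  exists (disc z (Num.min (r / 2) (e / 3 / L)),
    [set i | (mvp (disc c (3 * r)) (u i) /\ forall z, disc c (3 * r) z -> `|u i z| <= M)
      /\ `|x z - u i z| < e / 3]) => /=.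
    split; first exact: near_disc.
    by apply: filterI => //; have /cvgrPdist_lt := Hx z zr'; apply.
  move=> [w i] /= [wd [[hi1 hi2] hz]].
  move: wd; rewrite /disc /= lt_min => /andP[/ltW w1 w2].
  have wL : L * N (w - z) <= e / 3 by rewrite mulrC -ler_pdivlMr // ltW.
  have h1 := lip i z w hi1 hi2 zr w1; have h2 := lipx z w zr w1.
  have -> : u i w - x w = (u i w - u i z) - (x z - u i z) - (x w - x z) by ring.
  apply: le_trans (ler_normB _ _) _.
  apply: le_trans (lerD (ler_normB _ _) (lexx _)) _; lra.
split=> // z zr; have oD : open (disc c r) by exact: disc_open.
have cx y : disc c r y -> {for y, continuous x}.
  move=> /ltW yr; apply/contC => e e0.
  have d0 : 0 < Num.min (r / 2) (e / L) by rewrite lt_min !divr_gt0.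
  exists (Num.min (r / 2) (e / L)) => // w; rewrite /disc /= lt_min => /andP[/ltW w1 w2].
  apply: le_lt_trans (lipx y w yr w1) _; by rewrite mulrC -ltr_pdivlMr.
split; first exact: cx.
have [d dpos D] := open_disc oD zr.
apply: (near_small dpos) => s /andP[s0 sd].
have cs y : cdisc z s y -> disc c r y by move=> ys; apply: D; apply: le_lt_trans ys sd.
have c3 y : disc c r y -> disc c (3 * r) y.
  by move=> /ltW yr; apply: sub yr _; rewrite /cdisc /= subrr N0 ltW.
apply: eq_eps => e e0; have e2 : 0 < e / 2 by rewrite divr_gt0.
have [i [[hi1 hi2] hu]] := filter_ex (filterI Hu (unif _ e2)).
have mi : u i z = cmean (u i) z s.
  apply: mvp_mean => //; first by move=> y ys; case: (hi1 y) => //; apply/c3/cs.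
  by apply: mvp_sub hi1 => y /ltW ys; apply/c3/cs.
have Cz : cdisc z s z by rewrite /cdisc /= subrr N0 ltW.
have h1 : `|u i z - x z| <= e / 2 by apply: hu; apply: ltW; exact: cs.
have cci t : cdisc z s (circle z s t) by apply: circle_cdisc; exact: ltW.
have igx : ig 0 (2 * pi) (fun t => x (circle z s t)).
  by apply: cont_circle_ig => t; apply/cx/cs.
have igi : ig 0 (2 * pi) (fun t => u i (circle z s t)).
  by apply: cont_circle_ig => t; case: (hi1 (circle z s t)) => //; apply/c3/cs.
have h2 : `|cmean (u i) z s - cmean x z s| <= e / 2.
  rewrite /cmean -mulrBr -IntB // normrM ger0_norm ?invr_ge0 ?(ltW twopi_gt0) //.
  rewrite mulrC ler_pdivrMr ?twopi_gt0 // -{2}(subr0 (2 * pi)).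
  apply: Int_bound; rewrite ?(ltW twopi_gt0) //; first exact: igB.
  by move=> t _; apply: hu; apply: ltW; apply: cs.
have -> : x z - cmean x z s = (cmean (u i) z s - cmean x z s) - (u i z - x z) by rewrite mi; ring.
apply: le_trans (ler_normB _ _) _; lra.
Qed.

Lemma is_derive_eps (k : R -> R) (x d : R) : (forall e : R, 0 < e ->
    exists2 r, 0 < r & forall s, `|s| < r -> `|k (s + x) - k x - d * s| <= e * `|s|) ->
  is_derive x 1 k d.
Proof.
move=> H.
have K : (fun h : R => h^-1 *: (k (h *: 1 + x) - k x)) @ 0^' --> d.
  apply/cvgrPdist_le => e e0; have [r r0 D] := H e e0.
  apply/nbhs_ballP; exists r => //= s; rewrite /ball /= sub0r normrN => sr s0.
  have := D s sr; rewrite /GRing.scale /= mulr1 => E.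
  have -> : d - s^-1 * (k (s + x) - k x) = - (s^-1 * (k (s + x) - k x - d * s)).
    by field.
  by rewrite normrN normrM normfV mulrC ler_pdivrMr ?normr_gt0.
apply: DeriveDef; first by apply/cvg_ex; exists d.
exact/cvg_lim.
Qed.

(** Taken with [a = 1] for [dx] and [a = i] for [dy]. *)
Lemma is_derive_Re (u : C -> R) (Phi : C -> C) z d (a : C) : N a = 1 ->
  (\forall w \near z, u w = Re (Phi w)) -> cderiv Phi z d ->
  is_derive (0 : R) 1 (fun t : R => u (z + t%:C * a)) (Re (a * d)).
Proof.
move=> Na /nbhs_discP[r1 r10 E] H; apply: is_derive_eps => e e0.
have /nbhs_discP[r2 r20 D] := H e e0.
exists (Num.min r1 r2) => [|s]; first by rewrite lt_min r10.
rewrite lt_min => /andP[s1 s2]; rewrite addr0 mul0r addr0.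
have Ns : N (z + s%:C * a - z) = `|s| by rewrite addrAC subrr add0r NM Na mulr1 NC.
have e1 := E z (disc_center z r10); rewrite e1.
have -> : u (z + s%:C * a) = Re (Phi (z + s%:C * a)) by apply: E; rewrite /disc /= Ns.
have := D (z + s%:C * a); rewrite /disc /= Ns => /(_ s2); apply: le_trans.
apply: le_trans (Re_le_N _); rewrite le_eqVlt; apply/orP; left; apply/eqP; congr `|_|.
have -> : z + s%:C * a - z = s%:C * a by ring.
by move: (Phi _) (Phi _) => A B; rewrite !ReImE /=; ring.
Qed.

Lemma eq_cont U (v w : C -> R) z : open U -> U z -> (forall y, U y -> v y = w y) ->
  {for z, continuous v} -> {for z, continuous w}.
Proof.
move=> oU Uz E /contC cv; apply/contC => e /cv[d d0 D].
have [r r0 Ur] := open_disc oU Uz.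
exists (Num.min d r) => [|y]; first by rewrite lt_min d0.
rewrite /disc /= lt_min => /andP[yd yr].
by rewrite -!E //; [exact: D|exact: Ur].
Qed.

Lemma dyE t : (0 +i* t) = t%:C * ((0 : R) +i* 1).
Proof. by apply: complexP; rewrite !ReImE /=; ring. Qed.

Lemma C1_Re U u (Phi Phi1 : C -> C) : open U -> (forall z, U z -> u z = Re (Phi z)) ->
  (forall z, U z -> cderiv Phi z (Phi1 z)) ->
  (forall z, U z -> {for z, continuous Phi1}) ->
  [/\ C1_on U u, forall z, U z -> dx u z = Re (Phi1 z) &
      forall z, U z -> dy u z = Re (((0 : R) +i* 1) * Phi1 z)].
Proof.
move=> oU E H c1.
have near_E z : U z -> \forall w \near z, u w = Re (Phi w).
  by move=> Uz; apply: filterS (open_nbhs_nbhs (conj oU Uz)) => w; exact: E.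
have Ni : N ((0 : R) +i* 1) = 1 by rewrite /= expr0n /= expr1n add0r sqrtr1.
have Dx z : U z -> is_derive (0 : R) 1 (fun t : R => u (z + (t +i* 0))) (Re (Phi1 z)).
  move=> Uz; have := is_derive_Re (N1 (R:=R)) (near_E z Uz) (H z Uz); rewrite mul1r.
  by congr is_derive; apply/funext => t; rewrite mulr1.
have Dy z : U z -> is_derive (0 : R) 1 (fun t : R => u (z + (0 +i* t))) (Re (((0 : R) +i* 1) * Phi1 z)).
  move=> Uz; have := is_derive_Re Ni (near_E z Uz) (H z Uz).
  by congr is_derive; apply/funext => t; rewrite dyE.
have dxE' z : U z -> dx u z = Re (Phi1 z).
  by move=> Uz; rewrite /dx derive1E; have [_ ->] := Dx z Uz.
have dyE' z : U z -> dy u z = Re (((0 : R) +i* 1) * Phi1 z).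
  by move=> Uz; rewrite /dy derive1E; have [_ ->] := Dy z Uz.
split=> // z Uz; split.
- by case: (Dx z Uz).
- by case: (Dy z Uz).
- apply: (eq_cont oU Uz (v := fun w => Re (Phi1 w))) => [y Uy|]; first by rewrite dxE'.
  by apply: (@continuous_comp _ _ _ Phi1 (@complex.Re R)); [exact: c1|exact: continuous_Re].
- apply: (eq_cont oU Uz (v := fun w => Re (((0 : R) +i* 1) * Phi1 w))) => [y Uy|]; first by rewrite dyE'.
  apply: (@continuous_comp _ _ _ (fun w => ((0 : R) +i* 1) * Phi1 w) (@complex.Re R)); last exact: continuous_Re.
  by apply: (@cvgM _ _ (nbhs z) (nbhs_filter z)); [exact: cvg_cst|exact: c1].
Qed.

Lemma harmonic_Re U u (Phi Phi1 Phi2 : C -> C) : open U -> (forall z, U z -> u z = Re (Phi z)) ->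
  (forall z, U z -> cderiv Phi z (Phi1 z)) -> (forall z, U z -> cderiv Phi1 z (Phi2 z)) ->
  (forall z, U z -> {for z, continuous Phi2}) -> harmonic_on U u.
Proof.
move=> oU E H1 H2 c2.
have [C1u ux uy] := C1_Re oU E H1 (fun z Uz => cderiv_cont (H2 z Uz)).
have [C1x uxx _] := C1_Re oU ux H2 c2.
have [C1y _ uyy] := C1_Re oU uy (fun z Uz => cderivZ ((0 : R) +i* 1) (H2 z Uz))
  (fun z Uz => cvgM (cvg_cst _) (c2 z Uz)).
split=> // z Uz; rewrite uxx // uyy //.
by move: (Phi2 z) => w; rewrite !ReImE /=; ring.
Qed.

(** Locally [u] is the real part of its Schwarz integral, whose first two derivatives are
    explicit. *)
Lemma mvp_harmonic U u : open U -> mvp U u -> harmonic_on U u.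
Proof.
move=> oU mu.
have loc z : U z -> exists2 r, 0 < r & harmonic_on (disc z r) u.
  move=> Uz; have [d d0 D] := open_disc oU Uz.
  have r0 : 0 < d / 2 by rewrite divr_gt0.
  have sub w : cdisc z (d / 2) w -> U w.
    by rewrite /cdisc /= => wr; apply: D; rewrite /disc /=; lra.
  have cu w : cdisc z (d / 2) w -> {for w, continuous u} by move=> /sub/mu[].
  have [M bM] := cont_circle_bmeas r0 cu.
  have mu' : mvp (disc z (d / 2)) u by apply: mvp_sub mu => w /ltW/sub.
  exists (d / 2) => //.
  apply: (@harmonic_Re _ _ (schwarz z (d / 2) u) (schwarz1 z (d / 2) u) (schwarz2 z (d / 2) u)).
  - exact: disc_open.
  - by move=> w wr; rewrite (poisson_repr r0 cu mu' wr).
  - by move=> w wr; exact: cderiv_schwarz bM _ wr.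
  - by move=> w wr; exact: cderiv_schwarz1 bM _ wr.
  - by move=> w wr; apply: cdiff_cont; exact: cdiff_schwarz2 bM _ wr.
split=> z Uz; have [r r0 [h1 h2 h3 h4]] := loc z Uz; have zr := disc_center z r0.
- exact: h1.
- exact: h2.
- exact: h3.
- exact: h4.
Qed.

End HarmonicFunctions.

(** * Perron's method *)

Section PerronMethod.
Context {R : realType}.
Local Notation C := R[i].
Implicit Types (c p z w zeta : C) (r s t e : R) (u v phi : C -> R).

Lemma near_smvp U u v : open U -> (forall z, U z -> u z = v z) -> smvp U u -> smvp U v.
Proof.
move=> oU E H z Uz; have [cu mu] := H z Uz; split; first exact: eq_cont oU Uz E cu.
apply: filterS2 mu (circle_near oU Uz) => r; rewrite E // => h cU.
apply: le_trans h _; rewrite le_eqVlt; apply/orP; left; apply/eqP.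
by congr (_ * _); apply: eq_Int => t _; rewrite E.
Qed.

Lemma smvp_sub U V u : U `<=` V -> smvp V u -> smvp U u.
Proof. by move=> UV H z /UV/H. Qed.

Lemma smvpZ U (k : R) u : open U -> 0 <= k -> smvp U u -> smvp U (fun z => k * u z).
Proof.
move=> oU k0 hu z Uz; have [cu mu] := hu z Uz; split.
  by apply: (@cvgM _ _ (nbhs z) (nbhs_filter z)) => //; exact: cvg_cst.
apply: filterS2 mu (circle_near oU Uz) => r h cU.
rewrite /cmean IntZ; last by apply: cont_circle_ig => t; case: (hu _ (cU t)).
by rewrite mulrCA ler_wpM2l.
Qed.

(** Continuous real-valued subsolutions, a smaller class than in [perron]; Poisson modification and
    real suprema apply to them directly. *)
Definition perron_class (U : set C) phi v := smvp U v /\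
  forall zeta, frontier U zeta -> forall e, 0 < e ->
    \forall w \near zeta, U w -> v w <= phi zeta + e.

(** Weak in that nothing keeps [b] away from 0 at other boundary points; [bouligand] makes up for
    this. *)
Definition weak_barrier (U : set C) zeta (b : C -> R) :=
  [/\ mvp U b, forall z, U z -> 0 < b z &
    forall e, 0 < e -> \forall z \near zeta, U z -> b z <= e].

Lemma nearC (P : set C) z : (forall w, P w) -> \forall w \near z, P w.
Proof. by move=> H; apply/nbhs_discP; exists 1. Qed.

Variables (U : set C) (M : R).
Hypothesis oU : open U.
Hypothesis bU : forall z, U z -> N z <= M.

Lemma frontier_notin zeta : frontier U zeta -> ~ U zeta.
Proof. by move=> [_ nz] Uz; apply: nz; apply: open_nbhs_nbhs. Qed.

Lemma perron_class_max phi v1 v2 : perron_class U phi v1 -> perron_class U phi v2 ->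
  perron_class U phi (fun z => Num.max (v1 z) (v2 z)).
Proof.
move=> [s1 b1] [s2 b2]; split; first exact: smvp_max.
move=> zeta fz e e0; apply: filterS2 (b1 _ fz _ e0) (b2 _ fz _ e0) => w h1 h2 Uw.
by rewrite ge_max h1 ?h2.
Qed.

Lemma perron_class_add phi1 phi2 v1 v2 : (forall z, frontier U z -> phi1 z + phi2 z <= 0) ->
  perron_class U phi1 v1 -> perron_class U phi2 v2 -> forall z, U z -> v1 z + v2 z <= 0.
Proof.
move=> phi12 [s1 b1] [s2 b2] z Uz.
apply: (max_principle_real oU bU (smvpD oU s1 s2) (mvp_cst (U:=U) 0) _ Uz).
move=> zeta fz e e0; have e2 : 0 < e / 2 by rewrite divr_gt0.
apply: filterS2 (b1 _ fz _ e2) (b2 _ fz _ e2) => w h1 h2 Uw.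
by have := h1 Uw; have := h2 Uw; have := phi12 _ fz; lra.
Qed.

Section PoissonModification.
Variables (phi v : C -> R) (c : C) (rho : R).
Hypothesis rho0 : 0 < rho.
Hypothesis cU : cdisc c rho `<=` U.
Hypothesis pv : perron_class U phi v.

Definition pmod z := if N (z - c) < rho then poisson c rho v z else v z.

Let cv z : cdisc c rho z -> {for z, continuous v}.
Proof. by move=> /cU; case: pv => sv _ /sv[]. Qed.

Let mP : mvp (disc c rho) (poisson c rho v).
Proof. by have [K bK] := cont_circle_bmeas rho0 cv; apply: poisson_mvp bK. Qed.

Lemma pmod_ge z : U z -> v z <= pmod z.
Proof.
move=> Uz; rewrite /pmod; case: ifPn => // zr.
have oD : open (disc c rho) by exact: disc_open.
have sv : smvp (disc c rho) v.
  by apply: smvp_sub pv.1 => w /ltW; exact: cU.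
apply: (max_principle_real oD (@disc_bounded _ c rho) sv mP _ zr).
move=> zeta fz e e0; have zc := frontier_disc rho0 fz.
have e2 : 0 < e / 2 by rewrite divr_gt0.
have cz : cdisc c rho zeta by rewrite /cdisc /= zc.
apply: filterS2 (poisson_boundary rho0 cv zc e2) (near_cont cv cz e2) => w H1 H2 /H1.
by move: H2; rewrite !ler_norml => /andP[? ?] /andP[? ?]; lra.
Qed.

Lemma pmod_mvp : mvp (disc c rho) pmod.
Proof.
apply: near_mvp mP; first exact: disc_open.
by move=> z; rewrite /disc /pmod /= => ->.
Qed.

Lemma pmod_class : perron_class U phi pmod.
Proof.
have cm z : U z -> {for z, continuous pmod}.
  move=> Uz; have [zr|zr] := ltP (N (z - c)) rho.
    by case: (pmod_mvp (zr : disc c rho z)).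
  have zn : pmod z = v z by rewrite /pmod ltNge zr.
  apply/contC => e e0; have [sv _] := pv; have [cvz _] := sv z Uz.
  have e2 : 0 < e / 2 by rewrite divr_gt0.
  have [d d0 D] := (contC _ _).1 cvz e e0.
  have [zE|zN] := eqVneq (N (z - c)) rho; last first.
    have z1 : 0 < N (z - c) - rho by rewrite subr_gt0 lt_neqAle eq_sym zN.
    exists (Num.min d (N (z - c) - rho)) => [|w]; first by rewrite lt_min d0.
    rewrite /disc /= lt_min => /andP[wd wr]; rewrite zn /pmod ifN; first exact: D.
    by rewrite -leNgt; have := N_tri w z c; rewrite (NBC z w); lra.
  have /nbhs_discP[d1 d10 D1] := poisson_boundary rho0 cv zE e2.
  exists (Num.min d d1) => [|w]; first by rewrite lt_min d0.
  rewrite /disc /= lt_min => /andP[wd wd1]; rewrite zn /pmod; case: ifPn => wr.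
    by apply: le_lt_trans (D1 w wd1 wr) _; rewrite ltr_pdivrMr // ltr_pMr // ltr1n.
  exact: D.
split.
  move=> z Uz; split; first exact: cm.
  have [zr|zr] := ltP (N (z - c)) rho.
    by have [_ H] := mvp_smvp pmod_mvp (zr : disc c rho z).
  have zn : pmod z = v z by rewrite /pmod ltNge zr.
  have [sv _] := pv; have [_ H] := sv z Uz.
  apply: filterS2 H (circle_near oU Uz) => r h cUr; rewrite zn; apply: le_trans h _.
  apply: le_cmean => t; [by case: (sv _ (cUr t))|exact: cm|exact: pmod_ge].
move=> zeta fz e e0.
have nz : ~ cdisc c rho zeta by move=> /cU; exact: frontier_notin.
have near_out : \forall w \near zeta, rho <= N (w - c).
  have z1 : 0 < N (zeta - c) - rho by rewrite subr_gt0 ltNge; apply/negP.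
  apply: filterS (near_disc zeta z1) => w; rewrite /disc /= => wz.
  by have := N_tri w zeta c; rewrite (NBC zeta w); lra.
have [_ bv] := pv; apply: filterS2 (bv _ fz _ e0) near_out => w h wr Uw.
by rewrite /pmod ltNge wr /= h.
Qed.

End PoissonModification.

Section PerronSolution.
Variables (phi : C -> R) (K : R).
Hypothesis bphi : forall zeta, frontier U zeta -> `|phi zeta| <= K.

Definition psol z : R := sup [set v z | v in perron_class U phi].

Lemma perron_class_cst : perron_class U phi (fun _ => - K).
Proof.
split; first by apply: mvp_smvp; exact: mvp_cst.
move=> zeta /bphi; rewrite ler_norml => /andP[h _] e e0; apply: nearC => w _; lra.
Qed.

Lemma perron_class_le v z : perron_class U phi v -> U z -> v z <= K.
Proof.
move=> pv Uz; have pK : perron_class U (fun _ => - K) (fun _ => - K).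
  split; first by apply: mvp_smvp; exact: mvp_cst.
  by move=> zeta _ e e0; apply: nearC => w _; lra.
have := perron_class_add _ pv pK Uz; rewrite subr_le0; apply => zeta /bphi.
by rewrite ler_norml => /andP[_ h]; rewrite subr_le0.
Qed.

Let hs z : U z -> has_sup [set v z | v in perron_class U phi].
Proof.
move=> Uz; split; first by exists (- K), (fun _ => - K) => //; exact: perron_class_cst.
by exists K => _ [v pv <-]; exact: perron_class_le.
Qed.

Lemma psol_ge v z : perron_class U phi v -> U z -> v z <= psol z.
Proof. by move=> pv Uz; apply: ub_le_sup; [case: (hs Uz)|exists v]. Qed.

Lemma psol_le x z : U z -> (forall v, perron_class U phi v -> v z <= x) -> psol z <= x.
Proof.
move=> Uz H; apply: ge_sup; first by case: (hs Uz).
by move=> _ [v pv <-]; exact: H.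
Qed.

(** Subsolutions are directed by maxima, and each lies below one that is harmonic in the given disc,
    its Poisson modification. The sets [B v0] thus generate a filter along which values converge to
    the supremum, and [mvp_limit] makes the limit harmonic with no choice of sequences. *)
Lemma psol_mvp : mvp U psol.
Proof.
apply: mvp_local => c Uc; have [d d0 D] := open_disc oU Uc.
pose r := d / 6; have r0 : 0 < r by rewrite divr_gt0.
have r3 : 0 < 3 * r by rewrite mulr_gt0.
have cU : cdisc c (3 * r) `<=` U.
  by move=> z; rewrite /cdisc /= => zr; apply: D; apply: le_lt_trans zr _; rewrite /r; lra.
exists (disc c r); first by split; [exact: disc_open|exact: disc_center].
pose B v0 : set (C -> R) := [set v | [/\ perron_class U phi v,
  forall z, U z -> v0 z <= v z & mvp (disc c (3 * r)) v]].
pose F := filter_from (perron_class U phi) B.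
have FF : ProperFilter F.
  apply: filter_from_proper; last first.
    move=> v0 pv; exists (pmod v0 c (3 * r)); split.
    - exact: pmod_class.
    - by move=> z Uz; exact: (pmod_ge r3 cU pv).
    - exact: (pmod_mvp r3 cU pv).
  apply: filter_from_filter; first by exists (fun _ => - K); exact: perron_class_cst.
  move=> v1 v2 p1 p2; exists (fun z => Num.max (v1 z) (v2 z)); first exact: perron_class_max.
  move=> v [pv vmax mv]; split; split => // z Uz; apply: le_trans (vmax z Uz).
    by rewrite le_max lexx.
  by rewrite le_max lexx orbT.
have near_B v0 : perron_class U phi v0 -> \forall v \near F, B v0 v by move=> p0; exists v0.
have [||_ //] := @mvp_limit R _ F FF (fun v => v) psol c r K r0.
  apply: filterS (near_B _ perron_class_cst) => v [pv vK mv]; split=> // z zr.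
  have Uz : U z by apply: cU; exact: ltW.
  by rewrite ler_norml vK // perron_class_le.
move=> z zr; have Uz : U z by apply: cU; exact: ltW.
apply/cvgrPdist_lt => e e0.
have [_ [v0 p0 <-] H] := sup_adherent e0 (hs Uz).
apply: filterS (near_B _ p0) => v [pv v0v _].
rewrite ger0_norm ?subr_ge0 ?psol_ge //.
by have := v0v z Uz; rewrite -/(psol z) in H; lra.
Qed.

End PerronSolution.

Lemma Int_ge0 a b (k : R -> R) : ig a b k -> (forall t, 0 <= k t) -> 0 <= Int a b k.
Proof.
move=> hk k0; have [ab|ba] := leP a b.
  by have := le_Int (ig_cst a b 0) hk (fun t _ => k0 t); rewrite Int_cst // mul0r.
by rewrite /Int set_itv_ge ?bnd_simp -?ltNge // Rintegral_set0.
Qed.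

Definition boundary_layer (d : R) : set C := [set z | U z /\ exists2 y, ~ U y & N (z - y) < d].

Lemma boundary_layer_open d : open (boundary_layer d).
Proof.
apply/open_discP => z [Uz [y nUy zy]]; have [r r0 D] := open_disc oU Uz.
have z1 : 0 < d - N (z - y) by rewrite subr_gt0.
exists (Num.min r (d - N (z - y))) => [|w]; first by rewrite lt_min r0.
rewrite /disc /= lt_min => /andP[wr wd]; split; first exact: D.
by exists y => //; have := N_tri z w y; lra.
Qed.

Lemma boundary_layer_bmeas d c rho : bmeas (fun t => \1_(boundary_layer d) (circle c rho t) : R) 1.
Proof.
split; last by move=> t; rewrite indicE; case: (_ \in _); rewrite ?normr1 ?normr0.
have -> : (fun t => \1_(boundary_layer d) (circle c rho t) : R) =
    \1_(circle c rho @^-1` boundary_layer d).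
  by apply/funext => t; rewrite !indicE; congr (nat_of_bool _)%:R; apply/idP/idP; rewrite !inE.
apply: measurable_funTS; apply: measurable_realfun.measurable_indic; apply: measurable_realfun.open_measurable.
apply: open_comp; last exact: boundary_layer_open.
by move=> t _; exact: continuous_circle.
Qed.

(* The layers [{z in U | dist (z, ~U) < 1 / k}] decrease to the empty set, so
   their traces on a circle have small length. *)
Lemma boundary_layer_small c rho e : 0 < e ->
  exists2 d, 0 < d & Int 0 (2 * pi) (fun t => \1_(boundary_layer d) (circle c rho t)) <= e.
Proof.
move=> e0; pose T (k : nat) : set R := `[0, 2 * pi]%classic `&` (circle c rho @^-1` boundary_layer k.+1%:R^-1).
have mT k : measurable (T k).
  apply: measurableI => //; apply: measurable_realfun.open_measurable.
  apply: open_comp; last exact: boundary_layer_open.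
  by move=> t _; exact: continuous_circle.
have T0 : \bigcap_k T k = set0.
  rewrite -subset0 => t Ht; have [_ [Ut _]] := Ht 0%N I.
  have [r r0 D] := open_disc oU Ut.
  have [k Hk] : exists k, (k.+1%:R^-1 : R) < r.
    exists (Num.bound r^-1); rewrite -[ltRHS]invrK ltf_pV2 ?posrE ?invr_gt0 ?ltr0n //.
    by apply: lt_trans (archi_boundP _) _; rewrite ?invr_ge0 ?(ltW r0) // ltr_nat.
  have [_ [_ [y nUy ty]]] := Ht k I; apply: nUy; apply: D.
  by rewrite /disc /= NBC; apply: lt_trans ty Hk.
have Tdec : nonincreasing_seq T.
  move=> m n mn; apply/subsetPset => t [t1 [Ut [y nUy ty]]]; split=> //; split=> //.
  exists y => //; apply: lt_le_trans ty _.
  by rewrite lef_pV2 ?posrE ?ltr0n // ler_nat ltnS.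
have fin0 : (@lebesgue_measure R (T 0%N) < +oo)%E.
  apply: le_lt_trans (_ : (@lebesgue_measure R `[0%R, (2 * pi)%R]%classic < +oo)%E).
    apply: le_measure; [exact: mem_set (mT 0%N)|apply: mem_set; exact: measurable_itv|].
    by move=> t [].
  by apply: compact_finite_measure; exact: segment_compact.
have mI : measurable (\bigcap_k T k) by rewrite T0.
have := nonincreasing_cvg_mu fin0 mT mI Tdec; rewrite T0 measure0.
move=> /fine_cvgP[_ /cvgrPdist_lt/(_ e e0)[k _ /(_ k (leqnn k))]] /=.
rewrite sub0r normrN => /(le_lt_trans (ler_norm _))/ltW Hk.
exists k.+1%:R^-1; first by rewrite invr_gt0 ltr0n.
apply: le_trans Hk; rewrite /Int /Rintegral le_eqVlt; apply/orP; left; apply/eqP.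
congr fine; have -> : (fun t => (\1_(boundary_layer k.+1%:R^-1) (circle c rho t))%:E) =
   (fun t => (\1_(circle c rho @^-1` boundary_layer k.+1%:R^-1) t : R)%:E).
  by apply/funext => t; congr EFin; rewrite !indicE; congr (nat_of_bool _)%:R; apply/idP/idP; rewrite !inE.
rewrite integral_indic //; first by rewrite setIC.
apply: measurable_realfun.open_measurable; apply: open_comp; last exact: boundary_layer_open.
by move=> t _; exact: continuous_circle.
Qed.

(* Bouligand: a weak barrier, corrected by the Poisson integral of a set of
   small measure on a small circle, is bounded below on that circle. *)
Lemma bouligand phi K zeta b : frontier U zeta -> weak_barrier U zeta b ->
  (forall z, frontier U z -> `|phi z| <= K) ->
  {within frontier U, continuous phi} ->
  forall e, 0 < e -> exists2 v, perron_class U phi v &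
    \forall z \near zeta, U z -> phi zeta - e <= v z.
Proof.
move=> fz [mb b0 bz] bphi cphi e e0.
pose e1 := e / 2; have e10 : 0 < e1 by rewrite divr_gt0.
have [rho rho0 Hrho] : exists2 rho, 0 < rho &
    forall y, frontier U y -> cdisc zeta rho y -> phi zeta - e1 <= phi y.
  have cz := (subspace_continuousP _ _).1 cphi zeta fz.
  have /(@cvgrPdist_lt _ _ _ (within (frontier U) (nbhs zeta)))/(_ _ e10) := cz.
  move=> /nbhs_discP[r r0 D]; exists (r / 2); first by rewrite divr_gt0.
  have {}D y : disc zeta r y -> frontier U y -> `|phi zeta - phi y| < e1 by exact: D.
  move=> y fy; rewrite /cdisc /= => yr; have := D y; rewrite /disc /=.
  have -> : N (y - zeta) < r by lra.
  by move=> /(_ isT fy); rewrite ltr_norml => /andP[]; lra.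
have K0 : 0 <= K by apply: le_trans (bphi zeta fz).
(* A drop by [A] takes [phi zeta] below every boundary value. The choice of [e'] allows three
   errors, from [b], from [P zeta] and from the continuity of [P], whose total cost after
   multiplication by [A] is [e1]. *)
pose A := 2 * K + 1; have A0 : 0 < A by rewrite ltr_wpDl // mulr_ge0.
pose e' := e1 / (3 * A); have e'0 : 0 < e' by rewrite divr_gt0 // mulr_gt0.
have p2 := @twopi_gt0 R.
have [d d0 small] := boundary_layer_small zeta rho (mulr_gt0 e'0 p2).
pose L := boundary_layer d; have oL : open L by exact: boundary_layer_open.
pose psi z : R := \1_L z.
have bpsi : bmeas (fun t => psi (circle zeta rho t)) 1 by exact: boundary_layer_bmeas.
pose P := poisson zeta rho psi.
have mP : mvp (disc zeta rho) P by exact: poisson_mvp bpsi.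
have P0 z : disc zeta rho z -> 0 <= P z.
  move=> zr; rewrite /P (poissonE rho0 bpsi zr) mulr_ge0 ?invr_ge0 ?(ltW p2) //.
  apply: Int_ge0; first exact: (pkerF_ig rho0 bpsi zr).
  by move=> t; rewrite mulr_ge0 ?pker_ge0 // /psi indicE.
have Pz : P zeta <= e'.
  by rewrite /P (poisson_center rho0 bpsi) mulrC ler_pdivrMr.
(* The part of the circle at distance at least [d] from the complement: a compact subset of [U], on
   which [b] has a positive minimum. The rest of the circle inside [U] is left to the Poisson
   integral [P]. *)
pose KF := cdisc zeta rho `&` ~` disc zeta rho `&` ~` [set z | exists2 y, ~ U y & N (z - y) < d].
have cKF : compact KF.
  apply: (@subclosed_compact _ KF _ _ (@compact_cdisc R zeta rho)); last by move=> z [[]].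
  apply: closedI; first apply: closedI.
  - exact: cdisc_closed.
  - by rewrite closedC; exact: disc_open.
  - rewrite closedC; apply/open_discP => z [y nUy zy]; exists (d - N (z - y)).
      by rewrite subr_gt0.
    move=> w; rewrite /disc /= => wz; exists y => //.
    by have := N_tri z w y; lra.
have KFU z : KF z -> U z.
  by move=> [_ nz]; apply: contrapT => nUz; apply: nz; exists z => //; rewrite subrr N0.
have [m m0 Hm] : exists2 m, 0 < m & forall z, KF z -> m <= b z.
  have [[z0 Kz0]|none] := pselect (KF !=set0); last first.
    by exists 1 => // z Kz; exfalso; apply: none; exists z.
  have cb z : KF z -> {for z, continuous (fun w => - b w)}.
    move=> /KFU Uz; apply: (@cvgN _ _ _ (nbhs z) (nbhs_filter z)).
    by case: (mb z Uz).
  have [p Kp Hp] := compact_max cKF (ex_intro _ z0 Kz0) cb.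
  exists (b p); first by apply: b0; exact: KFU.
  by move=> z /Hp; rewrite lerN2.
pose D := U `&` disc zeta rho; have oD : open D by apply: openI => //; exact: disc_open.
pose g z := Num.max (- (m^-1 * b z + P z)) (- 1).
pose nq z := if N (z - zeta) < rho then g z else - 1.
have mg : smvp D g.
  apply: (smvp_max oD); last by apply: mvp_smvp; exact: mvp_cst.
  apply: mvp_smvp; apply: (mvpN oD); apply: (mvpD oD).
    by apply: (mvpZ _ oD); apply: mvp_sub mb => z [].
  by apply: mvp_sub mP => z [].
have gnq z : D z -> g z = nq z by move=> [_]; rewrite /disc /nq /= => ->.
have mnqD : smvp D nq by apply: near_smvp gnq mg.
have nq1 z : - 1 <= nq z.
  by rewrite /nq; case: ifP => // _; rewrite /g le_max lexx orbT.
have nq0 z : U z -> nq z <= 0.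
  move=> Uz; rewrite /nq; case: ifP => zr; last by rewrite lerN10.
  rewrite /g ge_max lerN10 andbT oppr_le0 addr_ge0 ?P0 //.
  by rewrite mulr_ge0 ?invr_ge0 ?(ltW m0) // ltW // b0.
have cnq z : U z -> {for z, continuous nq}.
  move=> Uz; have [zr|zr] := ltP (N (z - zeta)) rho.
    by case: (mnqD z (conj Uz zr)).
  have zn : nq z = - 1 by rewrite /nq ltNge zr.
  suff lim1 eta : 0 < eta -> \forall w \near z, disc zeta rho w -> - (m^-1 * b w + P w) <= - 1 + eta.
    apply/contC => eta eta0; have eta2 : 0 < eta / 2 by rewrite divr_gt0.
    have /nbhs_discP[d1 d10 D1] := lim1 _ eta2; exists d1 => // w /D1; rewrite zn => H.
    rewrite ger0_norm; last by rewrite subr_ge0 nq1.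
    rewrite /nq; case: ifP => wr; last by rewrite addrN.
    rewrite ltrBlDr /g gt_max; apply/andP; split; last by rewrite ltrDr.
    apply: le_lt_trans (H wr) _; rewrite addrC ltrD2r.
    by rewrite ltr_pdivrMr // ltr_pMr // ltr1n.
  move=> eta0; have [zE|zN] := eqVneq (N (z - zeta)) rho; last first.
    have z1 : 0 < N (z - zeta) - rho by rewrite subr_gt0 lt_neqAle eq_sym zN.
    apply: filterS (near_disc z z1) => w; rewrite /disc /= => wz wr.
    by have := N_tri w z zeta; rewrite (NBC z w); move: wz wr; clear; lra.
  have nU : \forall w \near z, U w by exact: open_nbhs_nbhs.
  (* In the layer, [P] tends to 1 because [psi] is 1 near [z]; off the layer [z] is in [KF], where
     [m^-1 * b z] is at least 1. *)
  have [Lz|nLz] := pselect (L z).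
    have [dL dL0 DL] := open_disc oL Lz.
    have H : forall eps, 0 < eps -> exists2 d, 0 < d & forall t, N (circle zeta rho t - z) < d ->
        `|psi (circle zeta rho t) - 1| <= eps.
      move=> eps eps0; exists dL => // t /DL Lt.
      by rewrite /psi indicE mem_set // subrr normr0 ltW.
    apply: filterS2 (poisson_limit rho0 bpsi zE H eta0) nU => w Pw Uw wr.
    have := Pw wr; rewrite ler_norml => /andP[]; rewrite -/P.
    have : 0 <= m^-1 * b w by rewrite mulr_ge0 ?invr_ge0 ?(ltW m0) // ltW // b0.
    by clear; lra.
  have KFz : KF z.
    split; first by split; rewrite /cdisc /disc /= zE ?lexx ?ltxx.
    by move=> Hy; apply: nLz; split.
  have cbz : {for z, continuous b} by case: (mb z Uz).
  have [d1 d10 D1] := (contC _ _).1 cbz _ (mulr_gt0 m0 eta0).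
  apply: filterS (near_disc z d10) => w /D1 bw wr.
  have Pw := P0 w wr; have bm := Hm z KFz.
  have : 1 - eta <= m^-1 * b w.
    rewrite mulrC ler_pdivlMr //.
    by move: bw bm; rewrite ltr_norml => /andP[+ _]; clear; lra.
  by move: Pw; clear; lra.
have mnq : smvp U nq.
  move=> z Uz; split; first exact: cnq.
  have [zr|zr] := ltP (N (z - zeta)) rho; first by case: (mnqD z (conj Uz zr)).
  have zn : nq z = - 1 by rewrite /nq ltNge zr.
  have [_ m1] := @mvp_cst R U (-1) z Uz.
  apply: filterS2 m1 (circle_near oU Uz) => r h1 cUr; rewrite zn h1.
  by apply: le_cmean => t; [exact: cst_continuous|exact: cnq|exact: nq1].
exists (fun z => (phi zeta - e1) + A * nq z).
  split.
    apply: smvpD => //; first by apply: mvp_smvp; exact: mvp_cst.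
    by apply: smvpZ => //; exact: ltW.
  move=> y fy eps eps0; have [yr|yr] := leP (N (y - zeta)) rho.
    apply: filterS (nearC y (fun w => I)) => w _ Uw.
    have := Hrho y fy yr; have : A * nq w <= 0 by rewrite pmulr_rle0 // nq0.
    by move: eps0; clear; lra.
  have z1 : 0 < N (y - zeta) - rho by rewrite subr_gt0.
  apply: filterS (near_disc y z1) => w; rewrite /disc /= => wy _.
  have -> : nq w = - 1.
    by rewrite /nq ifN // -leNgt; have := N_tri w y zeta; rewrite (NBC y w); move: wy; clear; lra.
  have := bphi y fy; have := bphi zeta fz; rewrite /A !ler_norml => /andP[? ?] /andP[? ?].
  lra.
have cPz : {for zeta, continuous P} by case: (mP zeta (disc_center zeta rho0)).
have [d1 d10 D1] := (contC _ _).1 cPz _ e'0.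
have me' : 0 < m * e' by rewrite mulr_gt0.
apply: filterS2 (bz _ me') (filterI (near_disc zeta d10) (near_disc zeta rho0)) => z bw [/D1 Pw zr] Uz.
have -> : nq z = g z by rewrite gnq.
have gz : - (3 * e') <= g z.
  rewrite /g le_max; apply/orP; left.
  have : m^-1 * b z <= e' by rewrite mulrC ler_pdivrMr // mulrC bw.
  by move: Pw; rewrite ltr_norml => /andP[_ Pw]; lra.
have := ler_wpM2l (ltW A0) gz.
have -> : A * - (3 * e') = - e1 by rewrite /e'; field; rewrite gt_eqF.
by rewrite /e1; lra.
Qed.

Lemma closed_frontier : closed (frontier U).
Proof.
rewrite /frontier; apply: closedI; first by refine (@closed_closure _ U).
by rewrite closedC; exact: open_interior.
Qed.

Lemma frontier_compact : compact (frontier U).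
Proof.
refine (@subclosed_compact _ _ _ closed_frontier (bounded_closure_compact bU) _).
by move=> z [].
Qed.

Lemma frontier_bound phi : {within frontier U, continuous phi} ->
  exists K, forall z, frontier U z -> `|phi z| <= K.
Proof.
move=> cphi; have [[z0 fz0]|none] := pselect (frontier U !=set0); last first.
  by exists 0 => z fz; exfalso; apply: none; exists z.
have cn : {within frontier U, continuous (fun z => `|phi z|)}.
  apply: (@within_continuous_comp _ _ _ _ phi (fun x => `|x|)) => // x _.
  exact: norm_continuous.
have [p _ H] := compact_EVT_max (ex_intro _ z0 fz0) frontier_compact cn.
by exists `|phi p| => z fz; apply: H; rewrite inE.
Qed.

Lemma dirichlet_of_barriers :
  (forall zeta, frontier U zeta -> exists b, weak_barrier U zeta b) -> dirichlet_regular U.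
Proof.
move=> HB phi cphi; have [K bphi] := frontier_bound cphi.
exists (psol phi); first by apply: mvp_harmonic => //; exact: psol_mvp bphi.
move=> zeta fz; have [b wb] := HB zeta fz.
have cnphi : {within frontier U, continuous (fun z => - phi z)}.
  by apply: (@within_continuous_comp _ _ _ _ phi -%R) => // x _; exact: opp_continuous.
have bnphi z : frontier U z -> `|- phi z| <= K by rewrite normrN; exact: bphi.
apply/(@cvgrPdist_le _ _ _ (within U (nbhs zeta))) => e e0.
have [v pv Hv] := bouligand fz wb bphi cphi e0.
have [v' pv' Hv'] := bouligand fz wb bnphi cnphi e0.
apply: filterS2 Hv Hv' => z h1 h2 Uz.
have {}h1 := h1 Uz; have {}h2 := h2 Uz.
have l1 := psol_ge bphi pv Uz.
(* A subsolution for [- phi] plus any subsolution for [phi] is nonpositive, so the lower bound for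
   [- phi] is an upper bound for the solution. *)
have l2 : psol phi z <= - v' z.
  apply: (psol_le bphi Uz) => v1 pv1; rewrite -subr_le0 opprK.
  by apply: (perron_class_add _ pv1 pv' Uz) => y _; rewrite subrr.
by rewrite ler_norml; apply/andP; split; lra.
Qed.

Lemma within_nbhs_filter zeta : Filter (within U (nbhs zeta)).
Proof. by apply: within_filter; exact: nbhs_filter. Qed.

Lemma perron_ge phi u z : U z -> smvp U u ->
  (forall zeta, frontier U zeta -> forall e, 0 < e -> \forall w \near zeta, U w -> u w <= phi zeta + e) ->
  ((u z)%:E <= perron U phi z)%E.
Proof.
move=> Uz su Hu; apply: ereal_sup_ubound; exists (fun w => (u w)%:E) => //; split.
  exact: smvp_subharmonic.
move=> zeta fz; apply/(limf_esup_le (within_nbhs_filter zeta)) => e e0.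
by apply: filterS (Hu _ fz e e0) => w h Uw; rewrite lee_fin h.
Qed.

Lemma perron_le phi u z : U z -> mvp U u ->
  (forall zeta, frontier U zeta -> forall e, 0 < e -> \forall w \near zeta, U w -> phi zeta <= u w + e) ->
  (perron U phi z <= (u z)%:E)%E.
Proof.
move=> Uz mu Hu; apply: ge_ereal_sup => _ [v [sv bv] <-].
apply: (max_principle oU bU sv mu _ Uz) => zeta fz e e0.
have e2 : 0 < e / 2 by rewrite divr_gt0.
have := (limf_esup_le (within_nbhs_filter zeta) _ _).1 (bv zeta fz) _ e2.
apply: filterS2 (Hu _ fz _ e2) => w h1 h2 Uw; apply: le_trans (h2 Uw) _.
by rewrite lee_fin; have := h1 Uw; lra.
Qed.

End PerronMethod.

(** * Entire functions and the Fatou set *)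

Section EntireFunctions.
Context {R : realType}.
Local Notation C := R[i].
Implicit Types (c p z w : C) (r s t M B A al : R) (u v : C -> R) (U V G : set C) (f g : C -> C).

Lemma eqC_eps a b : (forall e : R, 0 < e -> N ((a : C) - b) <= e) -> a = b.
Proof.
move=> H; apply/eqP; rewrite -subr_eq0 -N_eq0 eq_le N_ge0 andbT.
apply/ler_addgt0Pr => e /H; by rewrite add0r.
Qed.

Lemma near_lt u v z : {for z, continuous u} -> {for z, continuous v} -> u z < v z ->
  \forall w \near z, u w < v w.
Proof.
move=> cu cv uv; have d0 : 0 < (v z - u z) / 2 by rewrite divr_gt0 // subr_gt0.
have [d1 d10 D1] := (contC _ _).1 cu _ d0; have [d2 d20 D2] := (contC _ _).1 cv _ d0.
apply: filterS2 (near_disc z d10) (near_disc z d20) => w /D1 + /D2.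
rewrite !ltr_norml => /andP[_ h1] /andP[h2 _]; lra.
Qed.

Lemma cdiff_contN g z : cdiff g z -> {for z, continuous (fun w => N (g w))}.
Proof.
move=> /cdiff_cont cg; apply: (@continuous_comp _ _ _ g (fun w => N w)) => //.
exact: continuous_N.
Qed.

Lemma elnN_le g z (x : R) : (elnN g z <= x%:E)%E <-> N (g z) <= expR x.
Proof.
rewrite /elnN; case: eqP => [->|/eqP g0]; first by rewrite N0 leNye; split => // _; exact: expR_ge0.
by rewrite lee_fin -ler_expR lnK ?posrE ?N_gt0.
Qed.

(** Stated with [expR (u z)] rather than [ln (N (g z))], so that zeros of [g] need no case
    distinction. *)
Lemma log_majorant G M g u : open G -> (forall z, G z -> N z <= M) -> (forall z, cdiff g z) ->
  mvp G u -> (forall zeta, frontier G zeta -> {for zeta, continuous u} /\ N (g zeta) <= expR (u zeta)) ->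
  forall z, G z -> N (g z) <= expR (u z).
Proof.
move=> oG bG dg mu H z Gz; apply/elnN_le.
apply: (max_principle oG bG (elnN_subharmonic oG (fun z _ => dg z)) mu) => // zeta fz e e0.
have [cu hg] := H _ fz.
have ce : {for zeta, continuous (fun w => expR (u w + e))}.
  apply: (@continuous_comp _ _ _ (fun w => u w + e) expR); last exact: continuous_expR.
  by apply: (@cvgD _ _ _ (nbhs zeta) (nbhs_filter zeta)) => //; exact: cvg_cst.
apply: filterS (near_lt (cdiff_contN (dg zeta)) ce _) => [w h _|]; first by apply/elnN_le/ltW.
by apply: le_lt_trans hg _; rewrite ltr_expR ltrDl.
Qed.

Lemma max_modulus G M g B : open G -> (forall z, G z -> N z <= M) -> (forall z, cdiff g z) ->
  0 < B -> (forall zeta, frontier G zeta -> N (g zeta) <= B) ->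
  forall z, G z -> N (g z) <= B.
Proof.
move=> oG bG dg B0 H z Gz; rewrite -[B]lnK ?posrE //.
apply: (log_majorant oG bG dg (u := fun _ => ln B)) => // [|zeta fz]; first exact: mvp_cst.
have cB : {for zeta, continuous (fun _ : C => ln B)} by exact: cst_continuous.
by split => //; rewrite lnK ?posrE //; exact: H.
Qed.

Lemma open_ring p s1 s2 : open [set z | s1 < N (z - p) < s2].
Proof.
apply/open_discP => w /= /andP[h1 h2].
exists (Num.min (N (w - p) - s1) (s2 - N (w - p))); first by rewrite lt_min !subr_gt0 h1.
move=> y; rewrite /disc /= lt_min => /andP[h3 h4].
have := N_tri y w p; have := N_tri w y p; rewrite (NBC w y) => *; apply/andP; split; lra.
Qed.

Lemma frontier_ring p s1 s2 z : frontier [set z | s1 < N (z - p) < s2] z ->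
  N (z - p) = s1 \/ N (z - p) = s2.
Proof.
move=> fz.
have oA := @open_ring p s1 s2.
have [cz nz] : closure [set z | s1 < N (z - p) < s2] z /\ ~ (s1 < N (z - p) < s2).
  by split; [case: fz|exact: (frontier_notin oA fz)].
have cont w : {for w, continuous (fun w => N (w - p))}.
  by apply: cdiff_contN; apply: cdiffB; [exact: cdiff_id|exact: cdiff_cst].
have h1 : s1 <= N (z - p).
  rewrite leNgt; apply/negP => h.
  have [w [/= /andP[h2 _] h3]] := cz _ (near_lt (cont z) (@cvg_cst _ _ _ _ (nbhs_filter z)) h); lra.
have h2 : N (z - p) <= s2.
  rewrite leNgt; apply/negP => h.
  have [w [/= /andP[_ h2] h3]] := cz _ (near_lt (@cvg_cst _ _ _ _ (nbhs_filter z)) (cont z) h); lra.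
have [h3|h3] := eqVneq (N (z - p)) s1; [by left|right].
apply/eqP; rewrite eq_le h2 leNgt; apply/negP => h4; apply: nz.
by rewrite h4 lt_neqAle eq_sym h3 h1.
Qed.

Lemma lnNB_mvp p s1 s2 A al : 0 <= s1 ->
  mvp [set z | s1 < N (z - p) < s2] (fun z => A + al * ln (N (z - p))).
Proof.
move=> s10; have oA := @open_ring p s1 s2.
apply: mvpD => //; first exact: mvp_cst.
apply: mvpZ => //; apply: lnN_mvp => // z /= /andP[h _].
  by apply: cdiffB; [exact: cdiff_id|exact: cdiff_cst].
by rewrite -N_gt0 (le_lt_trans s10).
Qed.

Lemma cont_lnN g z : cdiff g z -> g z != 0 -> {for z, continuous (fun w => ln (N (g w)))}.
Proof.
move=> dg g0; apply: (@continuous_comp _ _ _ (fun w => N (g w)) (@ln R)); first exact: cdiff_contN.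
by apply: continuous_ln; rewrite N_gt0.
Qed.

(** Hadamard's theorem: [A + al * ln |z - p|] is the harmonic function that interpolates between the
    two circles. *)
Lemma three_circles g p s1 s2 A al : 0 < s1 -> (forall z, cdiff g z) ->
  (forall z, N (z - p) = s1 \/ N (z - p) = s2 -> N (g z) <= expR (A + al * ln (N (z - p)))) ->
  forall z, s1 <= N (z - p) <= s2 -> N (g z) <= expR (A + al * ln (N (z - p))).
Proof.
move=> s10 dg H z /andP[]; rewrite le_eqVlt => /orP[/eqP h _|h1]; first by apply: H; left.
rewrite le_eqVlt => /orP[/eqP h|h2]; first by apply: H; right.
have hz : s1 < N (z - p) < s2 by exact/andP.
apply: (log_majorant (G := [set z | s1 < N (z - p) < s2]) (M := N p + s2)
  (u := fun z => A + al * ln (N (z - p)))) => //.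
- exact: open_ring.
- by move=> w /= /andP[_ h]; have := ler_N (w - p) p; rewrite subrK; lra.
- exact: lnNB_mvp (ltW s10).
move=> zeta fz; have hh := frontier_ring fz; split; last exact: H.
have z0 : zeta - p != 0.
  rewrite -N_gt0; case: hh => ->//; lra.
apply: (@cvgD _ _ _ (nbhs zeta) (nbhs_filter zeta)); first exact: cvg_cst.
apply: (@cvgM _ _ (nbhs zeta) (nbhs_filter zeta)); first exact: cvg_cst.
by apply: (cont_lnN (g := fun w => w - p)) => //; apply: cdiffB; [exact: cdiff_id|exact: cdiff_cst].
Qed.

(** As [g] vanishes on the inner circle, the three circles theorem allows any slope [k]; for large
    [k] the majorant at [z], inside the outer circle, is as small as desired. *)
Lemma entire_identity g p r : 0 < r -> (forall z, cdiff g z) ->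
  (forall z, disc p r z -> g z = 0) -> forall z, g z = 0.
Proof.
move=> r0 dg H z; have [zr|zr] := ltP (N (z - p)) (r / 2).
  by apply: H; rewrite /disc /=; lra.
pose s2 := N (z - p) + 1; pose s1 := r / 4.
have s10 : 0 < s1 by rewrite divr_gt0.
have [M HM] := @cdisc_bound R (fun z => N (g z)) p s2 (fun z _ => cdiff_contN (dg z)).
pose L := ln (N (z - p) + 1) - ln (N (z - p)).
have Np : 0 < N (z - p) by lra.
have L0 : 0 < L by rewrite /L subr_gt0 ltr_ln ?posrE; lra.
pose M' := `|M| + 1; have M'0 : 0 < M' by rewrite /M'; have := normr_ge0 M; lra.
have key k : 0 < k -> N (g z) <= expR (ln M' - k * L).
  move=> k0; have := three_circles (p := p) (s1 := s1) (s2 := s2) (A := ln M' - k * ln s2) (al := k) s10 dg.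
  move/(_ _ z); have -> : ln M' - k * L = ln M' - k * ln s2 + k * ln (N (z - p)).
    by rewrite /L /s2; lra.
  apply; last by rewrite /s1 /s2; apply/andP; split; lra.
  move=> w [h|h].
    by rewrite H ?N0 ?expR_ge0 // /disc /= h /s1; lra.
  rewrite h subrK lnK ?posrE //; have := HM w; rewrite ger0_norm ?N_ge0 // /cdisc /= h lexx => /(_ isT).
  by have := ler_norm M; rewrite /M'; lra.
apply: eqC_eps => e e0; rewrite subr0.
pose k := (`|ln M'| + `|ln e| + 1) / L.
have k0 : 0 < k.
  by rewrite divr_gt0 //; have := normr_ge0 (ln M'); have := normr_ge0 (ln e); lra.
apply: le_trans (key k k0) _; rewrite -[leRHS]lnK ?posrE // ler_expR /k divfK ?gt_eqF //.
have := ler_norm (ln M'); have := ler_norm (- ln e); rewrite normrN; lra.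
Qed.

(* Harnack's inequality for [ln (2 B / N (g - w))]. *)
Lemma omit_value g c rho B w (K : R) y : 0 < rho -> 0 < B -> (forall z, cdisc c rho z -> cdiff g z) ->
  (forall z, cdisc c rho z -> N (g z) <= B) -> N w <= B -> (forall z, cdisc c rho z -> g z <> w) ->
  N (g c - w) <= 2 * B * expR (- (3 * K)) -> N (y - c) <= rho / 2 ->
  N (g y - w) <= 2 * B * expR (- K).
Proof.
move=> r0 B0 dg bg bw gw hc hy.
pose v z := ln (2 * B) - ln (N (g z - w)).
have B2 : 0 < 2 * B by lra.
have dgw z : cdisc c rho z -> cdiff (fun z => g z - w) z.
  by move=> h; apply: cdiffB; [exact: dg|exact: cdiff_cst].
have gw0 z : cdisc c rho z -> g z - w != 0 by move=> /gw /eqP; rewrite subr_eq0.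
have dsub : disc c rho `<=` cdisc c rho by move=> z /ltW.
have cv z : cdisc c rho z -> {for z, continuous v}.
  move=> h; apply: (@cvgB _ _ _ (nbhs z) (nbhs_filter z)); first exact: cvg_cst.
  by apply: (cont_lnN (g := fun z => g z - w)); [exact: dgw|exact: gw0].
have mv : mvp (disc c rho) v.
  apply: mvpB; [exact: disc_open|exact: mvp_cst|].
  by apply: lnN_mvp => [|z /dsub|z /dsub]; [exact: disc_open|exact: dgw|exact: gw0].
have v0 z : cdisc c rho z -> 0 <= v z.
  move=> h; rewrite /v subr_ge0 ler_ln ?posrE ?N_gt0 ?gw0 //.
  by apply: le_trans (ler_NB _ _) _; have := bg z h; lra.
have cc : cdisc c rho c by rewrite /cdisc /= subrr N0 ltW.
have cy : cdisc c rho y by rewrite /cdisc /=; lra.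
have := harnack_half r0 cv mv v0 hy => /andP[h _].
have h3 : 3 * K <= v c.
  rewrite /v lerBrDr -lerBrDl.
  move: hc; rewrite -ler_ln ?posrE ?N_gt0 ?gw0 ?mulr_gt0 ?expR_gt0 //.
  by rewrite lnM ?posrE ?expR_gt0 // expRK; lra.
have vy : K <= v y by lra.
rewrite -ler_ln ?posrE ?N_gt0 ?gw0 ?mulr_gt0 ?expR_gt0 //.
by move: vy; rewrite /v [ln (2 * B * _)]lnM ?posrE ?expR_gt0 // expRK; lra.
Qed.

(** The value [(1 + d) g c] lies off the unit circle, hence is omitted, and is at distance [d] from
    [g c]. By [omit_value], [g y] stays near it; then [d] tends to 0. *)
Lemma unimodular_constant g c rho y : 0 < rho -> (forall z, cdisc c rho z -> cdiff g z) ->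
  (forall z, cdisc c rho z -> N (g z) = 1) -> N (y - c) <= rho / 2 -> g y = g c.
Proof.
move=> r0 dg g1 hy; apply: eqC_eps => e e0.
pose K := ln 4 - ln (e / 2).
pose d := Num.min 1 (Num.min (e / 2) (2 * 2 * expR (- (3 * K)))).
have e2 : 0 < e / 2 by rewrite divr_gt0.
have d0 : 0 < d by rewrite !lt_min ltr01 e2 !mulr_gt0 // expR_gt0.
have [d1 d2 d3] : [/\ d <= 1, d <= e / 2 & d <= 2 * 2 * expR (- (3 * K))].
  by split; rewrite !ge_min lexx ?orbT.
have cc : cdisc c rho c by rewrite /cdisc /= subrr N0 ltW.
pose w := (1 + d)%:C * g c.
have wc : N (g c - w) = d.
  have -> : g c - w = - (d%:C * g c) by rewrite /w rmorphD /=; ring.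
  by rewrite NN NM NC g1 // mulr1 gtr0_norm.
have Nw : N w = 1 + d by rewrite /w NM NC g1 // mulr1 gtr0_norm //; lra.
have eK : 2 * 2 * expR (- K) = e / 2.
  rewrite /K opprB expRD expRN !lnK ?posrE //; lra.
have H : N (g y - w) <= 2 * 2 * expR (- K).
  apply: (@omit_value g c rho 2 w K y r0 _ dg) => //.
  - by move=> z /g1 ->; lra.
  - by rewrite Nw; lra.
  - by move=> z /g1 + gw; rewrite gw Nw; lra.
  by rewrite wc.
have := N_tri w (g y) (g c); rewrite (NBC w) wc; lra.
Qed.

Definition nonconstant g := ~ exists c, forall z, g z = c.

(** If values arbitrarily close to [g z] were omitted on [V], [omit_value] would make [g] constant
    on a smaller disc, hence everywhere by [entire_identity]. *)
Lemma open_map g z V : (forall z, cdiff g z) -> nonconstant g -> nbhs z V -> nbhs (g z) (g @` V).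
Proof.
move=> dg nc /nbhs_discP[r r0 rV].
pose rho := r / 2; have rho0 : 0 < rho by rewrite divr_gt0.
have cV : cdisc z rho `<=` V.
  by move=> w; rewrite /cdisc /= => h; apply: rV; rewrite /disc /=; rewrite /rho in h; lra.
have [M HM] := @cdisc_bound R (fun z => N (g z)) z rho (fun z _ => cdiff_contN (dg z)).
pose B := `|M| + 1; have B0 : 0 < B by rewrite /B; have := normr_ge0 M; lra.
have bg w : cdisc z rho w -> N (g w) <= B - 1.
  by move/HM; rewrite ger0_norm ?N_ge0 // /B; have := ler_norm M; lra.
apply: contrapT => nn; apply: nc; exists (g z) => y.
apply/eqP; rewrite -subr_eq0; apply/eqP.
apply: (@entire_identity (fun y => g y - g z) z (rho / 2)); first by rewrite divr_gt0.
  by move=> w; apply: cdiffB; [exact: dg|exact: cdiff_cst].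
move=> {}y hy; apply/eqP; rewrite subr_eq0; apply/eqP; apply: eqC_eps => e e0.
have e2 : 0 < e / 2 by rewrite divr_gt0.
pose K := ln (2 * B) - ln (e / 2); have eK : 2 * B * expR (- K) = e / 2.
  by rewrite /K opprB expRD expRN !lnK ?posrE //; [field|]; lra.
pose d := Num.min (Num.min 1 (e / 2)) (2 * B * expR (- (3 * K))).
have d0 : 0 < d by rewrite !lt_min ltr01 e2 !mulr_gt0 // expR_gt0.
have [w wd nw] : exists2 w, disc (g z) d w & ~ (g @` V) w.
  apply: contrapT => none; apply: nn; apply/nbhs_discP; exists d => // w wd.
  by apply: contrapT => h; apply: none; exists w.
move: wd; rewrite /disc /= !lt_min => /andP[/andP[w1 we] wB].
have Nw : N w <= B.
  have := bg z; rewrite /cdisc /= subrr N0 => /(_ (ltW rho0)).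
  by have := N_rev w (g z); lra.
have := @omit_value g z rho B w K y rho0 B0 (fun z _ => dg z).
rewrite eK => /(_ _ Nw) H; apply: le_trans (N_tri w _ _) _.
have : N (g y - w) <= e / 2.
  apply: H.
  - by move=> x /bg; lra.
  - by move=> x /cV Vx gx; apply: nw; exists x.
  - by rewrite NBC ltW.
  by move: hy; rewrite /disc /=; lra.
lra.
Qed.

Lemma cdiff_iter f n : (forall z, cdiff f z) -> forall z, cdiff (iter n f) z.
Proof.
move=> df; elim: n => [|n IH] z; first exact: cdiff_id.
by apply: (cdiff_comp (f := f) (g := iter n f)).
Qed.

End EntireFunctions.

(** * Normality and the invariance of the Fatou set *)

Section FatouSet.
Context {R : realType}.
Local Notation C := R[i].
Implicit Types (c p z w : C) (r s t M B : R) (U V G : set C) (f g : C -> C).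

Lemma uniform_cvgP V (F : nat -> C -> C) g : {uniform V, F @ \oo --> g} <->
  forall e : R, 0 < e -> \forall k \near \oo, forall w, V w -> N (F k w - g w) < e.
Proof.
split=> [H e e0|H A].
  have : nbhs (g : {uniform` V -> C}) [set h | forall w, V w -> N (h w - g w) < e].
    apply/uniform_nbhs; exists [set xy | ball xy.1 (e%:C : C) xy.2]; split.
      by rewrite -entourage_ballE; exists e%:C => //=; rewrite ltcE /= eqxx.
    by move=> h hh w Vw; have := hh w Vw; rewrite /ball /= distrC normE ltcR.
  exact: H.
move/uniform_nbhs => [E [entE EA]].
have [d d0 dE] : exists2 d : R, 0 < d & forall x y : C, N (x - y) < d -> E (x, y).
  move: entE; rewrite -entourage_ballE => -[e /= e0 eE]; exists (Re e).
    by move: e0; rewrite ltcE => /andP[].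
  move=> x y xy; apply: eE; rewrite /ball /= normE ltcE /=.
  by rewrite xy andbT; move: e0; rewrite ltcE => /andP[/eqP ->].
by apply: filterS (H d d0) => k hk; apply: EA => w /hk h; apply: dE; rewrite NBC.
Qed.

Lemma component_open U z : open U -> open (connected_component U z).
Proof.
move=> oU; apply/open_discP => w zw; have Uw := connected_component_sub zw.
have [r r0 D] := open_disc oU Uw; exists r => //.
rewrite (same_connected_component zw).
by apply: connected_component_max => //; [exact: disc_center|exact: connected_disc].
Qed.

Lemma fatou_open f : open (fatou_set f).
Proof.
rewrite openE => z [V [oV Vz] nV]; apply: filterS (open_nbhs_nbhs (conj oV Vz)) => w Vw.
by exists V.
Qed.

Lemma fatou_forward f z : (forall z, cdiff f z) -> nonconstant f ->
  fatou_set f z -> fatou_set f (f z).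
Proof.
move=> df nc [V [oV Vz] nV].
have im y (A : set C) : nbhs y A -> nbhs (f y) (f @` A) by move=> h; exact: open_map.
exists (interior (f @` V)).
  split; first exact: open_interior.
  by apply: im; exact: open_nbhs_nbhs.
move=> s; have [t ht lim] := nV (fun k => (s k).+1); exists t => //.
have sub w : (interior (f @` V)) w -> exists2 y, V y & f y = w by move/interior_subset.
case: lim => [[g lg]|lg]; [left|right].
  pose g' w := g (xget 0 [set y | V y /\ f y = w]).
  have gE y : V y -> g' (f y) = g y.
    move=> Vy; rewrite /g'; case: xgetP => [y' _ [Vy' fy']|/(_ y)/not_andP[]//].
    apply: eqC_eps => e e0; have e2 : 0 < e / 2 by rewrite divr_gt0.
    have [A1 nA1 /uniform_cvgP/(_ _ e2) h1] := lg y' Vy'.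
    have [A2 nA2 /uniform_cvgP/(_ _ e2) h2] := lg y Vy.
    have [k [/(_ _ (nbhs_singleton nA1)) h3 /(_ _ (nbhs_singleton nA2)) h4]] := filter_ex (filterI h1 h2).
    move: h3 h4; rewrite !iterSr fy' => h3 h4.
    have := N_tri (iter (s (t k)) f (f y)) (g y') (g y); rewrite (NBC (g y') (iter _ _ _)); lra.
  exists g' => w /sub[y Vy <-]; have [A nA /uniform_cvgP hA] := lg y Vy.
  exists (f @` (A `&` V)); first by apply: im; apply: filterI => //; exact: open_nbhs_nbhs.
  apply/uniform_cvgP => e /hA; apply: filterS => k hk _ [x [Ax Vx] <-].
  by rewrite gE // -iterSr; exact: hk.
move=> w /sub[y Vy <-]; have [A nA hA] := lg y Vy; exists (f @` A); first exact: im.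
by move=> M; apply: filterS (hA M) => k hk _ [x Ax <-]; rewrite -iterSr; exact: hk.
Qed.

Lemma increasing_choice (P : nat -> nat -> Prop) : (forall n m, exists2 k, (m < k)%N & P n k) ->
  exists2 t : nat -> nat, {homo t : m n / (m < n)%N} & forall n, P n (t n).
Proof.
move=> H; have /choice[c Hc] : forall nm : nat * nat, exists k, (nm.2 < k)%N /\ P nm.1 k.
  by move=> [n m]; have [k] := H n m; exists k.
pose t := fix t n := match n with 0%N => c (0%N, 0%N) | n.+1 => c (n.+1, t n) end.
exists t; last by case=> [|n]; [case: (Hc (0%N, 0%N))|case: (Hc (n.+1, t n))].
by apply: homo_ltn => [? ? ?|i]; [exact: ltn_trans|case: (Hc (i.+1, t i))].
Qed.

Lemma fatou_backward f z : (forall z, {for z, continuous f}) -> fatou_set f (f z) -> fatou_set f z.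
Proof.
move=> cf [V [oV Vz] nV].
have pre y (A : set C) : nbhs (f y) A -> nbhs y (f @^-1` A) by exact: cf.
exists (f @^-1` V).
  by split => //; rewrite openE => y Vy; apply: pre; exact: open_nbhs_nbhs.
(* The exponent 0 has no predecessor. If it occurs infinitely often, the identity is a limit;
   otherwise a tail of [s] can be shifted down by one. *)
move=> s; have [inf|fin] := pselect (forall m, exists2 k, (m < k)%N & s k = 0%N).
  have [t ht st] := @increasing_choice (fun _ k => s k = 0%N) (fun _ => inf).
  exists t => //; left; exists id => y _; exists setT; first exact: filterT.
  apply/uniform_cvgP => e e0; near=> k => w _.
  by rewrite st /= subrr N0.
have [m Hm] : exists m, forall k, (m < k)%N -> (0 < s k)%N.
  apply: contrapT => none; apply: fin => m; apply: contrapT => h; apply: none; exists m => k mk.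
  by rewrite lt0n; apply/eqP => sk; apply: h; exists k.
have [t ht lim] := nV (fun k => (s (k + m.+1)%N).-1).
exists (fun k => (t k + m.+1)%N) => [i j ij|]; first by rewrite ltn_add2r ht.
have E k y : iter (s (t k + m.+1)%N) f y = iter (s (t k + m.+1)%N).-1 f (f y).
  by rewrite -iterSr prednK // Hm // addnS ltnS leq_addl.
case: lim => [[g lg]|lg]; [left; exists (g \o f)|right] => y Vy.
  have [A nA /uniform_cvgP hA] := lg (f y) Vy; exists (f @^-1` A); first exact: pre.
  by apply/uniform_cvgP => e /hA; apply: filterS => k hk w Aw; rewrite E; exact: hk.
have [A nA hA] := lg (f y) Vy; exists (f @^-1` A); first exact: pre.
by move=> M; apply: filterS (hA M) => k hk w Aw; rewrite E; exact: hk.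
Unshelve. all: by end_near. Qed.

Lemma ultra_bounded_limit (I : Type) (F : set_system I) (u : I -> R) M : UltraFilter F ->
  (\forall i \near F, `|u i| <= M) -> exists x : R, u @ F --> x.
Proof.
move=> UF bu; have FF : ProperFilter F by exact: ultra_proper.
have cI : compact `[- M, M]%classic by exact: segment_compact.
have [G [UG sG]] := ultraFilterLemma (fmap_proper_filter u FF).
have GI : G `[- M, M]%classic.
  by apply: sG; apply: filterS bu => i; rewrite /= in_itv /= ler_norml.
move: cI; rewrite compact_ultra => /(_ G UG GI) [x [_ Gx]]; exists x.
move=> A nA; have := Gx A nA.
have [//|nF] := in_ultra_setVsetC (u @^-1` A) UF.
move=> GA; have : G (~` A) by apply: sG.
by move=> /(filterI GA); rewrite setICr => /filter_not_empty.
Qed.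

(* Montel's theorem for a bounded family: harmonicity of the real and imaginary
   parts makes the pointwise limit along an ultrafilter locally uniform. *)
Lemma fatou_of_bounded f z r M : (forall z, cdiff f z) -> 0 < r ->
  (forall n w, disc z (3 * r) w -> N (iter n f w) <= M) -> fatou_set f z.
Proof.
move=> df r0 bf; exists (disc z r); first by split; [exact: disc_open|exact: disc_center].
move=> s; have [F [UF sF]] := ultraFilterLemma eventually_filter.
have FF : ProperFilter F by exact: ultra_proper.
pose k i := iter (s i) f.
have o3 : open (disc z (3 * r)) by exact: disc_open.
have bR i w : disc z (3 * r) w -> `|Re (k i w)| <= M.
  by move=> /(bf (s i)); apply: le_trans; exact: Re_le_N.
have bI i w : disc z (3 * r) w -> `|Im (k i w)| <= M.
  by move=> /(bf (s i)); apply: le_trans; exact: Im_le_N.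
have mR i : mvp (disc z (3 * r)) (fun w => Re (k i w)).
  by apply: Re_mvp => // w _; exact: cdiff_iter.
have mI i : mvp (disc z (3 * r)) (fun w => Im (k i w)).
  by apply: Im_mvp => // w _; exact: cdiff_iter.
have /choice[x Hx] : forall w, exists x : R, disc z (3 * r) w -> (fun i => Re (k i w)) @ F --> x.
  move=> w; have [h|h] := pselect (disc z (3 * r) w); last by exists 0.
  have [|x hx] := @ultra_bounded_limit nat F (fun i => Re (k i w)) M UF.
    by apply: filterE => i; exact: bR.
  by exists x.
have /choice[y Hy] : forall w, exists y : R, disc z (3 * r) w -> (fun i => Im (k i w)) @ F --> y.
  move=> w; have [h|h] := pselect (disc z (3 * r) w); last by exists 0.
  have [|y hy] := @ultra_bounded_limit nat F (fun i => Im (k i w)) M UF.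
    by apply: filterE => i; exact: bI.
  by exists y.
have [uR _] := @mvp_limit R nat F FF (fun i w => Re (k i w)) x z r M r0
  (@filterE _ F _ _ (fun i => conj (mR i) (bR i))) Hx.
have [uI _] := @mvp_limit R nat F FF (fun i w => Im (k i w)) y z r M r0
  (@filterE _ F _ _ (fun i => conj (mI i) (bI i))) Hy.
have [|t ht Ht] := @increasing_choice
  (fun n i => forall w, cdisc z r w -> N (k i w - (x w +i* y w)) <= 2 * n.+1%:R^-1).
  move=> n m; have n0 : 0 < (n.+1%:R : R)^-1 by rewrite invr_gt0.
  have big : F [set i | (m < i)%N] by apply: sF; exact: nbhs_infty_gt.
  have [i [[hR hI] mi]] := filter_ex (filterI (filterI (uR _ n0) (uI _ n0)) big).
  exists i => // w zw; apply: le_trans (N_le_ReIm _) _.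
  rewrite ReD ReN ImD ImN [Re (_ +i* _)]/= [Im (_ +i* _)]/=.
  by rewrite mulr_natl mulr2n; apply: lerD; [exact: hR|exact: hI].
exists t => //; left; exists (fun w => x w +i* y w) => w zw; exists (disc z r).
  by apply: open_nbhs_nbhs; split => //; exact: disc_open.
apply/uniform_cvgP => e e0; near=> n => w' zw'.
apply: le_lt_trans (Ht n w' (ltW zw')) _.
rewrite -ltr_pdivlMl // -[ltRHS]invrK ltf_pV2 ?posrE ?invr_gt0 ?mulr_gt0 ?invr_gt0 //.
apply: (@lt_le_trans _ _ n%:R); last by rewrite ler_nat.
near: n; exact: nbhs_infty_gtr.
Unshelve. all: by end_near. Qed.

(* On a disc, [g = chi * cexp (la * Phi)] with [Re Phi = ln (N g) / la], so that
   [Phi] omits a logarithm of each value that [g] omits. *)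
Lemma omit_log_value g p rho la M B zeta (K : R) y : 0 < rho -> pi <= la -> (forall z, cdiff g z) ->
  (forall z, cdisc p rho z -> g z != 0) -> (forall z, cdisc p rho z -> `|ln (N (g z)) / la| <= M) ->
  zeta != 0 -> (forall z, cdisc p rho z -> g z <> zeta) ->
  let c := ln (N zeta) / la in 10 * M <= B -> `|c| + 1 <= B ->
  `|ln (N (g p)) / la - c| + pi / la <= 2 * B * expR (- (3 * K)) ->
  N (y - p) <= rho / 8 -> `|ln (N (g y)) / la - c| <= 2 * B * expR (- K).
Proof.
move=> r0 pl dg g0 gM z0 gz c MB cB hp hy.
have la0 : 0 < la by apply: lt_le_trans pl; exact: pi_gt0.
pose v z := ln (N (g z)) / la.
have M0 : 0 <= M.
  have pp : cdisc p rho p by rewrite /cdisc /= subrr N0 ltW.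
  by apply: le_trans (gM p pp).
have cv z : cdisc p rho z -> {for z, continuous v}.
  move=> hz; apply: (@cvgM _ _ (nbhs z) (nbhs_filter z)); last exact: cvg_cst.
  by apply: cont_lnN => //; exact: g0.
have vE z : la^-1 * ln (N (g z)) = v z by rewrite mulrC.
have od : open (disc p rho) by exact: disc_open.
have mv : mvp (disc p rho) v.
  apply: near_mvp (fun z _ => vE z) _ => //; apply: mvpZ => //; apply: lnN_mvp => // z /ltW; exact: g0.
have bv : bmeas (fun t => v (circle p rho t)) M.
  have cc t : cdisc p rho (circle p rho t) by apply: circle_cdisc; exact: ltW.
  apply: cont_bmeas => [|t]; last exact: gM.
  by apply: cont_circle => t; exact: cv.
pose Phi := schwarz p rho v.
have RePhi z : disc p rho z -> Re (Phi z) = v z.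
  by move=> hz; rewrite (poisson_repr r0 cv mv hz).
have dPhi z : disc p rho z -> cdiff Phi z by move=> hz; exists (schwarz1 p rho v z); exact: (cderiv_schwarz r0 bv).
pose q z := g z * cexp (- (la%:C * Phi z)).
have r2 : 0 < rho / 2 by rewrite divr_gt0.
have r4 : 0 < rho / 4 by rewrite divr_gt0.
have in2 z : cdisc p (rho / 2) z -> disc p rho z by rewrite /cdisc /disc /=; lra.
have dq z : cdisc p (rho / 2) z -> cdiff q z.
  move=> /in2 hz; apply: cdiffM => //.
  apply: (cdiff_comp (g := fun z => - (la%:C * Phi z)) (f := cexp)); last exact: cdiff_cexp.
  by apply: cdiffN; apply: cdiffM; [exact: cdiff_cst|exact: dPhi].
have Nq z : cdisc p (rho / 2) z -> N (q z) = 1.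
  move=> /in2 hz; rewrite NM N_cexp ReN ReM [Re _%:C]/= [Im _%:C]/= mul0r subr0 RePhi //.
  have gz0 := g0 z (ltW hz); rewrite /v mulrCA divff ?gt_eqF // mulr1 expRN.
  by rewrite lnK ?posrE ?N_gt0 // divff // N_eq0.
have qE z : cdisc p (rho / 4) z -> q z = q p.
  move=> hz; apply: (unimodular_constant r2 dq Nq).
  by apply: le_trans hz _; lra.
have gE z : cdisc p (rho / 4) z -> g z = q p * cexp (la%:C * Phi z).
  by move=> /qE <-; rewrite /q -mulrA -cexpD addNr cexp0 mulr1.
have Nqp : N (q p) = 1 by apply: Nq; rewrite /cdisc /= subrr N0 ltW.
have qp0 : q p != 0 by rewrite -N_gt0 Nqp.
have [|t tpi tE] := @polar R (zeta / q p); first by rewrite mulf_neq0 // invr_eq0.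
rewrite NM NV Nqp invr1 mulr1 in tE.
(* A logarithm of [zeta / q p] divided by [la]: a value that [Phi] omits, within [pi / la] of
   [c]. *)
pose om : C := c +i* (t / la).
have omE : la%:C * om = ln (N zeta) +i* t.
  apply: complexP; rewrite ?ReM ?ImM /= ?mul0r ?mulr0 ?subr0 ?addr0 /c.
    by rewrite mulrCA divff ?gt_eqF // mulr1.
  by rewrite mulrCA divff ?gt_eqF // mulr1.
have tl : `|t / la| <= pi / la by rewrite normrM normfV (gtr0_norm la0) ler_pM2r // invr_gt0.
have pl1 : pi / la <= 1 by rewrite ler_pdivrMr // mul1r.
have Nom : N om <= `|c| + 1.
  apply: le_trans (N_le_ReIm _) _; rewrite [Re om]/= [Im om]/= lerD2l; exact: le_trans tl pl1.
have B0 : 0 < B by have := normr_ge0 c; lra.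
have pd : disc p rho p by exact: disc_center.
have := @omit_value R Phi p (rho / 4) B om K y r4 B0.
have in4 z : cdisc p (rho / 4) z -> disc p rho z by rewrite /cdisc /disc /=; lra.
move=> /(_ (fun z hz => dPhi z (in4 z hz))) H.
have yd : disc p rho y by rewrite /disc /=; move: hy r0; clear; lra.
have : N (Phi y - om) <= 2 * B * expR (- K).
  apply: H.
  - move=> z hz; apply: le_trans (schwarz_bound r0 bv _) _; first by apply: le_trans hz _; lra.
    by [].
  - exact: le_trans Nom cB.
  - move=> z hz PE; apply: (gz z (ltW (in4 z hz))).
    by rewrite gE // PE omE -tE mulrCA divff ?mulr1.
  - apply: le_trans hp; apply: le_trans (N_le_ReIm _) _.
    rewrite ReD ReN ImD ImN (RePhi _ pd) [Re om]/= [Im om]/= schwarz_center // add0r normrN.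
    by rewrite lerD2l.
  by lra.
move=> h; have := le_trans (Re_le_N _) h.
by rewrite ReD ReN (RePhi _ yd) [Re om]/=.
Qed.

End FatouSet.

(** * Plane topology *)

Section PlaneTopology.
Context {R : realType}.
Local Notation C := R[i].
Implicit Types (c p z w y zeta : C) (r s M : R) (A B E G U W X D : set C).

Lemma compact_separated A B : compact A -> closed B -> (forall z, A z -> ~ B z) ->
  exists2 d, 0 < d & forall x y, A x -> B y -> d <= N (x - y).
Proof.
move=> cA cB AB; have /compact_near_coveringP nA := cA.
have := nA R (0 : R)^'+ (fun d x => forall y, B y -> d <= N (x - y)).
move/(_ _) => H; have {}H := H _.
have [d [d0 Hd]] : exists d, 0 < d /\ forall x, A x -> forall y, B y -> d <= N (x - y).
  apply: (@filter_ex _ (0 : R)^'+ _ (fun d => 0 < d /\ forall x, A x -> forall y, B y -> d <= N (x - y))).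
  apply: filterI; first exact: nbhs_right_gt.
  apply: H => x Ax.
  have [r r0 D] : exists2 r, 0 < r & disc x r `<=` ~` B.
    by apply: open_disc; [exact: closed_openC|exact: AB].
  have r2 : 0 < r / 2 by rewrite divr_gt0.
  exists (disc x (r / 2), [set d | d <= r / 2]) => /=.
    by split; [exact: near_disc|apply: nbhs_right_le].
  move=> [w d] /= [wx dr] y By; rewrite leNgt; apply/negP => wy.
  apply: (D y) => //; rewrite /disc /=; move: wx; rewrite /disc /= => wx.
  by have := N_tri w y x; rewrite (NBC y w); lra.
by exists d => // x y Ax By; exact: Hd.
Qed.

Definition thicken D r : set C := [set x | exists2 p, D p & N (x - p) < r].

Lemma thicken_open D r : open (thicken D r).
Proof.
apply/open_discP => z [p Dp zp]; exists (r - N (z - p)); first by rewrite subr_gt0.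
move=> w; rewrite /disc /= => wz; exists p => //.
by apply: le_lt_trans (N_tri z w p) _; rewrite -ltrBrDr.
Qed.

Lemma sub_thicken D r : 0 < r -> D `<=` thicken D r.
Proof. by move=> r0 z Dz; exists z => //; rewrite subrr N0. Qed.

Lemma closure_thicken D r z : 0 < r -> closure (thicken D r) z -> exists2 p, D p & N (z - p) < 2 * r.
Proof.
move=> r0 cz; have [w [[p Dp wp] wz]] := cz _ (near_disc z r0).
exists p => //; move: wz; rewrite /disc /= => wz.
by have := N_tri w z p; rewrite (NBC z w); lra.
Qed.

Definition clopen_in X D := [/\ D `<=` X, closed D & closed (X `\` D)].

Lemma clopen_inI X D1 D2 : closed X -> clopen_in X D1 -> clopen_in X D2 -> clopen_in X (D1 `&` D2).
Proof.
move=> cX [s1 c1 d1] [s2 c2 d2]; split; first by move=> z [/s1].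
  exact: closedI.
by rewrite setDIr; exact: closedU.
Qed.

Definition quasi_component X zeta := [set y | X y /\ forall D, clopen_in X D -> D zeta -> D y].

(* By compactness, some clopen set that contains [zeta] lies in the union of two
   disjoint neighbourhoods of [A1] and [A2]. *)
Lemma quasi_component_split X zeta A1 A2 : compact X -> X zeta -> closed A1 -> closed A2 ->
  (forall z, A1 z -> ~ A2 z) -> A1 `<=` X -> quasi_component X zeta `<=` A1 `|` A2 -> A1 zeta ->
  forall y, quasi_component X zeta y -> ~ A2 y.
Proof.
move=> kX Xz c1 c2 A12 A1X QA A1z.
have cX : closed X by apply: compact_closed => //; exact: norm_hausdorff.
have k1 : compact A1 by exact: (subclosed_compact c1 kX).
have [d d0 Hd] := compact_separated k1 c2 A12.
have d2 : 0 < d / 2 by rewrite divr_gt0.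
pose O1 := thicken A1 (d / 2); pose O2 := thicken A2 (d / 2).
have o1 : open O1 by exact: thicken_open.
have o2 : open O2 by exact: thicken_open.
have O12 z : O1 z -> O2 z -> False.
  move=> [p A1p zp] [q A2q zq]; have := Hd _ _ A1p A2q.
  by have := N_tri z p q; rewrite (NBC p z); lra.
pose Y := X `&` ~` (O1 `|` O2).
have kY : compact Y.
  apply: (subclosed_compact _ kX) => [|z []//].
  by apply: closedI => //; apply: open_closedC; exact: openU.
pose F := filter_from [set D | clopen_in X D /\ D zeta] (fun D => [set D' : set C | D' `<=` D]).
have cXX : clopen_in X X by split => //; rewrite setDv; exact: closed0.
have FF : Filter F.
  apply: filter_from_filter; first by exists X.
  move=> D1 D2 [h1 z1] [h2 z2]; exists (D1 `&` D2); first by split => //; exact: clopen_inI.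
  by move=> D' sD; split=> z /sD[].
have /compact_near_coveringP nY := kY.
have [D [cD Dz] DY] : F [set D | Y `<=` (~` D)].
  apply: (nY _ F (fun D y => ~ D y)) => y [Xy nO].
  have [D [[cD Dz] nD]] : exists D, (clopen_in X D /\ D zeta) /\ ~ D y.
    apply: contrapT => none; apply: nO.
    have Qy : quasi_component X zeta y.
      split => // D cD Dz; apply: contrapT => nD; apply: none; exists D; split => //.
    by case: (QA y Qy) => h; [left|right]; exact: sub_thicken.
  exists (~` D, [set D' | D' `<=` D]) => /=.
    split; last by exists D.
    by apply: open_nbhs_nbhs; split => //; apply: closed_openC; case: cD.
  by move=> [w D'] /= [nDw sD] /sD.
have {}DY z : D z -> O1 z \/ O2 z.
  move=> Dz'; apply: contrapT => nO; apply: (DY D (fun _ h => h) z) => //.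
  by split => //; case: cD => + _ _; apply.
have cD1 : clopen_in X (D `&` O1).
  case: cD => DX clD clXD; split; first by move=> z [/DX].
    have -> : D `&` O1 = D `&` ~` O2.
      apply/seteqP; split=> z [Dz' h]; split => //; first by move=> h2; exact: (O12 z).
      by case: (DY z Dz') => // h2; case: h.
    by apply: closedI => //; exact: open_closedC.
  rewrite setDIr; apply: closedU => //.
  by rewrite setDE; apply: closedI => //; exact: open_closedC.
move=> y [Xy Qy] A2y; have [|_ O1y] := Qy _ cD1; first by split => //; exact: sub_thicken.
by apply: (O12 y O1y); exact: sub_thicken.
Qed.

(** A relatively clopen part of the quasi-component and its complement there are both closed; by
    [quasi_component_split] the one without [zeta] is empty. *)
Lemma quasi_component_connected X zeta : compact X -> X zeta -> connected (quasi_component X zeta).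
Proof.
move=> kX Xz.
move=> B [y0 By0].
move=> [V oV BO].
move=> [Z cZ BZ].
pose Q := quasi_component X zeta.
rewrite -/Q in BO BZ.
rewrite -/Q.
have cX : closed X by apply: compact_closed => //; exact: norm_hausdorff.
have cQ : closed Q.
  have -> : Q = \bigcap_(D in [set D | clopen_in X D /\ D zeta]) D.
    apply/seteqP; split=> [y [Xy Qy] D [cD Dz]|y H]; first exact: Qy.
    split; last by move=> D cD Dz; apply: H.
    by apply: (H X); split => //; split => //; rewrite setDv; exact: closed0.
  by apply: closed_bigI => D [[]].
have cB : closed B by rewrite BZ; exact: closedI.
have cB' : closed (Q `\` B).
  rewrite BO setDIr setDv set0U setDE; apply: closedI => //; exact: open_closedC.
have Qz : Q zeta by split.
have BQ : B `<=` Q by rewrite BO => z [].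
have QX : Q `<=` X by move=> z [].
have [Bz|nBz] := pselect (B zeta).
  apply/seteqP; split => // y Qy.
  have : ~ (Q `\` B) y.
    apply: (quasi_component_split kX Xz cB cB' _ _ _ Bz Qy); first by move=> z Bz' [].
      by move=> z /BQ/QX.
    by move=> z Qz'; have [|] := pselect (B z); [left|right].
  by move=> h; apply: contrapT => nB; apply: h.
exfalso; have : ~ B y0; last exact.
apply: (quasi_component_split kX Xz cB' cB _ _ _ _ (BQ _ By0)); first by move=> z [].
- by move=> z [/QX].
- by move=> z Qz'; have [|] := pselect (B z); [right|left].
by split.
Qed.

(** The set is the image under [cexp] of a convex strip. *)
Lemma band_connected (P : R -> Prop) : (exists x, P x) ->
  (forall x y t : R, P x -> P y -> 0 <= t <= 1 -> P (x + t * (y - x))) ->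
  connected [set z : C | z != 0 /\ P (ln (N z))].
Proof.
move=> [x0 Px0] cP.
have -> : [set z : C | z != 0 /\ P (ln (N z))] = cexp @` [set w : C | P (Re w)].
  apply/seteqP; split=> [z [z0 Pz]|_ [w Pw <-]].
    by have [t _ ->] := polar z0; exists (ln (N z) +i* t).
  by split; [exact: cexp_neq0|rewrite N_cexp expRK].
apply: connected_continuous_connected.
  apply: (@connected_star R _ (x0 +i* 0)) => // z t Pz t01 /=.
  have -> : Re ((x0 +i* 0) + t%:C * (z - (x0 +i* 0))) = x0 + t * (Re z - x0).
    by rewrite ReD ReM ReD ReN /= mul0r subr0.
  exact: cP.
by apply: continuous_subspaceT => w; apply: cdiff_cont; exact: cdiff_cexp.
Qed.

Lemma convex_gt (k x y t : R) : k < x -> k < y -> 0 <= t <= 1 -> k < x + t * (y - x).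
Proof.
move=> h1 h2 /andP[t0 t1].
have e1 : x + t * (y - x) = (1 - t) * x + t * y by ring.
have h3 : (1 - t) * k <= (1 - t) * x by rewrite ler_wpM2l ?subr_ge0 // ltW.
have h4 : t * k <= t * y by rewrite ler_wpM2l // ltW.
have [t2|t2] := leP t (1 / 2).
  have : (1 - t) * k < (1 - t) * x by rewrite ltr_pM2l //; lra.
  lra.
have : t * k < t * y by rewrite ltr_pM2l //; lra.
lra.
Qed.

Lemma connected_far M : 0 < M -> connected [set z : C | M < N z].
Proof.
move=> M0; have -> : [set z : C | M < N z] = [set z : C | z != 0 /\ ln M < ln (N z)].
  apply/seteqP; split=> z /=.
    by move=> h; have h0 := lt_trans M0 h; rewrite -N_gt0 h0 ltr_ln.
  by rewrite -N_gt0 => -[h0]; rewrite ltr_ln.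
apply: (band_connected (P := fun x => ln M < x)); first by exists (ln M + 1); rewrite ltrDl.
by move=> x y t; exact: convex_gt.
Qed.

Lemma connected_shell M1 M2 : 0 < M1 -> M1 < M2 -> connected [set z : C | M1 < N z <= M2].
Proof.
move=> M0 M12; have M20 := lt_trans M0 M12.
have -> : [set z : C | M1 < N z <= M2] = [set z : C | z != 0 /\ ln M1 < ln (N z) <= ln M2].
  apply/seteqP; split=> z /=.
    by move=> /andP[h h2]; have h0 := lt_trans M0 h; rewrite -N_gt0 h0 ltr_ln // ler_ln // h.
  by rewrite -N_gt0 => -[h0]; rewrite ltr_ln // ler_ln.
apply: (band_connected (P := fun x => ln M1 < x <= ln M2)).
  by exists (ln M2); rewrite ltr_ln // M12 /=.
move=> x y t /andP[h1 h2] /andP[h3 h4] t01; have /andP[t0 t1] := t01; apply/andP; split.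
  exact: convex_gt.
have -> : x + t * (y - x) = (1 - t) * x + t * y by ring.
have h5 : (1 - t) * x <= (1 - t) * ln M2 by rewrite ler_wpM2l // subr_ge0.
have h6 : t * y <= t * ln M2 by rewrite ler_wpM2l.
lra.
Qed.

Lemma bounded_setP A : bounded_set A <-> exists M, forall z, A z -> N z <= M.
Proof.
split=> [[M [Mr HM]]|[M HM]].
  have h : M < (Re M + 1)%:C.
    rewrite ltcE /=; move: Mr; rewrite realE !lecE /= => /orP[|] /andP[/eqP -> _]; by rewrite eqxx ltrDl ltr01.
  exists (Re M + 1) => z Az; have := HM _ h z Az.
  by rewrite /= normE lecR.
exists M%:C; split; first by rewrite realE !lecE /= eqxx /= le_total.
move=> x Mx z /HM h /=; rewrite normE; apply: le_trans (ltW Mx).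
by rewrite lecR.
Qed.

Lemma far_unbounded M : ~ bounded_set [set z : C | M < N z].
Proof.
move/bounded_setP => [K HK]; pose x := `|M| + `|K| + 1.
have [m0 k0] : 0 <= `|M| /\ 0 <= `|K| by [].
have [m1 k1] := (ler_norm M, ler_norm K).
have Nx : N (x%:C : C) = x by rewrite NC ger0_norm // /x; lra.
have : N (x%:C : C) <= K by apply: HK; change (M < N (x%:C : C)); rewrite Nx /x; lra.
by rewrite Nx /x; lra.
Qed.

(** Truncation at radius [M + 1] makes [E] compact. The quasi-component of [zeta] is connected, so
    lies in its bounded component and misses [ys]; hence a clopen part [D] contains [zeta] and
    misses [ys], and with it the connected shell that joins the truncation to infinity. A thin
    neighbourhood of [D] has its boundary off [E]. *)
Lemma bounded_component_separated E M zeta : closed E -> 0 < M -> (forall z, M < N z -> E z) ->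
  E zeta -> bounded_set (connected_component E zeta) ->
  exists G, [/\ open G, exists M', forall z, G z -> N z <= M', G zeta &
    forall z, frontier G z -> ~ E z].
Proof.
move=> cE M0 far Ez bE; set K := connected_component E zeta in bE.
have Kfar z : K z -> N z <= M.
  move=> Kz; rewrite leNgt; apply/negP => hz.
  have sub : [set w | M < N w] `<=` K.
    rewrite /K (same_connected_component Kz); apply: connected_component_max => //.
    exact: connected_far.
  apply: (@far_unbounded M); apply/bounded_setP; case/bounded_setP: bE => M' HM'; exists M' => w /sub.
  exact: HM'.
pose M2 := M + 1; pose X := E `&` cdisc 0 M2.
have kX : compact X.
  apply: (@compactC R X M2); first by apply: closedI => //; exact: cdisc_closed.
  by move=> z [_]; rewrite /cdisc /= subr0.
have Xz : X zeta.
  by split => //; rewrite /cdisc /= subr0 /M2; have := Kfar zeta (connected_component_refl Ez); lra.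
have M20 : 0 < M2 by rewrite /M2; lra.
pose ys : C := M2%:C.
have Nys : N ys = M2 by rewrite /ys NC gtr0_norm.
have Xy : X ys by split; [apply: far; rewrite Nys /M2; lra|change (N (ys - 0) <= M2); rewrite subr0 Nys].
have nQ : ~ quasi_component X zeta ys.
  move=> Qy; have : K ys; last by move=> /Kfar; rewrite Nys /M2; lra.
  apply: (connected_component_max (B := quasi_component X zeta)) Qy.
  - by split => // D.
  - by move=> z [[]].
  exact: quasi_component_connected.
have [D [[DX cD cXD] Dz nDy]] : exists D, [/\ clopen_in X D, D zeta & ~ D ys].
  by apply: contrapT => none; apply: nQ; split => // D cD Dz; apply: contrapT => nD; apply: none; exists D.
have shell z : M < N z <= M2 -> ~ D z.
  have cS : connected [set z : C | M < N z <= M2] by apply: connected_shell => //; rewrite /M2; lra.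
  move: z; apply: (connected_clopen (P := fun z => ~ D z)) => //.
  - exists ys => //; change (M < N ys <= M2); rewrite Nys lexx andbT /M2; lra.
  - move=> z _ nDz; have : nbhs z (~` D) by apply: open_nbhs_nbhs; split => //; exact: closed_openC.
    by apply: filterS => w.
  move=> z Sz /contrapT Dz'.
  have : nbhs z (~` (X `\` D)).
    by apply: open_nbhs_nbhs; split; [exact: closed_openC|move=> []].
  apply: filterS => w nXD /andP[w1 w2] nDw; apply: nXD; split => //.
  by split; [exact: far|rewrite /cdisc /= subr0].
have DM z : D z -> N z <= M.
  move=> Dz'; rewrite leNgt; apply/negP => h; apply: (shell z) => //; rewrite h /=.
  by have [_] := DX z Dz'; rewrite /cdisc /= subr0.
have kD : compact D by exact: (subclosed_compact cD kX).
have cED : closed (E `\` D).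
  have -> : E `\` D = (X `\` D) `|` (E `&` ~` disc 0 M2).
    apply/seteqP; split=> z.
      move=> [Ez' nD]; have [h|h] := ltP (N z) M2; [left|right].
        by split => //; split => //; rewrite /cdisc /= subr0 ltW.
      by split => //; rewrite /disc /= subr0; apply/negP; rewrite -leNgt.
    case=> [[[Ez' _] nD]//|[Ez' /negP]]; rewrite /disc /= subr0 -leNgt => h; split => //.
    by move/DM; rewrite /M2 in h; lra.
  apply: closedU => //; apply: closedI => //; apply: open_closedC; exact: disc_open.
have [d d0 Hd] := compact_separated kD cED (fun z Dz h => h.2 Dz).
have d2 : 0 < d / 2 by rewrite divr_gt0.
exists (thicken D (d / 2)); split.
- exact: thicken_open.
- exists (M + d / 2) => z [p /DM pM zp]; have := ler_N (z - p) p; rewrite subrK; lra.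
- exact: sub_thicken.
move=> z fz Ez'; have [p Dp zp] : exists2 p, D p & N (z - p) < 2 * (d / 2).
  by apply: closure_thicken => //; case: fz.
have [Dz'|nD] := pselect (D z).
  by apply: (frontier_notin (@thicken_open D (d / 2)) fz); exact: sub_thicken.
by have := Hd p z Dp (conj Ez' nD); rewrite NBC; lra.
Qed.

End PlaneTopology.

(** * Lifts of circle-valued maps and the outer boundary *)

Section OuterBoundary.
Context {R : realType}.
Local Notation C := R[i].
Implicit Types (c p z w y zeta : C) (r s M : R) (A B E G U W X D : set C) (g : C -> C).

Lemma uniform_cont g M (e : R) : (forall z, {for z, continuous g}) -> 0 < e ->
  exists2 d, 0 < d & forall x y, cdisc 0 M x -> N (y - x) < d -> N (g y - g x) < e.
Proof.
move=> cg e0; have /compact_near_coveringP nA := @compact_cdisc R 0 M.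
have e2 : 0 < e / 2 by rewrite divr_gt0.
have H := nA R (0 : R)^'+ (fun d x => forall y, N (y - x) < d -> N (g y - g x) < e).
have {}H := H _.
have [d [d0 Hd]] : exists d, 0 < d /\ forall x, cdisc 0 M x -> forall y, N (y - x) < d -> N (g y - g x) < e.
  apply: (@filter_ex _ (0 : R)^'+ _ (fun d => 0 < d /\ forall x, cdisc 0 M x -> forall y, N (y - x) < d -> N (g y - g x) < e)).
  apply: filterI; first exact: nbhs_right_gt.
  apply: H => x Ax; have [r r0 D] := (contCC _ _).1 (cg x) _ e2.
  have r2 : 0 < r / 2 by rewrite divr_gt0.
  exists (disc x (r / 2), [set d | d <= r / 2]) => /=.
    by split; [exact: near_disc|apply: nbhs_right_le].
  move=> [w d] /= [wx dr] y wy; move: wx; rewrite /disc /= => wx.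
  have h1 : N (g w - g x) < e / 2 by apply: D; rewrite /disc /=; lra.
  have h2 : N (g y - g x) < e / 2.
    by apply: D; rewrite /disc /=; have := N_tri w y x; lra.
  by have := N_tri (g x) (g y) (g w); rewrite (NBC (g x)); lra.
by exists d => // x y Ax h; exact: Hd.
Qed.

(* [g ((k + 1) z / n) / g (k z / n)] is within distance 1 of 1. *)
Lemma circle_lift g M : (forall z, {for z, continuous g}) -> (forall z, N (g z) = 1) ->
  exists theta : C -> R, forall z, cdisc 0 M z ->
    {for z, continuous theta} /\ g z = cexp (0 +i* theta z).
Proof.
move=> cg g1; have [d d0 Hd] := uniform_cont `|M| cg ltr01.
have [n Hn] : exists n : nat, `|M| / d < n.+1%:R.
  exists (Num.bound (`|M| / d)); apply: lt_le_trans (archi_boundP _) _; last by rewrite ler_nat.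
  by rewrite divr_ge0 // ltW.
pose q k z : C := (k%:R / n.+1%:R)%:C * z.
have n0 : 0 < n.+1%:R :> R by [].
have qM k z : (k <= n.+1)%N -> cdisc 0 M z -> cdisc 0 `|M| (q k z).
  rewrite /cdisc /= !subr0 /q => kn zM; rewrite NM NC ger0_norm; last by rewrite divr_ge0.
  have : k%:R / n.+1%:R <= 1 :> R by rewrite ler_pdivrMr // mul1r ler_nat.
  move=> k1; apply: le_trans (le_trans zM (ler_norm M)).
  by rewrite -[leRHS]mul1r ler_wpM2r // N_ge0.
have qS k z : cdisc 0 M z -> N (q k.+1 z - q k z) < d.
  rewrite /cdisc /= subr0 => zM; have -> : q k.+1 z - q k z = (n.+1%:R^-1)%:C * z.
    by rewrite /q -mulrBl -rmorphB /= -mulrBl -natrB // subSnn mul1r.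
  rewrite NM NC ger0_norm ?invr_ge0 // mulrC ltr_pdivrMr //.
  by move: Hn; rewrite ltr_pdivrMr // mulrC; have := ler_norm M; lra.
have gn0 z : g z != 0 by rewrite -N_gt0 g1.
have cq k z : {for z, continuous (fun z => g (q k z))}.
  apply: (@continuous_comp _ _ _ (q k) g); last exact: cg.
  by apply: cdiff_cont; apply: cdiffM; [exact: cdiff_cst|exact: cdiff_id].
pose rt k z := g (q k.+1 z) / g (q k z).
have rt1 k z : (k < n.+1)%N -> cdisc 0 M z -> 0 < Re (rt k z).
  move=> kn zM; have h := Hd (q k z) (q k.+1 z) (qM k z (ltnW kn) zM) (qS k z zM).
  have : N (rt k z - 1) < 1.
    have -> : rt k z - 1 = (g (q k.+1 z) - g (q k z)) / g (q k z) by rewrite /rt mulrBl divff.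
    by rewrite NM NV g1 invr1 mulr1.
  have := Re_le_N (rt k z - 1); rewrite ReD ReN [Re 1]/= ler_norml => /andP[+ _]; lra.
pose theta0 : R := xget 0 [set t : R | g 0 = cexp (0 +i* t)].
have th0 : g 0 = cexp (0 +i* theta0).
  rewrite /theta0; case: xgetP => [t _ //|/= none].
  have [t _ tE] := polar (gn0 0); case: (none t); rewrite {1}tE g1 ln1 //.
pose th := fix th k z : R := match k with 0%N => theta0 | k'.+1 => th k' z + Im (clog (rt k' z)) end.
have thP k z : (k <= n.+1)%N -> cdisc 0 M z -> {for z, continuous (th k)} /\ g (q k z) = cexp (0 +i* th k z).
  elim: k => [|k IH] kn zM.
    split; first exact: cst_continuous.
    by rewrite /q mul0r mul0r.
  have [IH1 IH2] := IH (ltnW kn) zM; have r0 := rt1 k z kn zM.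
  split.
    apply: (@cvgD _ _ _ (nbhs z) (nbhs_filter z)); first exact: IH1.
    apply: (@continuous_comp _ _ _ (fun z => clog (rt k z)) (@complex.Im R)); last exact: continuous_Im.
    apply: (@continuous_comp _ _ _ (rt k) clog); last exact: continuous_clog.
    apply: (@cvgM _ _ (nbhs z) (nbhs_filter z)); first exact: cq.
    by apply: (@cvgV _ _ (nbhs z) (nbhs_filter z)); [exact: gn0|exact: cq].
  have -> : g (q k.+1 z) = rt k z * g (q k z) by rewrite /rt divfK.
  rewrite -[in LHS](clogK r0) IH2 -cexpD /=; congr cexp.
  have Rl : Re (clog (rt k z)) = 0.
    by rewrite /clog [LHS]/= /rt NM NV !g1 invr1 mulr1 ln1.
  by apply: complexP; rewrite ?ReD ?ImD ?Rl /= ?addr0 // addrC.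
exists (th n.+1) => z zM; have := thP n.+1 z (leqnn _) zM.
by rewrite /q divff ?mul1r // gt_eqF.
Qed.

Lemma cexp_small (x : R) : `|x| < pi -> cexp ((0 : R) +i* x) = 1 -> x = 0.
Proof.
move=> xpi /(congr1 (@complex.Im R)); rewrite /cexp expR0 [LHS]/= [RHS]/= mul1r => sx.
apply: contrapT => /eqP x0; have [xn|xp] := ltP x 0.
  have : 0 < sin (- x) by apply: sin_gt0_pi; move: xpi; rewrite ltr0_norm // => h; rewrite oppr_gt0 xn h.
  by rewrite sinN sx oppr0 ltxx.
have : 0 < sin x; last by rewrite sx ltxx.
by apply: sin_gt0_pi; rewrite lt_neqAle eq_sym x0 xp /=; move: xpi; rewrite ger0_norm.
Qed.

Lemma phase_constant A (t : C -> R) : connected A -> (forall z, A z -> {for z, continuous t}) ->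
  (forall z, A z -> cexp (0 +i* t z) = 1) -> forall z w, A z -> A w -> t z = t w.
Proof.
move=> cA ct t1 z w Az Aw; have : A `<=` [set z | t z = t w]; last by apply.
have p0 : 0 < pi :> R by exact: pi_gt0.
have loc y : A y -> \forall x \near y, A x -> t x = t y.
  move=> Ay; have [d d0 D] := (contC _ _).1 (ct y Ay) _ p0.
  apply: filterS (near_disc y d0) => x /D h Ax; apply/eqP; rewrite -subr_eq0; apply/eqP.
  apply: cexp_small h _.
  have -> : ((0 : R) +i* (t x - t y)) = (0 +i* t x) - (0 +i* t y).
    by apply: complexP; rewrite ?ReD ?ImD ?ReN ?ImN /= ?subr0.
  apply: (mulIf (cexp_neq0 (0 +i* t y))).
  by rewrite -cexpD subrK mul1r !t1.
apply: (connected_clopen (P := fun z => t z = t w)) => //; first by exists w.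
  by move=> y Ay yw; apply: filterS (loc y Ay) => x h Ax; rewrite h.
by move=> y Ay yw; apply: filterS (loc y Ay) => x h Ax; rewrite h.
Qed.

(* The circle-valued map equal to [cexp (i pi la)] off [W] and to [cexp (- i pi la)]
   on [W] has a logarithm, whose increments over [U] and over [W] between the two
   points are [pi] and [- pi]. *)
Lemma two_valued_constant U W M (la : C -> R) zeta zeta' : connected U -> connected (W `&` cdisc 0 M) -> closed W ->
  (forall z, U z -> ~ W z) -> frontier W `<=` closure U ->
  (forall z, U z -> cdisc 0 M z) -> frontier W `<=` cdisc 0 M ->
  (forall z, {for z, continuous la}) -> (forall z, frontier W z -> la z = 0 \/ la z = 1) ->
  frontier W zeta -> frontier W zeta' -> la zeta = 0 -> la zeta' = 1 -> False.
Proof.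
move=> cU cW clW UW FU UM FM cla la01 fz fz' l0 l1.
have p0 : 0 < pi :> R by exact: pi_gt0.
pose e1 z := cexp (0 +i* (pi * la z)); pose e2 z := cexp (0 +i* (- (pi * la z))).
pose g z := if z \in W then e2 z else e1 z.
have WF z : frontier W z -> W z.
  by case=> + _; rewrite -(closure_id W).1.
have ci z (t : C -> R) : {for z, continuous t} -> {for z, continuous (fun z => cexp (0 +i* t z))}.
  move=> ct; apply: (@continuous_comp _ _ _ (fun z => 0 +i* t z) cexp); last by apply: cdiff_cont; exact: cdiff_cexp.
  by apply: (@cvg_complex R C (nbhs z) (nbhs_filter z)) => //; exact: cvg_cst.
have cpl z : {for z, continuous (fun z => pi * la z)}.
  by apply: (@cvgM _ _ (nbhs z) (nbhs_filter z)); [exact: cvg_cst|exact: cla].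
have c1 z : {for z, continuous e1} by apply: ci.
have c2 z : {for z, continuous e2} by apply: ci; apply: (@cvgN _ _ _ (nbhs z) (nbhs_filter z)); exact: cpl.
(* The factor [pi] is chosen because [exp (i pi) = exp (- i pi)]: the two branches agree where [la]
   is 0 or 1, so [g] is continuous. *)
have e12 z : frontier W z -> e1 z = e2 z.
  move=> /la01 [] E; rewrite /e1 /e2 E ?mulr0 ?mulr1 ?oppr0 //.
  by rewrite /cexp /= cosN sinN sinpi oppr0.
have cg z : {for z, continuous g}.
  have [Wz|nWz] := pselect (W z); last first.
    have nz : nbhs z (~` W) by apply: open_nbhs_nbhs; split => //; exact: closed_openC.
    apply/contCC => e e0; have [d d0 D] := (contCC _ _).1 (c1 z) e e0.
    have /nbhs_discP[d' d'0 D'] := nz.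
    exists (Num.min d d') => [|w]; first by rewrite lt_min d0.
    rewrite /disc /= lt_min => /andP[wd wd']; have nWw : ~ W w := D' w wd'.
    by rewrite /g !memNset //; exact: D.
  have [iz|niz] := pselect (interior W z).
    apply/contCC => e e0; have [d d0 D] := (contCC _ _).1 (c2 z) e e0.
    have /nbhs_discP[d' d'0 D'] := iz.
    exists (Num.min d d') => [|w]; first by rewrite lt_min d0.
    rewrite /disc /= lt_min => /andP[wd wd']; have Ww : W w := D' w wd'.
    by rewrite /g !mem_set //; exact: D.
  have fz0 : frontier W z by split => //; exact: subset_closure.
  apply/contCC => e e0; have [d d0 D] := (contCC _ _).1 (c2 z) e e0.
  have [d' d'0 D'] := (contCC _ _).1 (c1 z) e e0.
  exists (Num.min d d') => [|w]; first by rewrite lt_min d0.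
  rewrite /disc /= lt_min => /andP[wd wd']; rewrite /g (mem_set Wz).
  by case: ifP => _; [exact: D|rewrite -e12 //; exact: D'].
have g1 z : N (g z) = 1 by rewrite /g; case: ifP => _; rewrite N_cexp expR0.
have [th Hth] := circle_lift (M + 1) cg g1.
have M1 z : cdisc 0 M z -> cdisc 0 (M + 1) z by rewrite /cdisc /=; lra.
have ctU z : cdisc 0 M z -> {for z, continuous (fun z => th z - pi * la z)}.
  move=> zM; apply: (@cvgB _ _ _ (nbhs z) (nbhs_filter z)); last exact: cpl.
  by case: (Hth z (M1 z zM)).
have ctW z : cdisc 0 M z -> {for z, continuous (fun z => th z + pi * la z)}.
  move=> zM; apply: (@cvgD _ _ _ (nbhs z) (nbhs_filter z)); last exact: cpl.
  by case: (Hth z (M1 z zM)).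
have EW : th zeta + pi * la zeta = th zeta' + pi * la zeta'.
  apply: (phase_constant cW (fun z Wz => ctW z Wz.2)); [|by split; [exact: WF|exact: FM]|by split; [exact: WF|exact: FM]].
  move=> z [Wz zM]; have [_ tE] := Hth z (M1 z zM).
  have -> : ((0 : R) +i* (th z + pi * la z)) = (0 +i* th z) + (0 +i* (pi * la z)).
    by apply: complexP; rewrite ?ReD ?ImD /= ?addr0.
  rewrite cexpD -tE /g mem_set // -cexpD.
  have -> : ((0 : R) +i* - (pi * la z)) + (0 +i* (pi * la z)) = 0.
    by apply: complexP; rewrite ?ReD ?ImD /= ?addr0 ?addNr.
  exact: cexp0.
have EU y z : U y -> U z -> th y - pi * la y = th z - pi * la z.
  apply: (phase_constant cU (fun z Uz => ctU z (UM z Uz))).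
  move=> {}z Uz; have [_ tE] := Hth z (M1 z (UM z Uz)).
  have -> : ((0 : R) +i* (th z - pi * la z)) = (0 +i* th z) - (0 +i* (pi * la z)).
    by apply: complexP; rewrite ?ReD ?ImD ?ReN ?ImN /= ?subr0.
  rewrite cexpD -tE /g memNset; last exact: UW.
  by rewrite -cexpD subrr cexp0.
have [u Uu] : U !=set0.
  by have [w [Uw _]] := FU _ fz _ (near_disc zeta ltr01); exists w.
have EF z : frontier W z -> th z - pi * la z = th u - pi * la u.
  move=> fz0; apply: eq_eps => e e0.
  have [d d0 D] := (contC _ _).1 (ctU z (FM z fz0)) e e0.
  have [w [Uw wd]] := FU z fz0 _ (near_disc z d0).
  by rewrite -(EU w u Uw Uu) distrC ltW // D.
have := EF _ fz; rewrite -(EF _ fz'); move: EW; rewrite l0 l1 mulr0 mulr1; lra.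
Qed.

Section UnboundedComponent.
Variables (U : set C) (M : R).
Hypothesis oU : open U.
Hypothesis M0 : 0 < M.
Hypothesis bU : forall z, U z -> N z <= M.
Local Notation W := (unbounded_component U).

Let far z : M < N z -> (~` U) z.
Proof. by move=> h /bU; lra. Qed.

Lemma far_component z : M < N z -> [set w | M < N w] `<=` connected_component (~` U) z.
Proof. by move=> h; apply: connected_component_max => //; exact: connected_far. Qed.

Lemma unbounded_far z : M < N z -> W z.
Proof.
move=> h; split; first exact: far.
move/bounded_setP => [K HK]; apply: (@far_unbounded R M); apply/bounded_setP; exists K => w hw.
by apply: HK; exact: far_component hw.
Qed.

Lemma unbounded_componentE z : M < N z -> W = connected_component (~` U) z.
Proof.
move=> h; apply/seteqP; split=> w.
  move=> [nUw ub]; have [y hy My] : exists2 y, connected_component (~` U) w y & M < N y.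
    apply: contrapT => none; apply: ub; apply/bounded_setP; exists M => y hy.
    by rewrite leNgt; apply/negP => My; apply: none; exists y.
  apply: connected_component_trans (far_component h My) _.
  exact: connected_component_sym.
move=> zw; split; first exact: (connected_component_sub zw).
by rewrite -(same_connected_component zw); case: (unbounded_far h).
Qed.

Lemma far_point : exists z : C, M < N z.
Proof. by exists ((M + 1)%:C); rewrite NC ger0_norm ?ltrDl //; have := M0; lra. Qed.

Lemma unbounded_closed : closed W.
Proof.
have [z h] := far_point; rewrite (unbounded_componentE h).
by apply: component_closed; exact: open_closedC.
Qed.

Lemma unbounded_connected : connected W.
Proof. by have [z h] := far_point; rewrite (unbounded_componentE h); exact: component_connected. Qed.

Lemma unbounded_notin z : W z -> ~ U z.
Proof. by case. Qed.

Lemma outer_boundaryW zeta : outer_boundary U zeta -> W zeta.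
Proof. by case=> + _; rewrite -(closure_id W).1 //; exact: unbounded_closed. Qed.

Lemma unbounded_nbhs zeta : W zeta -> nbhs zeta (~` U) -> interior W zeta.
Proof.
move=> Wz /nbhs_discP[r r0 D]; apply/nbhs_discP; exists r => //.
have [z h] := far_point; rewrite (unbounded_componentE h) in Wz *.
rewrite (same_connected_component Wz); apply: connected_component_max => //.
  exact: disc_center.
exact: connected_disc.
Qed.

Lemma outer_boundary_frontier : outer_boundary U `<=` frontier U.
Proof.
move=> zeta fz; have Wz := outer_boundaryW fz; have nUz := unbounded_notin Wz.
apply: frontierE => //; apply: contrapT => ncl; case: fz => _; apply.
by apply: unbounded_nbhs => //; exact: near_closureN.
Qed.

Lemma inner_bounded zeta : frontier U zeta -> ~ outer_boundary U zeta ->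
  bounded_set (connected_component (~` U) zeta).
Proof.
move=> fz nout; apply: contrapT => ub; apply: nout.
have nUz := frontier_notin oU fz; have Wz : W zeta by split.
split; first exact: subset_closure.
move=> iz; case: fz => cz _; have [w [Uw Ww]] := cz _ iz.
exact: unbounded_notin Ww Uw.
Qed.

(** The radial retraction onto the disc maps the unbounded component into itself, since that
    component contains all points of modulus above [M]. *)
Lemma unbounded_truncated : connected (W `&` cdisc 0 (M + 1)).
Proof.
have M1 : 0 < M + 1 by have := M0; lra.
pose ret z : C := ((M + 1) / Num.max (M + 1) (N z))%:C * z.
have mx z : 0 < Num.max (M + 1) (N z) by rewrite lt_max M1.
have retin z : N z <= M + 1 -> ret z = z.
  by move=> h; rewrite /ret (max_idPl h) divff ?mul1r // gt_eqF.
have retout z : M + 1 < N z -> N (ret z) = M + 1.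
  move=> h; rewrite /ret (max_idPr (ltW h)) NM NC.
  have z0 : 0 < N z by lra.
  by rewrite ger0_norm ?divfK ?gt_eqF // divr_ge0 // ltW.
have -> : W `&` cdisc 0 (M + 1) = ret @` W.
  apply/seteqP; split=> [z [Wz]|_ [z Wz <-]].
    by rewrite /cdisc /= subr0 => h; exists z => //; exact: retin.
  have [h|h] := leP (N z) (M + 1); first by rewrite retin //; split => //; rewrite /cdisc /= subr0.
  by split; [apply: unbounded_far|rewrite /cdisc /= subr0]; rewrite retout // ltrDl.
apply: connected_continuous_connected; first exact: unbounded_connected.
apply: continuous_subspaceT => z.
apply: (@cvgM _ _ (nbhs z) (nbhs_filter z)); last exact: cvg_id.
apply: (@cvg_complex R C (nbhs z) (nbhs_filter z)); last exact: cvg_cst.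
apply: (@cvgM _ _ (nbhs z) (nbhs_filter z)); first exact: cvg_cst.
apply: (@cvgV _ _ (nbhs z) (nbhs_filter z)); first by rewrite gt_eqF.
apply: cont_max; first exact: cst_continuous.
exact: continuous_N.
Qed.

End UnboundedComponent.
End OuterBoundary.

(** * A barrier at the outer boundary *)

Section OuterBarrier.
Context {R : realType}.
Local Notation C := R[i].
Implicit Types (c p z w y zeta : C) (r s M : R) (A B E G U W X D : set C) (g : C -> C).

Definition away W r z := forall k, W k -> r <= N (z - k).

(** Moving the pole from [k] to [k'] by less than [r] multiplies the quotient by
    [(z - k) / (z - k')], which is within distance 1 of 1 and has the logarithm [clog]. The poles
    that can be reached form a clopen subset of [W]. *)
Lemma log_branch W r zeta zeta' : connected W -> 0 < r -> W zeta -> W zeta' ->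
  exists g, forall z, away W r z -> cexp (g z) = (z - zeta) / (z - zeta') /\ cdiff g z.
Proof.
move=> cW r0 Wz Wz'.
pose P k := exists g, forall z, away W r z -> cexp (g z) = (z - zeta) / (z - k) /\ cdiff g z.
have neq z k : away W r z -> W k -> z - k != 0.
  by move=> az Wk; rewrite -N_gt0; apply: lt_le_trans r0 (az k Wk).
have step k k' : W k -> W k' -> N (k - k') < r -> P k -> P k'.
  move=> Wk Wk' kk [g Hg]; exists (fun z => g z + clog ((z - k) / (z - k'))) => z az.
  have [g1 g2] := Hg z az; have n1 := neq z k az Wk; have n2 := neq z k' az Wk'.
  have re : 0 < Re ((z - k) / (z - k')).
    have : N ((z - k) / (z - k') - 1) < 1.
      have -> : (z - k) / (z - k') - 1 = (k' - k) / (z - k').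
        by rewrite -[X in _ - X](divff n2) -mulrBl; congr (_ / _); ring.
      rewrite NM NV ltr_pdivrMr ?N_gt0 // mul1r NBC; apply: lt_le_trans kk _; exact: az.
    have := Re_le_N ((z - k) / (z - k') - 1); rewrite ReD ReN [Re 1]/= ler_norml => /andP[+ _]; lra.
  split; first by rewrite cexpD g1 clogK // mulrA divfK.
  apply: cdiffD => //; apply: (cdiff_comp (f := clog) (g := fun z => (z - k) / (z - k'))).
    by apply: cdiff_div => //; apply: cdiffB; [exact: cdiff_id|exact: cdiff_cst|exact: cdiff_id|exact: cdiff_cst].
  exact: cdiff_clog.
have Pz : P zeta.
  exists (fun _ => 0) => z az; split; last exact: cdiff_cst.
  by rewrite cexp0 divff // neq.
have : W `<=` P; last by apply.
apply: (connected_clopen (P := P)) => //; first by exists zeta.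
  move=> k Wk Pk; apply: filterS (near_disc k r0) => k'; rewrite /disc /= => kk Wk'.
  by apply: step Pk => //; rewrite NBC.
move=> k Wk nPk; apply: filterS (near_disc k r0) => k'; rewrite /disc /= => kk Wk' Pk'.
by apply: nPk; apply: step Pk'.
Qed.

(** By Harnack's inequality a nonnegative harmonic function that vanishes at a point vanishes near
    it. *)
Lemma mvp_ge0_pos U (x : C -> R) z0 : open U -> connected U -> mvp U x ->
  (forall z, U z -> 0 <= x z) -> U z0 -> 0 < x z0 -> forall z, U z -> 0 < x z.
Proof.
move=> oU cU mx x0 Uz0 xz0; apply: (connected_clopen (P := fun z => 0 < x z)) => //.
- by exists z0.
- move=> z Uz h; have [cx _] := mx z Uz.
  by apply: filterS (near_lt (@cst_continuous _ _ 0 z) cx h) => w.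
move=> z Uz /negP; rewrite -leNgt => h.
have [r r0 D] := open_disc oU Uz; have r2 : 0 < r / 2 by rewrite divr_gt0.
have sub : cdisc z (r / 2) `<=` U by move=> w; rewrite /cdisc /= => hw; apply: D; rewrite /disc /=; lra.
have r4 : 0 < r / 4 by rewrite divr_gt0.
apply: filterS (near_disc z r4) => w; rewrite /disc /= => hw _.
have : x z / 3 <= x w <= 3 * x z.
  apply: (harnack_half r2).
  - by move=> y /sub Uy; case: (mx y Uy).
  - by apply: mvp_sub mx => y /ltW; exact: sub.
  - by move=> y /sub; exact: x0.
  lra.
by move=> /andP[_ h3]; apply/negP; rewrite -leNgt; lra.
Qed.

Lemma ReV z : Re z^-1 = Re z / N z ^+ 2.
Proof. by case: z => x y; rewrite N_sqr /= ?mulr1 -?exprVn. Qed.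

(* The barrier is a limit, as [r] tends to 0, of [Re (- 1 / (L - i tau - K))] where
   [L] is a branch of [log ((z - zeta) / (z - zeta'))] at distance [r] from the
   unbounded component, [tau] is real and [Re L < K]. *)
Lemma outer_barrier U M z0 zeta : open U -> connected U -> 0 < M -> (forall z, U z -> N z <= M) ->
  U z0 -> outer_boundary U zeta -> exists b, weak_barrier U zeta b.
Proof.
move=> oU cU M0 bU Uz0 oz; set W := unbounded_component U.
have cW : connected W := unbounded_connected M0 bU.
have Wz : W zeta := outer_boundaryW oU M0 bU oz.
(* A second point of the unbounded component, so far from [U] that the quotient has modulus at most
   both 2 and [N (z - zeta)] there. *)
pose zeta' : C := (2 * M + 1)%:C.
have Nz' : N zeta' = 2 * M + 1 by rewrite /zeta' NC ger0_norm //; lra.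
have Wz' : W zeta' by apply: (unbounded_far M0 bU); rewrite Nz'; lra.
have nWU z : U z -> ~ W z by move=> Uz /unbounded_notin.
have Nzeta : N zeta <= M.
  have := outer_boundaryW oU M0 bU oz; rewrite leNgt => _; apply/negP => h.
  have [cz _] := outer_boundary_frontier oU M0 bU oz.
  have [w [Uw hw]] := cz _ (near_lt (@cst_continuous _ _ M zeta) (@continuous_N R zeta) h).
  by have := bU w Uw; lra.
have Nd z : U z -> M + 1 <= N (z - zeta').
  by move=> /bU h; have := N_rev zeta' z; rewrite NBC Nz'; lra.
have Nn z : U z -> 0 < N (z - zeta) <= 2 * M.
  move=> Uz; rewrite N_gt0 subr_eq0; apply/andP; split.
    by apply/eqP => E; apply: (nWU z Uz); rewrite E.
  by have := ler_NB z zeta; have := bU z Uz; lra.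
pose lr z := ln (N ((z - zeta) / (z - zeta'))).
have lrE z : U z -> lr z <= ln 2 /\ lr z <= ln (N (z - zeta)).
  move=> Uz; have /andP[n1 n2] := Nn z Uz; have d1 := Nd z Uz.
  have d0 : 0 < N (z - zeta') by lra.
  have q0 : 0 < N (z - zeta) / N (z - zeta') by rewrite divr_gt0.
  by rewrite /lr NM NV !ler_ln ?posrE //; split; rewrite ler_pdivrMr //; nra.
have /choice[L HL] : forall n : nat, exists g, forall z, away W n.+1%:R^-1 z ->
    cexp (g z) = (z - zeta) / (z - zeta') /\ cdiff g z.
  by move=> n; apply: log_branch => //; rewrite invr_gt0.
(* The real part of every branch is at most [ln 2], so that of [D] is at least 1. *)
pose K : R := ln 2 + 1.
(* The imaginary shift makes [D n z0] real: [w n z0] is then eventually one positive constant, and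
   the limit cannot vanish identically. *)
pose D n z : C := (K +i* Im (L n z0)) - L n z.
pose w n z := Re (D n z)^-1.
have ReD_ n z : away W n.+1%:R^-1 z -> Re (D n z) = K - lr z.
  by move=> /HL[h _]; rewrite /D ReD ReN [Re (_ +i* _)]/= /lr -h N_cexp expRK.
have Kl z : U z -> 1 <= K - lr z by move=> /lrE[h _]; rewrite /K; lra.
have D0 n z : U z -> away W n.+1%:R^-1 z -> D n z != 0.
  move=> Uz az; apply/eqP => h; have := ReD_ n z az; rewrite h [Re 0]/=.
  by have := Kl z Uz; lra.
have wb n z : U z -> away W n.+1%:R^-1 z -> 0 <= w n z <= (K - lr z)^-1.
  move=> Uz az; have k1 := Kl z Uz; have e1 := ReD_ n z az; apply/andP; split.
    by rewrite /w ReV e1 divr_ge0 ?sqr_ge0 //; lra.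
  apply: le_trans (Re_le_normc _) _; rewrite NV lef_pV2 ?posrE ?N_gt0 ?D0 //; last lra.
  by rewrite -e1; exact: Re_le_normc.
have wb1 n z : U z -> away W n.+1%:R^-1 z -> `|w n z| <= 1.
  move=> Uz az; have /andP[h1 h2] := wb n z Uz az; rewrite ger0_norm //.
  by apply: le_trans h2 _; rewrite invf_le1 ?Kl //; have := Kl z Uz; lra.
have near_away c : U c -> exists2 r, 0 < r & disc c (3 * r) `<=` U /\
    \forall n \near \oo, forall z, disc c (3 * r) z -> away W n.+1%:R^-1 z.
  move=> Uc; have [d d0 dU] := open_disc oU Uc; exists (d / 6); first by rewrite divr_gt0.
  split; first by move=> z; rewrite /disc /= => hz; apply: dU; rewrite /disc /=; lra.
  have d2 : 0 < d / 2 by rewrite divr_gt0.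
  apply: filterS (near_infty_natSinv_lt (PosNum d2)) => n /= hn z; rewrite /disc /= => zc k Wk.
  rewrite leNgt; apply/negP => h; apply: (nWU k) => //; apply: dU; rewrite /disc /=.
  have hk : N (z - k) < d / 2 := lt_trans h hn.
  by have := N_tri z k c; rewrite (NBC k z); lra.
(* The branches for different [n] are chosen independently; boundedness gives a limit along an
   ultrafilter. *)
have [F [UF sF]] := ultraFilterLemma eventually_filter.
have FF : ProperFilter F by exact: ultra_proper.
have ev c : U c -> \forall n \near \oo, away W n.+1%:R^-1 c.
  move=> Uc; have [r r0 [_ H]] := near_away c Uc; apply: filterS H => n; apply.
  by apply: disc_center; rewrite mulr_gt0.
have /choice[x Hx] : forall z, exists x : R, U z -> (fun n => w n z) @ F --> x.
  move=> z; have [Uz|nU] := pselect (U z); last by exists 0.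
  have [|x hx] := @ultra_bounded_limit R nat F (fun n => w n z) 1 UF; last by exists x.
  by apply: sF; apply: filterS (ev z Uz) => n az; exact: wb1.
have mx : mvp U x.
  apply: mvp_local => c Uc; have [r r0 [rU H]] := near_away c Uc.
  exists (disc c r); first by split; [exact: disc_open|exact: disc_center].
  have H2 : \forall n \near F, mvp (disc c (3 * r)) (w n) /\ forall z, disc c (3 * r) z -> `|w n z| <= 1.
    apply: sF; apply: filterS H => n Hn; split; last by move=> z hz; apply: wb1; [exact: rU|exact: Hn].
    apply: Re_mvp => [|z hz]; first exact: disc_open.
    apply: cdiffV; last by apply: D0; [exact: rU|exact: Hn].
    apply: cdiffB; first exact: cdiff_cst.
    by case: (HL n z (Hn z hz)).
  by have [] := mvp_limit FF r0 H2 (fun z hz => Hx z (rU z hz)).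
have lim_near z (Q : R -> Prop) : U z -> (\forall n \near \oo, Q (w n z)) ->
    forall e, 0 < e -> exists2 t, Q t & `|x z - t| < e.
  move=> Uz HQ e e0; have /(@cvgrPdist_lt _ _ _ _ FF) /(_ e e0) h1 := Hx z Uz.
  by have [n [h2 h3]] := filter_ex (filterI h1 (sF _ HQ)); exists (w n z).
have xb z : U z -> 0 <= x z <= (K - lr z)^-1.
  move=> Uz; have HQ : \forall n \near \oo, 0 <= w n z <= (K - lr z)^-1.
    by apply: filterS (ev z Uz) => n; exact: wb.
  have H := @lim_near z (fun t => 0 <= t <= (K - lr z)^-1) Uz HQ; apply/andP; split; apply/ler_addgt0Pr => e e0.
    by have [t /andP[? ?]] := H e e0; rewrite ltr_norml => /andP[? ?]; lra.
  by have [t /andP[? ?]] := H e e0; rewrite ltr_norml => /andP[? ?]; lra.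
have xz0 : 0 < x z0.
  have HQ : \forall n \near \oo, w n z0 = (K - lr z0)^-1.
    apply: filterS (ev z0 Uz0) => n az.
    have k1 := Kl z0 Uz0.
    have DE : D n z0 = (K - lr z0)%:C.
      by apply: complexP; [rewrite ReD_|rewrite /D ImD ImN /= subrr].
    by rewrite /w ReV DE [Re _]/= NC ger0_norm ?(le_trans ler01) // expr2 invfM mulrA divff ?mul1r // gt_eqF // (lt_le_trans ltr01).
  have k0 : 0 < (K - lr z0)^-1 by rewrite invr_gt0; have := Kl z0 Uz0; lra.
  have [t -> h] := @lim_near z0 (fun t => t = (K - lr z0)^-1) Uz0 HQ _ k0.
  by move: h; rewrite ltr_norml => /andP[? ?]; lra.
exists x; split => //.
  by apply: (mvp_ge0_pos oU cU mx _ Uz0 xz0) => z /xb/andP[].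
move=> e e0; have p0 : 0 < expR (K - e^-1) by exact: expR_gt0.
apply: filterS (near_disc zeta p0) => z; rewrite /disc /= => hz Uz.
have /andP[_ h] := xb z Uz; apply: le_trans h _.
have k1 := Kl z Uz; have [_ h2] := lrE z Uz; have /andP[n0 _] := Nn z Uz.
rewrite -[leRHS]invrK lef_pV2 ?posrE ?invr_gt0 //; last lra.
have : ln (N (z - zeta)) < K - e^-1 by rewrite -[ltRHS]expRK ltr_ln ?posrE ?expR_gt0.
lra.
Qed.

End OuterBarrier.

(** * Orbits of a wandering domain *)

Section WanderingDomain.
Context {R : realType}.
Local Notation C := R[i].
Implicit Types (c p z w : C) (r s t M B : R) (G : set C).

Lemma connected_inside (S : set C) s1 s2 p : connected S -> s1 < s2 ->
  (forall z, S z -> annulus s1 s2 z -> False) -> S p -> N p < s2 -> forall z, S z -> N z <= s1.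
Proof.
move=> cS s12 dS Sp ps; apply: (connected_clopen (P := fun z => N z <= s1)) => //.
- exists p => //; rewrite leNgt; apply/negP => h; apply: (dS p Sp); rewrite /annulus /=.
  by rewrite h ps.
- move=> z Sz zs.
  have zs2 : N z < s2 by lra.
  apply: filterS (near_lt (@continuous_N R z) (@cvg_cst _ _ _ _ (nbhs_filter z)) zs2) => w ws Sw.
  by rewrite leNgt; apply/negP => h; apply: (dS w Sw); rewrite /annulus /= h ws.
move=> z Sz /negP; rewrite -ltNge => zs.
apply: filterS (near_lt (@cvg_cst _ _ _ _ (nbhs_filter z)) (@continuous_N R z) zs) => w ws Sw.
by apply/negP; rewrite -ltNge.
Qed.

Lemma connected_outside (S : set C) s1 s2 p : connected S -> s1 < s2 ->
  (forall z, S z -> annulus s1 s2 z -> False) -> S p -> s1 < N p -> forall z, S z -> s2 <= N z.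
Proof.
move=> cS s12 dS Sp ps z Sz; rewrite leNgt; apply/negP => zs.
by have := connected_inside cS s12 dS Sz zs Sp; lra.
Qed.

Lemma expr_infty (x B : R) : 1 < x -> \forall k \near \oo, B <= x ^+ k.
Proof.
move=> x1; have bern k : 1 + k%:R * (x - 1) <= x ^+ k.
  elim: k => [|k IH]; first by rewrite mul0r addr0.
  rewrite exprS; apply: (@le_trans _ _ (x * (1 + k%:R * (x - 1)))); last by rewrite ler_pM2l //; lra.
  rewrite -natr1; have : 0 <= k%:R * (x - 1) ^+ 2 :> R by rewrite mulr_ge0 // sqr_ge0.
  nra.
have x0 : 0 < x - 1 by lra.
have [k0 Bk] : exists k : nat, (B / (x - 1)) < k%:R.
  by exists (Num.bound `|B / (x - 1)|); apply: le_lt_trans (ler_norm _) _; exact: archi_boundP.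
exists k0 => // k /= kk; apply: le_trans (bern k); move: Bk; rewrite ltr_pdivrMr // => Bk.
have : k0%:R * (x - 1) <= k%:R * (x - 1) by rewrite ler_pM2r // ler_nat.
lra.
Qed.

Lemma iterates_bounded (f : C -> C) j s : (forall z, cdiff f z) ->
  exists M, forall i, (i < j)%N -> forall z, disc 0 s z -> N (iter i f z) <= M.
Proof.
move=> df; elim: j => [|j [M IH]]; first by exists 0.
have [M' HM'] := @cdisc_bound R (fun z => N (iter j f z)) 0 s
  (fun z _ => cdiff_contN (cdiff_iter j df z)).
exists (Num.max M M') => i; rewrite ltnS leq_eqVlt => /orP[/eqP -> z zs|ij z zs].
  by rewrite le_max; apply/orP; right; apply: le_trans (ler_norm _) (HM' z (ltW zs)).
by rewrite le_max IH.
Qed.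

(** Writing [n = q j + i] with [i < j], the iterate is one of finitely many bounded maps applied to
    a point of the disc, so Montel's theorem applies. *)
Lemma invariant_disc_fatou (f : C -> C) j s : (forall z, cdiff f z) -> (0 < j)%N ->
  (forall z, disc 0 s z -> disc 0 s (iter j f z)) -> disc 0 s `<=` fatou_set f.
Proof.
move=> df j0 inv z zs; have [M HM] := iterates_bounded j s df.
have invk k w : disc 0 s w -> disc 0 s (iter (k * j) f w).
  by elim: k => [//|k IH] ws; rewrite mulSn iterD; apply: inv; exact: IH.
have [d d0 D] := open_disc (@disc_open R 0 s) zs.
apply: (@fatou_of_bounded R f z (d / 3) M df); first by rewrite divr_gt0.
move=> n w; rewrite mulrC divfK // => /D ws.
rewrite (divn_eq n j) addnC iterD; apply: HM; first by rewrite ltn_mod.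
exact: invk.
Qed.

(** * The components visited by the orbit *)

Variables (f : C -> C) (U : set C) (z0 : C) (a_ b_ : nat -> R).
Hypothesis df : forall z, cdiff f z.
Hypothesis nc : nonconstant f.
Hypothesis Uwd : wandering_domain f U.
Hypothesis Uz0 : U z0.

Definition orbit_pt n := iter n f z0.
Definition orbit_log n := ln (N (orbit_pt n)).
Definition orbit_comp n := connected_component (fatou_set f) (orbit_pt n).
Local Notation Z := orbit_pt.
Local Notation l := orbit_log.
Local Notation Q := orbit_comp.

Lemma domainE : U = Q 0.
Proof.
case: Uwd => [[z Fz UE] _]; rewrite UE /orbit_comp.
by apply: same_connected_component; move: Uz0; rewrite UE.
Qed.

Lemma orbit_fatou n : fatou_set f (Z n).
Proof.
elim: n => [|n IH]; last by apply: fatou_forward.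
by move: Uz0; rewrite domainE => /connected_component_sub.
Qed.

Lemma comp_self n : Q n (Z n).
Proof. by apply: connected_component_refl; exact: orbit_fatou. Qed.

Lemma comp_fatou n z : Q n z -> fatou_set f z.
Proof. exact: connected_component_sub. Qed.

Lemma comp_open n : open (Q n).
Proof. by apply: component_open; exact: fatou_open. Qed.

Lemma comp_connected n : connected (Q n).
Proof. exact: component_connected. Qed.

Lemma fatou_iterate j z : fatou_set f z -> fatou_set f (iter j f z).
Proof. by elim: j => [//|j IH] h; apply: fatou_forward => //; exact: IH. Qed.

Lemma comp_map j n z : Q n z -> Q (n + j) (iter j f z).
Proof.
move=> Qz; have cI : connected (iter j f @` Q n).
  apply: connected_continuous_connected; first exact: comp_connected.
  by apply: continuous_subspaceT => w; apply: cdiff_cont; exact: cdiff_iter.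
have sub := @connected_component_max _ (fatou_set f) (iter j f @` Q n) (Z (n + j)).
apply: (sub _ _ cI); last by exists z.
  by exists (Z n); [exact: comp_self|rewrite /orbit_pt addnC iterD].
by move=> _ [w Qw <-]; apply: fatou_iterate; exact: comp_fatou Qw.
Qed.

Lemma fatou_iterE n : fatou_iter f U n = Q n.
Proof.
have im : iter n f @` U `<=` Q n.
  by move=> _ [z Uz <-]; rewrite -[n in Q n]add0n; apply: comp_map; rewrite -domainE.
apply/seteqP; split=> [z [V [[p Fp ->] VU] Vz]|z Qz].
  have /VU Vn : (iter n f @` U) (Z n) by exists z0.
  by rewrite /orbit_comp -(same_connected_component Vn).
by exists (Q n) => //; split => //; exists (Z n) => //; exact: orbit_fatou.
Qed.

(** If [Q n] met [Q m], the two would coincide and the sequence of components would have period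
    [m - n] from [n] on. *)
Lemma comp_disjoint n m z : n != m -> Q n z -> Q m z -> False.
Proof.
wlog nm : n m / (n < m)%N.
  by move=> H nm Qn Qm; case: (ltngtP n m) => h; [exact: H h nm Qn Qm|apply: (H m n h _ Qm Qn); rewrite eq_sym|rewrite h eqxx in nm].
move=> _ Qn Qm; case: Uwd => _; apply; exists n, (m - n)%N; split; first by rewrite subn_gt0.
have QE : Q n = Q m.
  rewrite /orbit_comp (same_connected_component Qn); symmetry.
  exact: same_connected_component.
move=> k nk; rewrite !fatou_iterE; symmetry; apply: same_connected_component.
have -> : (k + (m - n) = m + (k - n))%N by rewrite addnBA ?(ltnW nm) // addnC addnBA.
have : Q n (Z m) by rewrite QE; exact: comp_self.
move/(comp_map (k - n)); rewrite subnKC // /orbit_pt -iterD addnC.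
by rewrite /orbit_comp.
Qed.

(** * The annuli in logarithmic scale and the growth of the orbit *)

Definition ring_lo n := a_ n * l n.
Definition ring_hi n := b_ n * l n.
Local Notation al := ring_lo.
Local Notation be := ring_hi.

Variables (n0 : nat) (a' b' : R).
Hypothesis a'1 : a' < 1.
Hypothesis b1 : 1 < b'.
Hypothesis Hn0 : forall n, (n0 <= n)%N -> [/\ 0 < l n, a_ n < a', b' < b_ n &
  annulus (expR (al n)) (expR (be n)) `<=` Q n].

Lemma log_pos n : (n0 <= n)%N -> 0 < l n.
Proof. by case/Hn0. Qed.

Lemma orbit_modulus n : (n0 <= n)%N -> N (Z n) = expR (l n).
Proof.
move=> /log_pos h; rewrite lnK // posrE lt0r N_ge0 andbT; apply/eqP => h0.
by move: h; rewrite /orbit_log h0 ln0 // ltxx.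
Qed.

Lemma ring_lo_lt n : (n0 <= n)%N -> al n < l n.
Proof. by case/Hn0 => l0 h _ _; rewrite /ring_lo gtr_pMl // (lt_trans h). Qed.

Lemma ring_hi_gt n : (n0 <= n)%N -> b' * l n < be n.
Proof. by case/Hn0 => l0 _ h _; rewrite /ring_hi ltr_pM2r. Qed.

Lemma log_lt_hi n : (n0 <= n)%N -> l n < be n.
Proof.
move=> h; apply: lt_trans (ring_hi_gt h); rewrite ltr_pMl ?log_pos //.
Qed.

Lemma ring_sub n w : (n0 <= n)%N -> expR (al n) < N w < expR (be n) -> Q n w.
Proof. by case/Hn0 => _ _ _ h /h. Qed.

(* Otherwise [f^(m - n)] maps a disc that contains both orbit points into itself,
   so that this disc lies in the Fatou set. *)
Lemma hi_le_log n m : (n0 <= n)%N -> (n < m)%N -> be n <= l m.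
Proof.
move=> n0n nm; have n0m := leq_trans n0n (ltnW nm).
have neq : m != n by rewrite neq_ltn nm orbT.
have an := ring_lo_lt n0n; have bn := log_lt_hi n0n.
rewrite leNgt; apply/negP => lt.
have dis z : Q m z -> annulus (expR (al n)) (expR (be n)) z -> False.
  by move=> Qm /(ring_sub n0n) Qn; exact: (comp_disjoint neq Qm Qn).
have ab : expR (al n) < expR (be n) by rewrite ltr_expR; lra.
have inside : forall z, Q m z -> N z <= expR (al n).
  apply: (connected_inside (@comp_connected m) ab dis (comp_self m)).
  by rewrite orbit_modulus // ltr_expR.
pose s := expR ((l n + be n) / 2).
have s0 : 0 < s by exact: expR_gt0.
have as_ : expR (al n) < s by rewrite ltr_expR; lra.
pose j := (m - n)%N; have mE : m = (n + j)%N by rewrite subnKC // ltnW.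
have bnd z : disc 0 s z -> N (iter j f z) <= expR (al n).
  apply: (max_modulus (M := s)) => //.
  - exact: disc_open.
  - by move=> w; rewrite /disc /= subr0 => /ltW.
  - exact: cdiff_iter.
  - exact: expR_gt0.
  move=> w /(frontier_disc s0); rewrite subr0 => ws.
  apply: inside; rewrite mE; apply: comp_map; apply: ring_sub => //.
  by rewrite ws as_ /= ltr_expR; lra.
have sub : disc 0 s `<=` fatou_set f.
  apply: (@invariant_disc_fatou f j s df); first by rewrite subn_gt0.
  by move=> z /bnd h; rewrite /disc /= subr0; apply: le_lt_trans h as_.
have Zn : disc 0 s (Z n) by rewrite /disc /= subr0 orbit_modulus // ltr_expR; lra.
have Zm : disc 0 s (Z m).
  by rewrite /disc /= subr0; apply: le_lt_trans (inside _ (comp_self m)) as_.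
apply: (comp_disjoint neq (comp_self m)).
by apply: connected_component_max Zm => //; exact: connected_disc.
Qed.

Lemma hi_le_lo n m : (n0 <= n)%N -> (n < m)%N -> be n <= al m.
Proof.
move=> n0n nm; have n0m := leq_trans n0n (ltnW nm).
have an := ring_lo_lt n0n; have bn := log_lt_hi n0n.
have am := ring_lo_lt n0m; have bm := log_lt_hi n0m.
have bl := hi_le_log n0n nm.
rewrite leNgt; apply/negP => lt.
(* If the annuli overlapped, [exp x] would belong to both. *)
pose x := (Num.max (al m) (al n) + be n) / 2.
have mx : Num.max (al m) (al n) < be n by rewrite gt_max lt /=; lra.
have m1 : al m <= Num.max (al m) (al n) by rewrite le_max lexx.
have m2 : al n <= Num.max (al m) (al n) by rewrite le_max lexx orbT.
have NE : N ((expR x)%:C : C) = expR x by rewrite NC ger0_norm // expR_ge0.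
apply: (@comp_disjoint n m (expR x)%:C); first by rewrite neq_ltn nm.
  by apply: ring_sub => //; rewrite NE !ltr_expR /x; apply/andP; split; lra.
by apply: ring_sub => //; rewrite NE !ltr_expR /x; apply/andP; split; lra.
Qed.

Lemma log_growth n k : (n0 <= n)%N -> b' ^+ k * l n <= l (n + k).
Proof.
move=> n0n; have b1' := b1; elim: k => [|k IH]; first by rewrite mul1r addn0.
have n0k : (n0 <= n + k)%N by rewrite (leq_trans n0n) // leq_addr.
have := hi_le_log n0k (leqnn (n + k).+1); rewrite addnS; apply: le_trans.
apply: le_trans (ltW (ring_hi_gt n0k)); rewrite exprS -mulrA ler_pM2l //; lra.
Qed.

Lemma log_infty (B : R) : \forall n \near \oo, B <= l n.
Proof.
have l0 := log_pos (leqnn n0); have b1' := b1.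
have [k _ /(_ k (leqnn k)) Hk0] := expr_infty (B / l n0) b1.
have Hk : B <= b' ^+ k * l n0 by rewrite -ler_pdivrMr.
exists (n0 + k)%N => // n /= nk.
have -> : n = (n0 + k + (n - (n0 + k)))%N by rewrite subnKC.
have h1 : (n0 <= n0 + k)%N by exact: leq_addr.
apply: le_trans Hk _; apply: le_trans (log_growth k (leqnn n0)) _.
apply: le_trans (log_growth (n - (n0 + k)) h1).
rewrite ler_peMl ?(ltW (log_pos h1)) // exprn_ege1 //; lra.
Qed.

Lemma comp_le n m z : (n0 <= n)%N -> (n < m)%N -> Q n z -> N z <= expR (al m).
Proof.
move=> n0n nm; have n0m := leq_trans n0n (ltnW nm).
have h1 := hi_le_lo n0n nm; have h2 := log_lt_hi n0n.
have h3 := ring_lo_lt n0m; have h4 := log_lt_hi n0m.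
apply: (@connected_inside (Q n) _ (expR (be m)) (Z n)).
- exact: comp_connected.
- by rewrite ltr_expR; lra.
- by move=> w Qn /(ring_sub n0m) Qm; apply: (@comp_disjoint n m w) => //; rewrite neq_ltn nm.
- exact: comp_self.
by rewrite orbit_modulus // ltr_expR; lra.
Qed.

Lemma comp_ge n m z : (n0 <= n)%N -> (n < m)%N -> Q m z -> expR (be n) <= N z.
Proof.
move=> n0n nm; have n0m := leq_trans n0n (ltnW nm).
have h1 := hi_le_log n0n nm; have h2 := log_lt_hi n0n.
have h3 := ring_lo_lt n0n.
apply: (@connected_outside (Q m) (expR (al n)) _ (Z m)).
- exact: comp_connected.
- by rewrite ltr_expR; lra.
- by move=> w Qm /(ring_sub n0n) Qn; apply: (@comp_disjoint n m w) => //; rewrite neq_ltn nm.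
- exact: comp_self.
by rewrite orbit_modulus // ltr_expR; lra.
Qed.

(** Nothing relates the modulus of [z0] to the annulus of index [n0], so an annulus of later index
    that surrounds [z0] is used. *)
Lemma domain_bounded : exists M, forall z, U z -> N z <= M.
Proof.
have [n _ Hn] := log_infty (`|l 0| + 1).
pose m := (maxn n n0).+1.
have nm : (n <= maxn n n0)%N by rewrite leq_maxl.
have n0m : (n0 <= maxn n n0)%N by rewrite leq_maxr.
have n0m' : (n0 <= m)%N by rewrite (leq_trans n0m).
have h1 := hi_le_lo n0m (leqnn m); have h2 := log_lt_hi n0m.
have h3 := ring_lo_lt n0m'; have h4 := log_lt_hi n0m'.
have h5 := Hn _ nm; have h6 := ler_norm (l 0).
exists (expR (al m)); rewrite domainE.
apply: (@connected_inside (Q 0) _ (expR (be m)) (Z 0)).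
- exact: comp_connected.
- by rewrite ltr_expR; lra.
- by move=> w Q0 /(ring_sub n0m') Qm; apply: (@comp_disjoint 0 m w).
- exact: comp_self.
have [z00|z00] := eqVneq (N (Z 0)) 0; first by rewrite z00 expR_gt0.
rewrite -[N _]lnK ?posrE ?lt0r ?z00 ?N_ge0 // ltr_expR.
rewrite -/(l 0); lra.
Qed.

Lemma comp_big n z : (n0 < n)%N -> Q n z -> 1 < N z.
Proof.
move=> hn Qz; apply: lt_le_trans (comp_ge (leqnn n0) hn Qz).
by rewrite -expR0 ltr_expR; have := log_pos (leqnn n0); have := log_lt_hi (leqnn n0); lra.
Qed.

Lemma iter_comp n z : U z -> Q n (iter n f z).
Proof. by rewrite domainE => /(comp_map n). Qed.

Lemma iter_big n z : (n0 < n)%N -> U z -> 1 < N (iter n f z).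
Proof. by move=> hn Uz; apply: (comp_big hn); exact: iter_comp. Qed.

Lemma domain_open : open U.
Proof. by rewrite domainE; exact: comp_open. Qed.

(** * The quotients and their locally uniform limit *)

Definition log_quot n z := ln (N (iter n f z)) / l n.
Local Notation u := log_quot.

Lemma log_quot_mvp n : (n0 < n)%N -> mvp U (u n).
Proof.
move=> hn; have E z : (l n)^-1 * ln (N (iter n f z)) = u n z by rewrite mulrC.
apply: near_mvp (fun z _ => E z) _; first exact: domain_open.
apply: mvpZ; first exact: domain_open.
apply: lnN_mvp; [exact: domain_open|by move=> z _; exact: cdiff_iter|].
by move=> z Uz; rewrite -N_gt0; apply: lt_trans (iter_big hn Uz).
Qed.

Lemma log_quot_gt0 n z : (n0 < n)%N -> U z -> 0 < u n z.
Proof.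
by move=> hn Uz; rewrite divr_gt0 ?log_pos ?(ltnW hn) // ln_gt0 // (iter_big hn Uz).
Qed.

Lemma log_quot_cont n z : iter n f z != 0 -> {for z, continuous (u n)}.
Proof.
move=> h; apply: (@cvgM _ _ (nbhs z) (nbhs_filter z)); last exact: cvg_cst.
by apply: cont_lnN => //; exact: cdiff_iter.
Qed.

Variable h : C -> R.
Hypothesis h_lim : forall z, U z -> (fun n => u n z) @ \oo --> h z.

Lemma limit_le z (x : R) : U z -> (\forall n \near \oo, u n z <= x) -> h z <= x.
Proof.
move=> Uz H; apply/ler_addgt0Pr => e e0.
have /(@cvgrPdist_lt _ _ _ _ eventually_filter) /(_ e e0) lz := h_lim Uz.
have [n [h1 h2]] := filter_ex (filterI H lz).
by move: h2; rewrite ltr_norml => /andP[_]; lra.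
Qed.

Lemma limit_ge z (x : R) : U z -> (\forall n \near \oo, x <= u n z) -> x <= h z.
Proof.
move=> Uz H; apply/ler_addgt0Pr => e e0.
have /(@cvgrPdist_lt _ _ _ _ eventually_filter) /(_ e e0) lz := h_lim Uz.
have [n [h1 h2]] := filter_ex (filterI H lz).
by move: h2; rewrite ltr_norml => /andP[+ _]; lra.
Qed.

(** Harnack's inequality bounds [u n] on a disc by three times its value at the centre, which
    converges; [mvp_limit] then applies. *)
Lemma limit_local c : U c -> exists r, [/\ 0 < r, cdisc c r `<=` U, mvp (disc c r) h &
  forall e, 0 < e -> \forall n \near \oo, forall z, cdisc c r z -> `|u n z - h z| <= e].
Proof.
move=> Uc; have [d d0 D] := open_disc domain_open Uc.
pose r := d / 7; have r0 : 0 < r by rewrite divr_gt0.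
have r6 : 0 < 6 * r by rewrite mulr_gt0.
have sub : cdisc c (6 * r) `<=` U.
  by move=> z; rewrite /cdisc /= => hz; apply: D; rewrite /disc /=; rewrite /r in hz; lra.
have sub3 : disc c (3 * r) `<=` U.
  by move=> z hz; apply: sub; move: hz; rewrite /disc /cdisc /=; lra.
have ev : \forall n \near \oo, mvp (disc c (3 * r)) (u n) /\
    forall z, disc c (3 * r) z -> `|u n z| <= 3 * (h c + 1).
  have /(@cvgrPdist_lt _ _ _ _ eventually_filter) /(_ 1 ltr01) lc := h_lim Uc.
  near=> n; have hn : (n0 < n)%N by near: n; exact: nbhs_infty_gt.
  have mn := log_quot_mvp hn; split; first exact: mvp_sub sub3 mn.
  move=> z hz; rewrite ger0_norm; last by apply/ltW/log_quot_gt0 => //; exact: sub3.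
  have : u n c / 3 <= u n z <= 3 * u n c.
    apply: (harnack_half r6).
    - by move=> w /sub Uw; case: (mn w Uw).
    - by apply: mvp_sub mn => w /ltW; exact: sub.
    - by move=> w /sub Uw; apply/ltW/log_quot_gt0.
    by move: hz; rewrite /disc /=; lra.
  have : `|h c - u n c| < 1 by near: n.
  by rewrite ltr_norml => /andP[? ?] /andP[? ?]; lra.
have [h1 h2] := mvp_limit (x := h) eventually_filter r0 ev (fun z hz => h_lim (sub3 z hz)).
exists r; split => //.
by move=> z hz; apply: sub; move: hz; rewrite /cdisc /=; lra.
Unshelve. all: by end_near. Qed.

Lemma limit_mvp : mvp U h.
Proof.
apply: mvp_local => c Uc; have [r [r0 _ mh _]] := limit_local Uc; exists (disc c r) => //.
by split; [exact: disc_open|exact: disc_center].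
Qed.

Lemma limit_cont z : U z -> {for z, continuous h}.
Proof. by move=> /limit_mvp[]. Qed.

Lemma limit_compact K (e : R) : compact K -> K `<=` U -> 0 < e ->
  \forall n \near \oo, forall z, K z -> `|u n z - h z| <= e.
Proof.
move=> cK KU e0; have /compact_near_coveringP nK := cK.
apply: (nK nat \oo (fun n z => `|u n z - h z| <= e)) => z /KU Uz.
have [r [r0 _ _ H]] := limit_local Uz.
exists (disc z r, [set n | forall z', cdisc z r z' -> `|u n z' - h z'| <= e]) => /=.
  by split; [exact: near_disc|exact: H].
by move=> [w n] /= [zw]; apply; exact: ltW.
Qed.

(** * Comparison of the limit with a single quotient *)

Definition distortion (La : R) := (La + 8) / (La - 8).
Local Notation kap := distortion.

(* [ln (N (iter j f (cexp zeta)))] is positive and harmonic in a disc of radius [La]. *)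
Lemma harnack_circle m j x La w1 w2 : (n0 < m)%N -> 8 < La -> al m < x - La -> x + La < be m ->
  N w1 = expR x -> N w2 = expR x ->
  ln (N (iter j f w2)) <= kap La * ln (N (iter j f w1)).
Proof.
move=> n0m La8 xl xh Nw1 Nw2.
have w10 : w1 != 0 by rewrite -N_gt0 Nw1 expR_gt0.
have w20 : w2 != 0 by rewrite -N_gt0 Nw2 expR_gt0.
have [t1 ht1 E1] := polar w10; have [t2 ht2 E2] := polar w20.
rewrite Nw1 expRK in E1; rewrite Nw2 expRK in E2.
pose g zeta := iter j f (cexp zeta).
have dg zeta : cdiff g zeta by apply: cdiff_comp; [exact: cdiff_cexp|exact: cdiff_iter].
have big zeta : cdisc (x +i* t1) La zeta -> 1 < N (g zeta).
  rewrite /cdisc /= => hz; apply: (@comp_big (m + j)); first by rewrite ltn_addr.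
  apply: comp_map; apply: ring_sub; first exact: ltnW.
  rewrite N_cexp !ltr_expR.
  have := le_trans (Re_le_N (zeta - (x +i* t1))) hz.
  by rewrite ReD ReN [Re (x +i* t1)]/= ler_norml => /andP[? ?]; apply/andP; split; lra.
have La0 : 0 < La by lra.
pose v zeta := ln (N (g zeta)).
have gn zeta : cdisc (x +i* t1) La zeta -> g zeta != 0.
  by move=> /big hz; rewrite -N_gt0; lra.
have dsub : disc (x +i* t1) La `<=` cdisc (x +i* t1) La by move=> z /ltW.
(* Both arguments lie in [[- pi, pi]] and [pi < 4]; hence the 8 in [distortion], which is Harnack's
   factor at that distance from the centre. *)
have dist : N ((x +i* t2) - (x +i* t1)) <= 8.
  apply: le_trans (N_le_ReIm _) _; rewrite ReD ReN ImD ImN [Re _]/= [Re (x +i* t1)]/= [Im _]/= [Im (x +i* t1)]/=.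
  rewrite subrr normr0 add0r.
  have := ler_normB t2 t1; have /andP[_] := pihalf_02 R.
  by rewrite ltr_pdivrMr //; lra.
have := @harnack R v (x +i* t1) La La0 _ (x +i* t2).
have cv z : cdisc (x +i* t1) La z -> {for z, continuous v} by move=> hz; apply: cont_lnN => //; exact: gn.
move/(_ cv).
have mv : mvp (disc (x +i* t1) La) v.
  by apply: lnN_mvp => [||z /dsub]; [exact: disc_open|by []|exact: gn].
have v0 z : cdisc (x +i* t1) La z -> 0 <= v z by move=> /big hz; apply: ln_ge0; exact: ltW.
have hd : disc (x +i* t1) La (x +i* t2) by exact: le_lt_trans dist La8.
move/(_ mv v0 hd) => /andP[_].
set d := N _ in dist hd *; have d0 : 0 <= d := N_ge0 _.
rewrite /v /g -E1 -E2 => h1; apply: le_trans h1 _.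
have c1 : cdisc (x +i* t1) La (x +i* t1) by apply: dsub; exact: disc_center.
apply: ler_wpM2r; first by have := v0 _ c1; rewrite /v /g -E1.
have La8' : 0 < La - 8 by lra.
have Lad : 0 < La - d by lra.
rewrite /distortion ler_pdivrMr // mulrAC ler_pdivlMr //.
nra.
Qed.

(** A bound, uniform in [j], for the ratio of [l (n0 + j).+1] to [l (m + j)]. The successor of [n0]
    occurs because [Q (n0 + j)] is only bounded by the annulus of the next index. *)
Definition decay m := (b' ^+ (m - n0.+1))^-1.
Local Notation del := decay.

Lemma decay_gt0 m : 0 < del m.
Proof. by rewrite invr_gt0 exprn_gt0 // (lt_trans ltr01 b1). Qed.

Lemma kap_ge1 La : 8 < La -> 1 <= kap La.
Proof. by move=> h8; rewrite /distortion ler_pdivlMr; lra. Qed.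

(* Three circles theorem between the circle through [w1] and the fixed circle of
   radius [expR (l n0)], which [f^j] maps into [orbit_comp (n0 + j)]. *)
Lemma log_interpolation m j x La w1 y : (n0 < m)%N -> 8 < La -> al m < x - La -> x + La < be m ->
  N w1 = expR x -> expR (l n0) <= N y <= expR x ->
  ln (N (iter j f y)) <= l (m + j) * del m + kap La * ln (N (iter j f w1)) / x * ln (N y).
Proof.
move=> n0m La8 xl xh Nw1 /andP[y1 y2].
have l00 := log_pos (leqnn n0).
have x0 : l n0 < x.
  by have := hi_le_lo (leqnn n0) n0m; have := log_lt_hi (leqnn n0); lra.
have x0' : 0 < x by lra.
have k1 := kap_ge1 La8.
have G w : N w = expR x -> 1 < N (iter j f w).
  move=> Nw; apply: (@comp_big (m + j)); first by rewrite ltn_addr.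
  apply: comp_map; apply: ring_sub; first exact: ltnW.
  by rewrite Nw !ltr_expR; apply/andP; split; lra.
set be1 := _ / x; have be0 : 0 <= be1.
  rewrite divr_ge0 ?(ltW x0') // mulr_ge0 //; first lra.
  by apply: ln_ge0; apply/ltW/G.
have A0 : 0 < l (m + j) * del m.
  by rewrite mulr_gt0 ?decay_gt0 // log_pos // (leq_trans (ltnW n0m)) // leq_addr.
have y0 : 0 < N y by apply: lt_le_trans y1; exact: expR_gt0.
have := three_circles (p := 0) (s1 := expR (l n0)) (s2 := expR x) (A := l (m + j) * del m)
  (al := be1) (expR_gt0 _) (cdiff_iter j df) _ (z := y).
rewrite subr0 y1 y2 => H.
(* At a zero the left-hand side is [ln 0 = 0], and the right-hand side is nonnegative. *)
have [g0|g0] := eqVneq (N (iter j f y)) 0.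
  rewrite g0 ln0 //; apply: addr_ge0; first exact: ltW.
  apply: mulr_ge0 => //; rewrite -(expRK (l n0)) in l00.
  apply: le_trans (ltW l00) _; rewrite ler_ln // posrE expR_gt0 //.
rewrite -ler_expR lnK ?posrE ?lt0r ?g0 ?N_ge0 //; apply: H => // z; rewrite subr0.
case=> hz.
  rewrite hz expRK.
  have Qz : Q (n0 + j) (iter j f z).
    apply: comp_map; apply: ring_sub => //; rewrite hz !ltr_expR.
    by rewrite ring_lo_lt // log_lt_hi.
  have n0j : (n0 <= n0 + j)%N by exact: leq_addr.
  apply: le_trans (comp_le n0j (leqnn _) Qz) _; rewrite ler_expR.
  have n0j1 : (n0 <= (n0 + j).+1)%N by rewrite (leq_trans n0j).
  apply: le_trans (ltW (ring_lo_lt n0j1)) _.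
  apply: (@le_trans _ _ (l (m + j) * del m)); last by rewrite lerDl mulr_ge0 // ltW.
  rewrite /decay ler_pdivlMr ?exprn_gt0 ?(lt_trans ltr01 b1) // mulrC.
  apply: le_trans (log_growth _ n0j1) _.
  by rewrite -addSn addnAC subnKC // addnC.
rewrite hz expRK.
have h1 := harnack_circle j n0m La8 xl xh Nw1 hz.
rewrite -[N (iter j f z)]lnK ?posrE ?(lt_trans ltr01 (G z hz)) // ler_expR.
apply: le_trans h1 _; rewrite /be1 divfK ?gt_eqF //.
by rewrite lerDr ltW.
Qed.

Lemma iter_gt n z : (n0 < n)%N -> U z -> expR (l n0) <= N (iter n f z).
Proof.
move=> hn Uz; apply: le_trans (comp_ge (leqnn n0) hn (iter_comp n Uz)).
by rewrite ler_expR ltW // log_lt_hi.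
Qed.

Lemma log_quotK n z : (n0 < n)%N -> U z -> N (iter n f z) = expR (u n z * l n).
Proof.
move=> hn Uz; rewrite /log_quot divfK ?gt_eqF ?log_pos ?(ltnW hn) // lnK // posrE.
exact: lt_trans ltr01 (iter_big hn Uz).
Qed.

(** Interpolation along the circle through [Z m], evaluated at [f^m z]: on that circle the logarithm
    of [|f^(n - m)|] is compared with [l n]. Division by [l n] and [n] to infinity give the
    bound. *)
Lemma upper_bound m La z : (n0 < m)%N -> 8 < La -> al m < l m - La -> l m + La < be m ->
  U z -> u m z <= 1 -> h z <= del m + kap La * u m z.
Proof.
move=> n0m La8 xl xh Uz um; have lm := log_pos (ltnW n0m).
apply: limit_le => //; exists m => // n /= mn.
have := @log_interpolation m (n - m) (l m) La (Z m) (iter m f z) n0m La8 xl xh.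
rewrite orbit_modulus ?(ltnW n0m) // iter_gt //= log_quotK // ler_expR ler_piMl ?(ltW lm) //.
have E1 y : iter (n - m) f (iter m f y) = iter n f y by rewrite -iterD subnK.
move/(_ erefl isT); rewrite -log_quotK // [in iter _ f (Z m)]/orbit_pt !E1 subnKC //.
have ln_ : 0 < l n by rewrite log_pos // (leq_trans (ltnW n0m)).
rewrite -/(orbit_pt n) -/(l n) => H.
rewrite {1}/log_quot ler_pdivrMr //; apply: le_trans H _.
by rewrite le_eqVlt; apply/orP; left; apply/eqP; rewrite /log_quot; ring.
Qed.

(** The roles are exchanged: interpolation along the circle through [f^m z], evaluated at [Z m],
    bounds [l n] above in terms of [u n z]. *)
Lemma lower_bound m La z : (n0 < m)%N -> 8 < La -> U z -> 1 <= u m z ->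
  al m < u m z * l m - La -> u m z * l m + La < be m ->
  u m z * (1 - del m) <= kap La * h z.
Proof.
move=> n0m La8 Uz um xl xh; have lm := log_pos (ltnW n0m).
have k1 := kap_ge1 La8.
rewrite mulrC -ler_pdivrMl; last lra.
apply: limit_ge => //; exists m => // n /= mn.
rewrite ler_pdivrMl; last lra.
have := @log_interpolation m (n - m) (u m z * l m) La (iter m f z) (Z m) n0m La8 xl xh.
rewrite -log_quotK // orbit_modulus ?(ltnW n0m) // log_quotK // !ler_expR ler_peMl ?(ltW lm) //.
rewrite expRK.
have l1 : l n0 <= l m.
  by have := hi_le_log (leqnn n0) n0m; have := log_lt_hi (leqnn n0); lra.
have E1 y : iter (n - m) f (iter m f y) = iter n f y by rewrite -iterD subnK.
rewrite l1 => /(_ erefl isT); rewrite [in iter _ f (Z m)]/orbit_pt !E1 subnKC //.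
have ln_ : 0 < l n by rewrite log_pos // (leq_trans (ltnW n0m)).
rewrite -/(orbit_pt n) -/(l n) => H.
have E : ln (N (iter n f z)) = u n z * l n by rewrite /log_quot divfK // gt_eqF.
rewrite E in H.
have um0 : 0 < u m z by lra.
rewrite -(ler_pM2r ln_).
have H2 : u m z * l n <= u m z * (l n * del m) + kap La * (u n z * l n).
  apply: le_trans (ler_wpM2l (ltW um0) H) _; rewrite mulrDr lerD2l.
  by rewrite le_eqVlt; apply/orP; left; apply/eqP; field; rewrite gt_eqF // gt_eqF.
lra.
Qed.

Lemma orbit_quot n : (n0 <= n)%N -> u n z0 = 1.
Proof. by move=> /log_pos h1; rewrite /log_quot divff // gt_eqF. Qed.

Lemma limit_z0 : h z0 = 1.
Proof.
apply/eqP; rewrite eq_le; apply/andP; split.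
  by apply: limit_le => //; exists n0 => // n /= /orbit_quot ->.
by apply: limit_ge => //; exists n0 => // n /= /orbit_quot ->.
Qed.

Lemma decay_small (e : R) : 0 < e -> \forall m \near \oo, del m <= e.
Proof.
move=> e0; have [k _ Hk] := expr_infty e^-1 b1.
exists (n0.+1 + k)%N => // m /= hm; rewrite /decay -[e]invrK lef_pV2 ?posrE ?invr_gt0 ?exprn_gt0 ?(lt_trans ltr01 b1) //.
by apply: Hk => /=; rewrite leq_subRL // (leq_trans _ hm) // leq_addr.
Qed.

Lemma distortion_small (c0 e : R) : 0 < c0 -> 0 < e ->
  \forall m \near \oo, 8 < l m * c0 /\ kap (l m * c0) - 1 <= e.
Proof.
move=> c00 e0; apply: filterS (log_infty ((9 + 16 / e) / c0)) => m.
rewrite ler_pdivrMr // => hm; have q0 : 0 < 16 / e by rewrite divr_gt0.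
split; first lra.
have d0 : 0 < l m * c0 - 8 by lra.
have -> : kap (l m * c0) - 1 = 16 / (l m * c0 - 8).
  rewrite /distortion; move: d0; generalize (l m * c0) => x d0; field; rewrite gt_eqF //; lra.
rewrite ler_pdivrMr // mulrC -ler_pdivrMr //; lra.
Qed.

Lemma upper_eps (e : R) : 0 < e ->
  \forall m \near \oo, forall z, U z -> u m z <= 1 -> h z <= u m z + e.
Proof.
(* Harnack's disc has radius [c0 * l m]: it fits into the annulus on both sides of [l m], and its
   radius tends to infinity. *)
move=> e0; pose c0 := Num.min (1 - a') (b' - 1).
have c00 : 0 < c0 by rewrite lt_min !subr_gt0 a'1 b1.
have c1 : c0 <= 1 - a' by rewrite ge_min lexx.
have c2 : c0 <= b' - 1 by rewrite ge_min lexx orbT.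
have e2 : 0 < e / 2 by rewrite divr_gt0.
near=> m => z Uz um.
have hm : (n0 < m)%N by near: m; exact: nbhs_infty_gt.
have [l0 ha hb _] := Hn0 (ltnW hm).
have [k1 k2] : 8 < l m * c0 /\ kap (l m * c0) - 1 <= e / 2 by near: m; exact: distortion_small.
have d1 : del m <= e / 2 by near: m; exact: decay_small.
have lc1 : l m * c0 <= l m * (1 - a') by rewrite ler_pM2l.
have lc2 : l m * c0 <= l m * (b' - 1) by rewrite ler_pM2l.
have ala : al m < a' * l m by rewrite /ring_lo ltr_pM2r.
have bbe := ring_hi_gt (ltnW hm).
have H := @upper_bound m (l m * c0) z hm k1 _ _ Uz um.
have {}H : h z <= del m + kap (l m * c0) * u m z by apply: H; lra.
have u0 := log_quot_gt0 hm Uz.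
have : (kap (l m * c0) - 1) * u m z <= e / 2 * 1.
  apply: ler_pM => //; last exact: ltW.
  by rewrite subr_ge0 kap_ge1.
lra.
Unshelve. all: by end_near. Qed.

Lemma lower_eps (x eta e : R) : 1 <= x -> 0 < eta -> 0 < e ->
  \forall m \near \oo, x + eta <= b_ m -> forall z, U z -> u m z = x -> x <= h z + e.
Proof.
move=> x1 eta0 e0; pose c0 := Num.min (1 - a') (eta / 2).
have c00 : 0 < c0 by rewrite lt_min subr_gt0 a'1 divr_gt0.
have c1 : c0 <= 1 - a' by rewrite ge_min lexx.
have c2 : c0 <= eta / 2 by rewrite ge_min lexx orbT.
have x0 : 0 < x by lra.
have e2 : 0 < e / 2 / x by rewrite !divr_gt0.
near=> m => bm z Uz um.
have hm : (n0 < m)%N by near: m; exact: nbhs_infty_gt.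
have [l0 ha hb _] := Hn0 (ltnW hm).
have [k1 k2] : 8 < l m * c0 /\ kap (l m * c0) - 1 <= e / 2 / x by near: m; exact: distortion_small.
have d1 : del m <= e / 2 / x by near: m; exact: decay_small.
have lc1 : l m * c0 <= l m * (1 - a') by rewrite ler_pM2l.
have lc2 : l m * c0 <= l m * (eta / 2) by rewrite ler_pM2l.
have ala : al m < a' * l m by rewrite /ring_lo ltr_pM2r.
have xl : l m <= x * l m by rewrite ler_peMl // ltW.
have bl : (x + eta) * l m <= be m by rewrite /ring_hi ler_pM2r.
have le0 : 0 < eta * l m by rewrite mulr_gt0.
have H := @lower_bound m (l m * c0) z hm k1 Uz; rewrite um in H.
have {}H : x * (1 - del m) <= kap (l m * c0) * h z by apply: H => //; lra.
(* When [h z < x], replacing [kap * h z] by [h z] costs at most [(kap - 1) * x]. *)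
have [//|hx] := leP x (h z); first lra.
have hz0 : 0 <= kap (l m * c0) - 1 by rewrite subr_ge0 kap_ge1.
have k3 : (kap (l m * c0) - 1) * h z <= (kap (l m * c0) - 1) * x by rewrite ler_wpM2l // ltW.
have k4 : (kap (l m * c0) - 1) * x <= e / 2 by rewrite -ler_pdivlMr.
have d2 : del m * x <= e / 2 by rewrite -ler_pdivlMr.
lra.
Unshelve. all: by end_near. Qed.

(* If the values [c] of [h] were not locally constant near [p], the branches of
   [log f^n / l n] would take the values that [orbit_comp n] omits. *)
Lemma level_local p (c : R) (cn : nat -> R) : U p -> h p = c -> cn @ \oo --> c ->
  (\forall n \near \oo, exists2 zeta, N zeta = expR (cn n * l n) & ~ Q n zeta) ->
  \forall y \near p, h y = c.
Proof.
move=> Up hp cnc Hz; have [r [r0 rU _ Hr]] := limit_local Up.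
have [Mh HMh] := @cdisc_bound R h p r (fun z hz => limit_cont (rU z hz)).
have r8 : 0 < r / 8 by rewrite divr_gt0.
apply: filterS (near_disc p r8) => y yr.
have pp : cdisc p r p by rewrite /cdisc /= subrr N0 ltW.
have yy : cdisc p r y by move: yr; rewrite /disc /cdisc /=; lra.
pose M := Mh + 1; pose B := 10 * M + (`|c| + 2).
have M0 : 0 <= M by have := HMh p pp; have := normr_ge0 (h p); rewrite /M; lra.
have B0 : 0 < 2 * B by rewrite /B; have := normr_ge0 c; lra.
apply: eq_eps => e e0; have e3 : 0 < e / 3 by rewrite divr_gt0.
pose K := ln (2 * B) - ln (e / 3).
have eK : 2 * B * expR (- K) = e / 3.
  by rewrite /K opprB expRD expRN !lnK ?posrE // mulrCA divff ?mulr1 // gt_eqF.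
(* A third of the tolerance of [omit_log_value], for the errors [u n p - h p], [c - cn n] and
   [pi / l n]. *)
pose d := 2 * B * expR (- (3 * K)) / 3.
have d0 : 0 < d by rewrite divr_gt0 // mulr_gt0 // expR_gt0.
pose d' := Num.min d (Num.min 1 (e / 3)).
have d'0 : 0 < d' by rewrite !lt_min d0 ltr01.
have [d1 d2 d3] : [/\ d' <= d, d' <= 1 & d' <= e / 3] by split; rewrite !ge_min lexx ?orbT.
have cn1 : \forall n \near \oo, `|c - cn n| < d'.
  by move/(@cvgrPdist_lt _ _ _ _ eventually_filter): cnc; apply.
have lp : \forall n \near \oo, Num.max pi (pi / d) <= l n by exact: log_infty.
have big : \forall n \near \oo, (n0 < n)%N by exact: nbhs_infty_gt.
have [n [[[hn hl] hd] [hc [zeta Nz nQ]]]] :=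
  filter_ex (filterI (filterI (filterI big lp) (Hr d' d'0)) (filterI cn1 Hz)).
move: hl; rewrite ge_max => /andP[hl1 hl2].
have ln0 : 0 < l n by rewrite log_pos // ltnW.
have cE : ln (N zeta) / l n = cn n by rewrite Nz expRK mulfK // gt_eqF.
have H := @omit_log_value R (iter n f) p r (l n) M B zeta K y r0 hl1 (cdiff_iter n df).
rewrite cE eK in H.
have hcn : `|cn n| <= `|c| + 1.
  by have := ler_normB c (c - cn n); rewrite opprB addrC subrK; lra.
have {}H : `|u n y - cn n| <= e / 3.
  apply: H.
  - by move=> z /rU Uz; rewrite -N_gt0; exact: lt_trans ltr01 (iter_big hn Uz).
  - move=> z hz; have := hd z hz; have := HMh z hz.
    by have := ler_normD (u n z - h z) (h z); rewrite subrK /M /log_quot; lra.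
  - by rewrite -N_gt0 Nz expR_gt0.
  - by move=> z /rU Uz zE; apply: nQ; rewrite -zE; exact: iter_comp.
  - by rewrite /B; have := normr_ge0 c; lra.
  - by rewrite /B; lra.
  - have := hd p pp; rewrite hp => h1.
    have h2 : pi / l n <= d by rewrite ler_pdivrMr // mulrC -ler_pdivrMr.
    have h3 := ler_normD (u n p - c) (c - cn n); rewrite addrA subrK in h3.
    have -> : 2 * B * expR (- (3 * K)) = 3 * d by rewrite /d; field.
    by rewrite -/(u n p); lra.
  by apply: ltW.
have h1 := hd y yy.
have h2 := ler_normD (h y - u n y) (u n y - c); rewrite addrA subrK in h2.
have h3 := ler_normD (u n y - cn n) (cn n - c); rewrite addrA subrK in h3.
have h4 := distrC (h y) (u n y); have h5 := distrC c (cn n); lra.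
Qed.

(** If the value [c] were taken, [level_local] would make its level set clopen in [U], against
    [h z0 = 1]. *)
Lemma level_omitted (c : R) (cn : nat -> R) z : c != 1 -> cn @ \oo --> c ->
  (\forall n \near \oo, exists2 zeta, N zeta = expR (cn n * l n) & ~ Q n zeta) -> U z -> h z <> c.
Proof.
move=> c1 cnc Hz Uz hz; have cU : connected U by rewrite domainE; exact: comp_connected.
have sub : U `<=` [set z | h z = c].
  apply: (connected_clopen (P := fun z => h z = c)) => //; first by exists z.
    by move=> w Uw hw; apply: filterS (level_local Uw hw cnc Hz) => y.
  move=> w Uw hw; have p0 : 0 < `|h w - c| by rewrite normr_gt0 subr_eq0; apply/eqP.
  have [d d0 D] := (contC _ _).1 (limit_cont Uw) _ p0.
  apply: filterS (near_disc w d0) => y /D + _ hy.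
  by rewrite hy distrC ltxx.
by move: (sub _ Uz0); rewrite /= limit_z0 => E; rewrite -E eqxx in c1.
Qed.

(** By compactness the points off [G] with modulus between [s / 2] and [s] have a greatest modulus,
    which is less than [s]. *)
Lemma ring_inward (G : set C) s : open G -> 0 < s -> (forall z, N z = s -> G z) ->
  exists2 t, 0 < t < s & forall z, t < N z <= s -> G z.
Proof.
move=> oG s0 circ.
pose K := (cdisc 0 s `&` ~` disc 0 (s / 2)) `&` ~` G.
have [[p0 Kp0]|none] := pselect (K !=set0); last first.
  exists (s / 2) => [|z /andP[h1 h2]]; first by apply/andP; split; lra.
  apply: contrapT => nG; apply: none; exists z; split => //.
  by split; rewrite /cdisc /disc /= subr0 //; apply/negP; rewrite -leNgt ltW.
have cK : compact K.
  apply: (@compactC R K s) => [|z [[+ _] _]]; last by rewrite /cdisc /= subr0.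
  apply: closedI; last exact: open_closedC.
  by apply: closedI; [exact: cdisc_closed|apply: open_closedC; exact: disc_open].
have [p [[p1 p2] p3] Hp] := compact_max cK (ex_intro _ p0 Kp0) (fun z _ => @continuous_N R z).
rewrite /cdisc /disc /= subr0 in p1 p2.
exists (N p) => [|z /andP[h1 h2]].
  apply/andP; split; first by move/negP: p2; rewrite -leNgt; lra.
  by rewrite lt_neqAle p1 andbT; apply/eqP => /circ.
apply: contrapT => nG; have : K z; last by move=> /Hp; lra.
split => //; split; rewrite /cdisc /disc /= subr0 //; apply/negP; rewrite -leNgt.
by move/negP: p2; rewrite -leNgt; lra.
Qed.

Lemma ring_outward (G : set C) s : open G -> 0 < s -> (forall z, N z = s -> G z) ->
  exists2 t, s < t & forall z, s <= N z < t -> G z.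
Proof.
move=> oG s0 circ.
pose K := (cdisc 0 (2 * s) `&` ~` disc 0 s) `&` ~` G.
have [[p0 Kp0]|none] := pselect (K !=set0); last first.
  exists (2 * s) => [|z /andP[h1 h2]]; first lra.
  apply: contrapT => nG; apply: none; exists z; split => //.
  by split; rewrite /cdisc /disc /= subr0 ?ltW //; apply/negP; rewrite -leNgt.
have cK : compact K.
  apply: (@compactC R K (2 * s)) => [|z [[+ _] _]]; last by rewrite /cdisc /= subr0.
  apply: closedI; last exact: open_closedC.
  by apply: closedI; [exact: cdisc_closed|apply: open_closedC; exact: disc_open].
have cN z : K z -> {for z, continuous (fun w : C => - N w)}.
  by move=> _; apply: (@cvgN _ _ _ (nbhs z) (nbhs_filter z)); exact: continuous_N.
have [p [[p1 p2] p3] Hp] := compact_max cK (ex_intro _ p0 Kp0) cN.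
rewrite /cdisc /disc /= subr0 in p1 p2.
move/negP: p2; rewrite -leNgt => p2.
exists (N p) => [|z /andP[h1 h2]].
  by rewrite lt_neqAle p2 andbT; apply/eqP => /esym /circ.
apply: contrapT => nG; have : K z; last by move=> /Hp; lra.
split => //; split; rewrite /cdisc /disc /= subr0; first lra.
by apply/negP; rewrite -leNgt.
Qed.

(** * Omitted values on the boundary of the maximal annuli *)

Hypothesis Hmax : forall n, (n0 <= n)%N ->
  maximal_annulus (Q n) (Z n) (expR (al n)) (expR (be n)).

Lemma NCpos (x : R) : 0 <= x -> N (x%:C : C) = x.
Proof. by move=> x0; rewrite NC ger0_norm. Qed.

Lemma annulusE s1 s2 z : annulus s1 s2 z = (s1 < N z < s2) :> Prop.
Proof. by []. Qed.

(** If the whole inner circle lay in the component, [ring_inward] would enlarge the annulus, against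
    its maximality. *)
Lemma omitted_lo n : (n0 <= n)%N -> exists2 zeta, N zeta = expR (al n) & ~ Q n zeta.
Proof.
move=> hn; apply: contrapT => none.
have circ z : N z = expR (al n) -> Q n z.
  by move=> Nz; apply: contrapT => nQ; apply: none; exists z.
have [t /andP[t0 ts] ht] := ring_inward (@comp_open n) (expR_gt0 _) circ.
have [/andP[s0 s12] ring _ mx] := Hmax hn.
have E : annulus t (expR (be n)) = annulus (expR (al n)) (expR (be n)).
  apply: mx => [|z /andP[h1 h2]|z /andP[h1 h2]].
  - by rewrite t0 (lt_trans ts s12).
  - by rewrite /annulus /= (lt_trans ts h1).
  have [h2'|h2'] := leP (N z) (expR (al n)); first by apply: ht; rewrite h1.
  by apply: ring; rewrite /annulus /= h2'.
have : annulus t (expR (be n)) ((expR (al n))%:C : C).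
  by rewrite annulusE NCpos ?expR_ge0 // ts.
by rewrite E annulusE NCpos ?expR_ge0 // ltxx.
Qed.

Lemma omitted_hi n : (n0 <= n)%N -> exists2 zeta, N zeta = expR (be n) & ~ Q n zeta.
Proof.
move=> hn; apply: contrapT => none.
have circ z : N z = expR (be n) -> Q n z.
  by move=> Nz; apply: contrapT => nQ; apply: none; exists z.
have [t ts ht] := ring_outward (@comp_open n) (expR_gt0 _) circ.
have [/andP[s0 s12] ring _ mx] := Hmax hn.
have E : annulus (expR (al n)) t = annulus (expR (al n)) (expR (be n)).
  apply: mx => [|z /andP[h1 h2]|z /andP[h1 h2]].
  - by rewrite s0 (lt_trans s12 ts).
  - by rewrite /annulus /= h1 (lt_trans h2 ts).
  have [h2'|h2'] := leP (expR (be n)) (N z); first by apply: ht; rewrite h2'.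
  by apply: ring; rewrite /annulus /= h1.
have : annulus (expR (al n)) t ((expR (be n))%:C : C).
  by rewrite annulusE NCpos ?expR_ge0 // s12.
by rewrite E annulusE NCpos ?expR_ge0 // ltxx andbF.
Qed.

(** * Strict bounds for [h] and boundary values of the quotients *)

Variables (a : R) (b : \bar R).
Hypothesis a_lim : a_ @ \oo --> a.
Hypothesis b_lim : (fun n => (b_ n)%:E) @ \oo --> b.
Hypothesis b_gt1 : (1 < b)%E.

Lemma near_a (e : R) : 0 < e -> \forall n \near \oo, `|a - a_ n| < e.
Proof. by move=> e0; move/(@cvgrPdist_lt _ _ _ _ eventually_filter): a_lim; apply. Qed.

Lemma limit_a_lt1 : a < 1.
Proof.
have : a <= a'; last by have := a'1; lra.
apply/ler_addgt0Pr => e e0.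
have [n [h1 h2]] := filter_ex (filterI (near_a e0) (nbhs_infty_ge n0)).
have [_ h3 _ _] := Hn0 h2; move: h1; rewrite ltr_norml => /andP[_]; lra.
Qed.

Lemma near_b (x : R) : (x%:E < b)%E -> \forall n \near \oo, x < b_ n.
Proof.
move=> xb; have : nbhs b [set y | (x%:E < y)%E].
  apply: open_nbhs_nbhs; split => //; exact: open_ereal_gt_ereal.
by move=> nb; have := b_lim nb; apply: (@filterS _ \oo _) => n /=; rewrite lte_fin.
Qed.

Lemma cvg_b (x : R) : b = x%:E -> b_ @ \oo --> x.
Proof. by move=> bE; move: b_lim; rewrite bE => /fine_cvg. Qed.

Lemma limit_sep (c : R) : (forall z, U z -> h z <> c) -> c < 1 -> forall z, U z -> c < h z.
Proof.
move=> hc c1; have cU : connected U by rewrite domainE; exact: comp_connected.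
apply: (connected_clopen (P := fun z => c < h z)) => //.
- by exists z0 => //; rewrite limit_z0.
- move=> z Uz hz.
  by apply: filterS (near_lt (@cst_continuous _ _ c z) (limit_cont Uz) hz) => w.
move=> z Uz /negP; rewrite -leNgt => hz.
have hz' : h z < c by rewrite lt_neqAle hz andbT; apply/eqP/hc.
apply: filterS (near_lt (limit_cont Uz) (@cst_continuous _ _ c z) hz') => w hw _.
by apply/negP; rewrite -leNgt ltW.
Qed.

Lemma limit_sep' (c : R) : (forall z, U z -> h z <> c) -> 1 < c -> forall z, U z -> h z < c.
Proof.
move=> hc c1; have cU : connected U by rewrite domainE; exact: comp_connected.
apply: (connected_clopen (P := fun z => h z < c)) => //.
- by exists z0 => //; rewrite limit_z0.
- move=> z Uz hz.
  by apply: filterS (near_lt (limit_cont Uz) (@cst_continuous _ _ c z) hz) => w.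
move=> z Uz /negP; rewrite -leNgt => hz.
have hz' : c < h z by rewrite lt_neqAle hz andbT eq_sym; apply/eqP/hc.
apply: filterS (near_lt (@cst_continuous _ _ c z) (limit_cont Uz) hz') => w hw _.
by apply/negP; rewrite -leNgt ltW.
Qed.

Lemma limit_gt z : U z -> a < h z.
Proof.
apply: limit_sep; last exact: limit_a_lt1.
move=> w; apply: (@level_omitted a a_) => //; first by rewrite lt_eqF // limit_a_lt1.
by exists n0 => // n /= /omitted_lo.
Qed.

Lemma limit_lt z : U z -> ((h z)%:E < b)%E.
Proof.
move=> Uz; move: b_gt1; case bE: b => [x| |] // x1; last by rewrite ltry.
rewrite lte_fin in x1; rewrite lte_fin; apply: limit_sep' => // w.
apply: (@level_omitted x b_) => //; [by rewrite gt_eqF|exact: cvg_b|].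
by exists n0 => // n /= /omitted_hi.
Qed.

Lemma closure_big n zeta : (n0 < n)%N -> closure U zeta -> 1 < N (iter n f zeta).
Proof.
move=> hn cz; have : expR (be n0) <= N (iter n f zeta).
  rewrite leNgt; apply/negP => lt.
  have [w [Uw hw]] := cz _ (near_lt (cdiff_contN (cdiff_iter n df zeta)) (@cst_continuous _ _ _ zeta) lt).
  by have := comp_ge (leqnn n0) hn (iter_comp n Uw); lra.
apply: lt_le_trans; rewrite -expR0 ltr_expR.
by have := log_pos (leqnn n0); have := log_lt_hi (leqnn n0); lra.
Qed.

Lemma log_quot_cont_closure n zeta : (n0 < n)%N -> closure U zeta -> {for zeta, continuous (u n)}.
Proof.
move=> hn cz; apply: log_quot_cont; rewrite -N_gt0; exact: lt_trans ltr01 (closure_big hn cz).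
Qed.

Lemma frontier_not_fatou zeta : frontier U zeta -> ~ fatou_set f zeta.
Proof.
move=> fz Fz; have nU := frontier_notin domain_open fz; apply: nU.
have oz : open (connected_component (fatou_set f) zeta) by apply: component_open; exact: fatou_open.
have [w [Uw zw]] : U `&` connected_component (fatou_set f) zeta !=set0.
  case: fz => cz _; apply: cz; apply: open_nbhs_nbhs; split => //.
  exact: connected_component_refl.
rewrite domainE in Uw *; apply: connected_component_trans Uw _.
exact: connected_component_sym.
Qed.

(** A boundary point of a Fatou component lies outside the Fatou set, and by [fatou_backward] so do
    its images. *)
Lemma frontier_iter n zeta : frontier U zeta -> ~ Q n (iter n f zeta).
Proof.
move=> fz /comp_fatou; have := frontier_not_fatou fz.
elim: n zeta {fz} => [//|n IH] zeta nF /=; rewrite -iterS iterSr => /IH; apply => h1; apply: nF.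
by apply: fatou_backward => // z; apply: cdiff_cont.
Qed.

Lemma frontier_dichotomy n zeta : (n0 < n)%N -> frontier U zeta ->
  u n zeta <= a_ n \/ b_ n <= u n zeta.
Proof.
move=> hn fz; have ln0 : 0 < l n by rewrite log_pos // ltnW.
have big : 1 < N (iter n f zeta) by apply: closure_big => //; case: fz.
have [h1|h1] := leP (u n zeta) (a_ n); [by left|right].
rewrite leNgt; apply/negP => h2; apply: (frontier_iter fz (n := n)).
apply: ring_sub; first exact: ltnW.
have E : N (iter n f zeta) = expR (u n zeta * l n).
  by rewrite /log_quot divfK ?gt_eqF // lnK // posrE; lra.
by rewrite E !ltr_expR /ring_lo /ring_hi !ltr_pM2r // h1.
Qed.

(** If [u n] stayed above [a_ n + e], all its boundary values would be at least [b_ n], and the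
    maximum principle would give [b_ n <= u n z0 = 1]. *)
Lemma inf_point n (e : R) : (n0 < n)%N -> 0 < e -> exists2 z, U z & u n z < a_ n + e.
Proof.
move=> hn e0; apply: contrapT => none.
have ge z : U z -> a_ n + e <= u n z.
  by move=> Uz; rewrite leNgt; apply/negP => lt; apply: none; exists z.
have [M bM] := domain_bounded; have oU := domain_open.
have mu := log_quot_mvp hn.
have := max_principle_real oU bM (mvp_smvp (mvpN oU mu)) (mvp_cst (U := U) (- b_ n)) _ Uz0.
have [l0 ha hb _] := Hn0 (ltnW hn); have b1' := b1.
rewrite orbit_quot ?(ltnW hn) // lerN2 => H.
have : b_ n <= 1; last lra.
apply: H => zeta fz e1 e10.
have cz : closure U zeta by case: fz.
have cu := log_quot_cont_closure hn cz.
have hz : b_ n <= u n zeta.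
  have [h1|//] := frontier_dichotomy hn fz.
  have lt : u n zeta < a_ n + e by lra.
  have [w [Uw hw]] := cz _ (near_lt cu (@cst_continuous _ _ _ zeta) lt).
  by have := ge w Uw; lra.
have lt : b_ n - e1 < u n zeta by lra.
by apply: filterS (near_lt (@cst_continuous _ _ _ zeta) cu lt) => w hw _; lra.
Qed.

Lemma sup_point n (x : R) : (n0 < n)%N -> x < b_ n -> exists2 z, U z & x < u n z.
Proof.
move=> hn xb; apply: contrapT => none.
have le z : U z -> u n z <= x.
  by move=> Uz; rewrite leNgt; apply/negP => lt; apply: none; exists z.
have [M bM] := domain_bounded; have oU := domain_open.
have mu := log_quot_mvp hn.
have := max_principle_real oU bM (mvp_smvp mu) (mvp_cst (U := U) (a_ n)) _ Uz0.
have [l0 ha hb _] := Hn0 (ltnW hn); have a'1' := a'1.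
rewrite orbit_quot ?(ltnW hn) // => H.
have : 1 <= a_ n; last lra.
apply: H => zeta fz e1 e10.
have cz : closure U zeta by case: fz.
have cu := log_quot_cont_closure hn cz.
have hz : u n zeta <= a_ n.
  have [//|h1] := frontier_dichotomy hn fz.
  have lt : x < u n zeta by lra.
  have [w [Uw hw]] := cz _ (near_lt (@cst_continuous _ _ _ zeta) cu lt).
  by have := le w Uw; lra.
have lt : u n zeta < a_ n + e1 by lra.
by apply: filterS (near_lt cu (@cst_continuous _ _ _ zeta) lt) => w hw _; exact: ltW.
Qed.

(** Intermediate values on the connected set [U]. The level must be exactly [x], because [lower_eps]
    needs a fixed distance from [x] to [b_ n]. *)
Lemma level_point n (x : R) : (n0 < n)%N -> 1 <= x < b_ n -> exists2 z, U z & u n z = x.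
Proof.
move=> hn /andP[x1 xb]; apply: contrapT => none.
have ne z : U z -> u n z <> x by move=> Uz E; apply: none; exists z.
have cU : connected U by rewrite domainE; exact: comp_connected.
have cu z : U z -> {for z, continuous (u n)} by move=> /(log_quot_mvp hn)[].
have [z Uz hz] := sup_point hn xb.
have : U `<=` [set z | u n z < x]; last by move=> /(_ z Uz) /=; lra.
apply: (connected_clopen (P := fun z => u n z < x)) => //.
- exists z0 => //; rewrite lt_neqAle orbit_quot ?(ltnW hn) // x1 andbT; apply/eqP => E.
  by apply: (ne z0 Uz0); rewrite orbit_quot // ltnW.
- by move=> w Uw hw; apply: filterS (near_lt (cu w Uw) (@cst_continuous _ _ x w) hw) => y.
move=> w Uw /negP; rewrite -leNgt => hw.
have hw' : x < u n w by rewrite lt_neqAle hw andbT eq_sym; apply/eqP/ne.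
apply: filterS (near_lt (@cst_continuous _ _ x w) (cu w Uw) hw') => y hy _.
by apply/negP; rewrite -leNgt ltW.
Qed.

(** * Infimum and supremum of the limit *)

Lemma limit_inf : a%:E = ereal_inf [set (h z)%:E | z in U].
Proof.
apply/eqP; rewrite eq_le; apply/andP; split.
  by apply: le_ereal_inf_tmp => _ [z Uz <-]; rewrite lee_fin ltW // limit_gt.
apply/lee_addgt0Pr => e e0; have a1 := limit_a_lt1.
have e3 : 0 < e / 3 by rewrite divr_gt0.
(* The bound [1 - a'] keeps [u n z] below 1, the range of [upper_eps]. *)
pose d := Num.min (e / 3) (1 - a'); have d0 : 0 < d by rewrite lt_min e3 subr_gt0.
have [d1 d2] : d <= e / 3 /\ d <= 1 - a' by rewrite !ge_min !lexx ?orbT.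
have [n [[h1 h2] h3]] := filter_ex (filterI (filterI (near_a e3) (upper_eps e3)) (nbhs_infty_gt n0)).
have [z Uz hz] := inf_point h3 d0.
have [_ h4 _ _] := Hn0 (ltnW h3).
have u1 : u n z <= 1 by lra.
have := h2 z Uz u1; move: h1; rewrite ltr_norml => /andP[h1 _] h5.
apply: (@le_trans _ _ (h z)%:E); first by apply: ereal_inf_lbound; exists z.
by rewrite -EFinD lee_fin; lra.
Qed.

Lemma lt_EFin_between (x : R) (y : \bar R) : (x%:E < y)%E -> exists2 t : R, x < t & (t%:E < y)%E.
Proof.
case: y => [y| |]; [|by exists (x + 1); rewrite ?ltry // ltrDl|by rewrite ltNge leNye].
by rewrite lte_fin => xy; exists ((x + y) / 2); rewrite ?lte_fin; lra.
Qed.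

Lemma limit_sup : b = ereal_sup [set (h z)%:E | z in U].
Proof.
apply/eqP; rewrite eq_le; apply/andP; split; last first.
  by apply: ge_ereal_sup => _ [z Uz <-]; rewrite ltW // limit_lt.
have key (x : R) : 1 <= x -> (x%:E < b)%E -> (x%:E <= ereal_sup [set (h z)%:E | z in U])%E.
  move=> x1 xb; apply/lee_addgt0Pr => e e0.
  have [y xy yb] := lt_EFin_between xb.
  have eta0 : 0 < y - x by rewrite subr_gt0.
  have [n [[h1 h2] h3]] := filter_ex (filterI (filterI (near_b yb) (lower_eps x1 eta0 e0)) (nbhs_infty_gt n0)).
  have xb' : 1 <= x < b_ n by rewrite x1 (lt_trans xy).
  have [z Uz hz] := level_point h3 xb'.
  have := h2 _ z Uz hz; rewrite addrC subrK => /(_ (ltW h1)) h4.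
  apply: (@le_trans _ _ ((h z)%:E + e%:E)%E); first by rewrite -EFinD lee_fin.
  by apply: leeD2r; apply: ereal_sup_ubound; exists z.
move: key b_gt1; case: b => [x| |] // key x1.
  apply/lee_addgt0Pr => e e0; rewrite lte_fin in x1.
  (* Approximation from below by levels that are at least 1, as [key] requires. *)
  pose y := Num.max 1 (x - e).
  have y1 : 1 <= y by rewrite le_max lexx.
  have yx : y < x by rewrite gt_max x1; lra.
  have yx' : x - e <= y by rewrite le_max lexx orbT.
  apply: (@le_trans _ _ (y%:E + e%:E)%E); first by rewrite -EFinD lee_fin; lra.
  by apply: leeD2r; apply: key => //; rewrite lte_fin.
rewrite leye_eq; apply/eqP/eqyP => e e0.
apply: (@le_trans _ _ (Num.max 1 e)%:E); first by rewrite lee_fin le_max lexx orbT.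
by apply: key; rewrite ?ltry // le_max lexx.
Qed.

(** * Behaviour at the inner and the outer boundary *)

Lemma domain_bounded_pos : exists2 M, 0 < M & forall z, U z -> N z <= M.
Proof.
have [M bM] := domain_bounded; exists (`|M| + 1); first by have := normr_ge0 M; lra.
by move=> z /bM h1; have := ler_norm M; lra.
Qed.

Lemma domain_connected : connected U.
Proof. by rewrite domainE; exact: comp_connected. Qed.

(* Maximum principle in a neighbourhood of the complementary component whose
   boundary is a compact subset of [U], where [u m] tends to [h < b]. *)
Lemma inner_eventually zeta : frontier U zeta -> ~ outer_boundary U zeta ->
  \forall m \near \oo, u m zeta <= a_ m.
Proof.
move=> fz nout; have [M M0 bM] := domain_bounded_pos; have oU := domain_open.
have bK := inner_bounded oU fz nout.
have cE : closed (~` U) by exact: open_closedC.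
have far z : M < N z -> (~` U) z by move=> h1 /bM; lra.
have [G [oG [M' bG] Gz fG]] := bounded_component_separated cE M0 far (frontier_notin oU fz) bK.
have fGU : frontier G `<=` U by move=> z /fG /contrapT.
have kG : compact (frontier G) := frontier_compact bG.
have [x xb Hx] : exists2 x : R, (x%:E < b)%E & \forall m \near \oo, forall z, frontier G z -> u m z <= x.
  have [[p0 Gp0]|none] := pselect (frontier G !=set0); last first.
    by exists 1 => //; near=> m => z Gz'; exfalso; apply: none; exists z.
  have [p Gp Hp] := compact_max kG (ex_intro _ p0 Gp0) (fun z Gz => limit_cont (fGU z Gz)).
  have [x hx xb] := lt_EFin_between (limit_lt (fGU p Gp)).
  exists x; first exact: xb.
  have d0 : 0 < x - h p by rewrite subr_gt0.
  apply: filterS (limit_compact kG fGU d0) => m Hm z Gz'.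
  by have := Hp z Gz'; have := Hm z Gz'; rewrite ler_norml => /andP[? ?]; lra.
near=> m.
have hm : (n0 < m)%N by near: m; exact: nbhs_infty_gt.
have lm : 0 < l m by rewrite log_pos // ltnW.
have xbm : x < b_ m by near: m; exact: near_b.
have Hm z : frontier G z -> u m z <= x by move: z; near: m.
have [//|bu] := frontier_dichotomy hm fz; exfalso.
have mm : N (iter m f zeta) <= expR (x * l m).
  apply: (max_modulus oG bG (cdiff_iter m df) (expR_gt0 _) _ Gz) => z Gz'.
  by rewrite (log_quotK hm (fGU z Gz')) ler_expR (ler_pM2r lm); exact: Hm.
have big : 1 < N (iter m f zeta) by apply: closure_big => //; case: fz.
have : u m zeta <= x; last lra.
rewrite /log_quot ler_pdivrMr // -ler_expR lnK // posrE; lra.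
Unshelve. all: by end_near. Qed.

(* The outer boundary lies entirely above or entirely below the ring, by
   [two_valued_constant]; in the second case the maximum principle off the
   unbounded component contradicts the position of the orbit. *)
Lemma outer_above n zeta : (n0 < n)%N -> outer_boundary U zeta -> b_ n <= u n zeta.
Proof.
move=> hn oz; have [M M0 bM] := domain_bounded_pos; have oU := domain_open.
have oF := outer_boundary_frontier oU M0 bM.
have [uz|//] := frontier_dichotomy hn (oF _ oz); exfalso.
have ln0 : 0 < l n by rewrite log_pos // ltnW.
have [A0 B0] := (expR_gt0 (al n), expR_gt0 (be n)).
have AB : expR (al n) < expR (be n).
  by rewrite ltr_expR; have := ring_lo_lt (ltnW hn); have := log_lt_hi (ltnW hn); lra.
have NE z : frontier U z -> N (iter n f z) = expR (u n z * l n).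
  move=> [cz _]; have big := closure_big hn cz.
  by rewrite /log_quot divfK ?gt_eqF // lnK // posrE; lra.
(* [la] is a continuous cut-off of [|f^n|], equal to 1 inside the annulus's hole and 0 beyond its
   outer circle, so it takes only these two values on the frontier of [U]. *)
pose ra z := (N (iter n f z) - expR (al n)) / (expR (be n) - expR (al n)).
pose la z := Num.max 0 (1 - Num.max 0 (ra z)).
have cN z : {for z, continuous (fun z => N (iter n f z))} by apply: cdiff_contN; exact: cdiff_iter.
have cra z : {for z, continuous ra}.
  apply: (@cvgM _ _ (nbhs z) (nbhs_filter z)); last exact: cvg_cst.
  by apply: (@cvgB _ _ _ (nbhs z) (nbhs_filter z)); [exact: cN|exact: cvg_cst].
have cla z : {for z, continuous la}.
  apply: cont_max; first exact: cst_continuous.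
  apply: (@cvgB _ _ _ (nbhs z) (nbhs_filter z)); first exact: cvg_cst.
  by apply: cont_max; [exact: cst_continuous|exact: cra].
have d0 : 0 < expR (be n) - expR (al n) by rewrite subr_gt0.
have laT z : frontier U z -> u n z <= a_ n -> la z = 1.
  move=> fz h1; have r0 : ra z <= 0.
    by rewrite /ra ler_pdivrMr // mul0r subr_le0 NE // ler_expR ler_pM2r.
  by rewrite /la (max_idPl r0) subr0; apply/max_idPr.
have laS z : frontier U z -> b_ n <= u n z -> la z = 0.
  move=> fz h1; have r1 : 1 <= ra z.
    by rewrite /ra ler_pdivlMr // mul1r lerD2r NE // ler_expR ler_pM2r.
  by apply/max_idPl; rewrite subr_le0 le_max r1 orbT.
have all_lo z : outer_boundary U z -> u n z <= a_ n.
  move=> oz'; have [//|h1] := frontier_dichotomy hn (oF _ oz'); exfalso.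
  apply: (@two_valued_constant R U (unbounded_component U) (M + 1) la z zeta).
  - exact: domain_connected.
  - exact: unbounded_truncated M0 bM.
  - exact: unbounded_closed oU M0 bM.
  - by move=> y Uy /unbounded_notin.
  - by move=> y /oF[].
  - by move=> y /bM h2; rewrite /cdisc /= subr0; lra.
  - move=> y /oF[cy _]; rewrite /cdisc /= subr0 leNgt; apply/negP => h2.
    have [w [Uw hw]] := cy _ (near_lt (@cst_continuous _ _ (M + 1) y) (@continuous_N R y) h2).
    by have := bM w Uw; lra.
  - exact: cla.
  - move=> y oy; have [h2|h2] := frontier_dichotomy hn (oF _ oy); last by left; apply: laS h2; exact: oF.
    by right; apply: laT h2; exact: oF.
  - exact: oz'.
  - exact: oz.
  - by apply: laS h1; exact: oF.
  by apply: laT uz; exact: oF.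
have clW := unbounded_closed oU M0 bM.
have oG : open (~` unbounded_component U) by exact: closed_openC.
have bG z : (~` unbounded_component U) z -> N z <= M.
  by move=> nW; rewrite leNgt; apply/negP => h1; apply: nW; exact: (unbounded_far M0 bM h1).
have mm : N (iter n f z0) <= expR (al n).
  have Gz0 : (~` unbounded_component U) z0 by move=> /unbounded_notin.
  apply: (max_modulus oG bG (cdiff_iter n df) A0 _ Gz0) => z fz.
  have Wz : unbounded_component U z by have /contrapT := frontier_notin oG fz.
  have oz' : outer_boundary U z.
    split; first exact: subset_closure.
    move=> iz; case: fz => cz _; have [w [nw Ww]] := cz _ iz; exact: nw.
  by rewrite (NE z (oF z oz')) ler_expR (ler_pM2r ln0); exact: all_lo.
have := ring_lo_lt (ltnW hn); rewrite -ltr_expR -orbit_modulus ?(ltnW hn) // /orbit_pt; lra.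
Qed.

(** Near such a boundary point [u m] is below 1 and close to [a_ m], and [upper_eps] passes this on
    to [h]. One [m] serves all these points, as [perron_lower] needs. *)
Lemma lo_limit (e : R) : 0 < e -> \forall m \near \oo, forall zeta, frontier U zeta ->
  u m zeta <= a_ m -> \forall w \near zeta, U w -> h w <= a + e.
Proof.
move=> e0; have e3 : 0 < e / 3 by rewrite divr_gt0.
apply: filterS (filterI (near_a e3) (filterI (upper_eps e3) (nbhs_infty_gt n0))) => m [h2 [h3 h4]].
move=> zeta fz h1; have cz : closure U zeta by case: fz.
have [_ am _ _] := Hn0 (ltnW h4); have a'1' := a'1.
have lt : u m zeta < Num.min 1 (a_ m + e / 3) by rewrite lt_min; apply/andP; split; lra.
apply: filterS (near_lt (log_quot_cont_closure h4 cz) (@cst_continuous _ _ _ zeta) lt) => w.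
rewrite lt_min => /andP[w1 w2] Uw; have := h3 w Uw (ltW w1).
by move: h2; rewrite ltr_norml => /andP[h2 _]; lra.
Qed.

Lemma inner_limit zeta (e : R) : frontier U zeta -> ~ outer_boundary U zeta -> 0 < e ->
  \forall w \near zeta, U w -> h w <= a + e.
Proof.
move=> fz nout e0.
by have [m [h1 h2]] := filter_ex (filterI (inner_eventually fz nout) (lo_limit e0)); exact: h2 fz h1.
Qed.

Lemma limit_extends : exists g : C -> R,
  [/\ {within U `|` (frontier U `\` outer_boundary U), continuous g},
      (forall z, U z -> g z = h z) &
      (forall zeta, (frontier U `\` outer_boundary U) zeta -> g zeta = a)].
Proof.
have oU := domain_open.
pose g z := if z \in U then h z else a.
have gU z : U z -> g z = h z by move=> Uz; rewrite /g mem_set.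
have gF z : frontier U z -> g z = a by move=> /(frontier_notin oU) nU; rewrite /g memNset.
exists g; split => //; last by move=> z [/gF].
apply/subspace_continuousP => z [Uz|[fz nout]].
  have cg : {for z, continuous g} by apply: (@eq_cont R U h g z) => //; [move=> y /gU|exact: limit_cont].
  move=> A nA; have nz : nbhs z (g @^-1` A) by exact: cg.
  by apply: filterS nz => w hw _.
have : g @ within (U `|` (frontier U `\` outer_boundary U)) (nbhs z) --> g z; last by [].
rewrite gF //; apply/(@cvgrPdist_le _ _ _ (within _ (nbhs z)) (within_nbhs_filter _ _)) => e e0.
apply: filterS (inner_limit fz nout e0) => w hw [Uw|[fw _]].
  rewrite gU // ler0_norm; first by have := hw Uw; lra.
  by have := limit_gt Uw; lra.
by rewrite (gF w fw) subrr normr0 ltW.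
Qed.

Lemma inner_barrier zeta : frontier U zeta -> ~ outer_boundary U zeta ->
  weak_barrier U zeta (fun z => h z - a).
Proof.
move=> fz nout; split.
- by apply: mvpB; [exact: domain_open|exact: limit_mvp|exact: mvp_cst].
- by move=> z /limit_gt; rewrite subr_gt0.
by move=> e e0; apply: filterS (inner_limit fz nout e0) => w hw /hw; lra.
Qed.

(** * Regularity and harmonic measure *)

Lemma domain_regular : dirichlet_regular U.
Proof.
have [M M0 bM] := domain_bounded_pos; have oU := domain_open.
apply: (dirichlet_of_barriers oU bM) => zeta fz.
have [oz|nout] := pselect (outer_boundary U zeta); last by eexists; exact: inner_barrier.
exact: (outer_barrier oU domain_connected M0 bM Uz0 oz).
Qed.

(** The modulus form of the condition [b_ n <= u n] makes the set closed for every [n]. For large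
    [n] it is also relatively open, by [frontier_dichotomy]; its indicator is then admissible
    boundary data. *)
Definition upper_part n : set C := frontier U `&` [set z | expR (be n) <= N (iter n f z)].
Local Notation S := upper_part.

Lemma upper_partP n zeta : (n0 < n)%N -> frontier U zeta -> S n zeta <-> b_ n <= u n zeta.
Proof.
move=> hn fz; have ln0 : 0 < l n by rewrite log_pos // ltnW.
have big : 1 < N (iter n f zeta) by apply: closure_big => //; case: fz.
have E : N (iter n f zeta) = expR (u n zeta * l n).
  by rewrite /log_quot divfK ?gt_eqF // lnK // posrE; lra.
rewrite /upper_part /setI /= E ler_expR (ler_pM2r ln0).
by split=> [[]|].
Qed.

Lemma upper_part_closed n : closed (S n).
Proof.
apply: closedI; first exact: closed_frontier.
have -> : [set z | expR (be n) <= N (iter n f z)] = ~` [set z | N (iter n f z) < expR (be n)].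
  by apply/seteqP; split=> z /=; rewrite leNgt => /negP.
apply: open_closedC; rewrite openE => z /= hz.
exact: near_lt (cdiff_contN (cdiff_iter n df z)) (@cst_continuous _ _ _ z) hz.
Qed.

Lemma upper_part_cont n : (n0 < n)%N -> {within frontier U, continuous (\1_(S n) : C -> R)}.
Proof.
move=> hn; apply/subspace_continuousP => z fz.
have cz : closure U z by case: fz.
have cu := log_quot_cont_closure hn cz.
have [_ _ hb _] := Hn0 (ltnW hn).
have ab : a_ n < b_ n.
  by have [_ h1 _ _] := Hn0 (ltnW hn); have := a'1; have := b1; lra.
have nr : \forall w \near z, frontier U w -> (w \in S n) = (z \in S n).
  have [h1|h1] := frontier_dichotomy hn fz.
    have lt : u n z < b_ n by lra.
    apply: filterS (near_lt cu (@cst_continuous _ _ _ z) lt) => w hw fw.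
    rewrite !memNset //; first by move/(upper_partP hn fz); lra.
    by move/(upper_partP hn fw); lra.
  have lt : a_ n < u n z by lra.
  apply: filterS (near_lt (@cst_continuous _ _ _ z) cu lt) => w hw fw.
  rewrite !mem_set //; first exact/(upper_partP hn fz).
  by apply/(upper_partP hn fw); have [|//] := frontier_dichotomy hn fw; lra.
have : (\1_(S n) : C -> R) @ within (frontier U) (nbhs z) --> (\1_(S n) z : R); last by [].
apply/(@cvgrPdist_le _ _ _ (within _ (nbhs z)) (within_nbhs_filter _ _)) => e e0.
apply: filterS nr => w hw fw; rewrite !indicE (hw fw) subrr normr0 ltW //.
Qed.

(** The affine function of [h] is a subsolution: it is below 1 everywhere because [h < x], and at
    most 0 near the boundary points outside [S n] by [lo_limit]. *)
Lemma perron_lower (x e : R) : b = x%:E -> 0 < e -> \forall n \near \oo, forall z, U z ->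
  (((h z - a - e) / (x - a))%:E <= perron U (\1_(S n)) z)%E.
Proof.
move=> bx e0; have a1 := limit_a_lt1.
have x1 : 1 < x by move: b_gt1; rewrite bx lte_fin.
have d0 : 0 < x - a by lra.
apply: filterS (filterI (lo_limit e0) (nbhs_infty_gt n0)) => n [lo hn] z Uz.
apply: (@perron_ge _ U domain_open _ (fun z => (h z - a - e) / (x - a))) => //.
  apply: mvp_smvp; have E w : (x - a)^-1 * (h w + (- a - e)) = (h w - a - e) / (x - a).
    by rewrite mulrC addrA.
  apply: near_mvp (fun z _ => E z) _; first exact: domain_open.
  apply: mvpZ; first exact: domain_open.
  by apply: mvpD; [exact: domain_open|exact: limit_mvp|exact: mvp_cst].
move=> zeta fz e1 e10; have [Sz|nS] := pselect (S n zeta).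
  rewrite indicE mem_set //; apply: nearC => w Uw.
  rewrite ler_pdivrMr //; have := limit_lt Uw; rewrite bx lte_fin => hw.
  have : 0 < e1 * (x - a) by rewrite mulr_gt0.
  by rewrite mulrDl /=; lra.
rewrite indicE memNset // add0r.
have uz : u n zeta <= a_ n.
  by have [//|h1] := frontier_dichotomy hn fz; exfalso; apply: nS; apply/upper_partP.
apply: filterS (lo zeta fz uz) => w hw Uw; have := hw Uw => hw'.
apply: (@le_trans _ _ 0); last exact: ltW.
by rewrite ler_pdivrMr // mul0r; lra.
Qed.

(** Here [u n] replaces [h], which is not known to attain [b] at the outer boundary: [u n] is at
    least [b_ n] on [S n], and [upper_eps] with [a < h] keeps [u n - a + e] nonnegative. The form
    with [b_ n] also covers [b = +oo]. *)
Lemma perron_upper (e : R) : 0 < e -> \forall n \near \oo, forall z, U z ->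
  (perron U (\1_(S n)) z <= ((u n z - a + e) / (b_ n - a + e))%:E)%E.
Proof.
move=> e0; have a1 := limit_a_lt1; have [M bM] := domain_bounded.
apply: filterS (filterI (upper_eps e0) (nbhs_infty_gt n0)) => n [up hn] z Uz.
have [_ _ hb _] := Hn0 (ltnW hn); have b1' := b1.
have d0 : 0 < b_ n - a + e by lra.
apply: (@perron_le _ U M domain_open bM _ (fun z => (u n z - a + e) / (b_ n - a + e))) => //.
  have E w : (b_ n - a + e)^-1 * (u n w + (- a + e)) = (u n w - a + e) / (b_ n - a + e).
    by rewrite mulrC addrA.
  apply: near_mvp (fun z _ => E z) _; first exact: domain_open.
  apply: mvpZ; first exact: domain_open.
  by apply: mvpD; [exact: domain_open|exact: log_quot_mvp|exact: mvp_cst].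
move=> zeta fz e1 e10; have cz : closure U zeta by case: fz.
have [Sz|nS] := pselect (S n zeta).
  have d1 : 0 < e1 * (b_ n - a + e) by rewrite mulr_gt0.
  have lt : b_ n - e1 * (b_ n - a + e) < u n zeta by have := (upper_partP hn fz).1 Sz; lra.
  apply: filterS (near_lt (@cst_continuous _ _ _ zeta) (log_quot_cont_closure hn cz) lt) => w hw Uw.
  rewrite indicE mem_set // -lerBlDr ler_pdivlMr // mulrBl mul1r /=; lra.
rewrite indicE memNset //; apply: nearC => w Uw.
apply: addr_ge0; last exact: ltW.
apply: divr_ge0; last exact: ltW.
have [h1|h1] := leP (u n w) 1; last lra.
by have := up w Uw h1; have := limit_gt Uw; lra.
Qed.

Section HarmonicMeasure.
Variables (z : C) (mu : probability (borelC R) R).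
Hypothesis Uz : U z.
Hypothesis hmu : is_harmonic_measure U z mu.
Local Notation out := (outer_boundary U).

Lemma borelC_closed (A : set C) : closed A -> measurable (A : set (borelC R)).
Proof.
move=> cA; rewrite -[A]setCK; apply: measurableC; apply: sub_sigma_algebra.
exact: closed_openC.
Qed.

Lemma frontier_borel (A : set C) : measurable (frontier A : set (borelC R)).
Proof. by apply: borelC_closed; exact: closed_frontier. Qed.

Lemma harmonic_upper n : (n0 < n)%N -> mu (S n) = perron U (\1_(S n)) z.
Proof.
move=> hn; case: hmu => _ /(_ _ (upper_part_cont hn)) <-.
have mS : measurable (S n : set (borelC R)) by apply: borelC_closed; exact: upper_part_closed.
rewrite (integral_indic mu (frontier_borel U) mS); congr (mu _).
by apply/seteqP; split=> w; [move=> Sw; split => //; case: Sw|case].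
Qed.

Lemma mu_fin (A : set C) : measurable (A : set (borelC R)) -> mu A = (fine (mu A))%:E.
Proof. by move=> mA; rewrite fineK //; exact: fin_num_measure. Qed.

Lemma outer_le n : (n0 < n)%N -> (mu out <= mu (S n))%E.
Proof.
move=> hn; have [M M0 bM] := domain_bounded_pos.
apply: le_measure; rewrite ?inE; [exact: frontier_borel|by apply: borelC_closed; exact: upper_part_closed|].
move=> w ow; have fw := outer_boundary_frontier domain_open M0 bM ow.
by apply/(upper_partP hn fw); exact: outer_above.
Qed.

Lemma outer_bound (e : R) : 0 < e -> \forall n \near \oo,
  fine (mu out) <= (h z + e - a + e) / (b_ n - a + e).
Proof.
move=> e0; have a1 := limit_a_lt1.
have hz : \forall n \near \oo, `|h z - u n z| < e.
  by move/(@cvgrPdist_lt _ _ _ _ eventually_filter): (h_lim Uz); apply.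
apply: filterS (filterI hz (filterI (perron_upper e0) (nbhs_infty_gt n0))) => n [h1 [h2 hn]].
have [_ _ hb _] := Hn0 (ltnW hn); have b1' := b1.
have d0 : 0 < b_ n - a + e by lra.
have := le_trans (outer_le hn) _; rewrite harmonic_upper // => /(_ _ (h2 z Uz)).
rewrite (mu_fin (frontier_borel _)) lee_fin => h3; apply: le_trans h3 _.
rewrite ler_pM2r ?invr_gt0 //; move: h1; rewrite ltr_norml => /andP[h1 _]; lra.
Qed.

(** Each boundary point off the outer boundary leaves [S n] for good by [inner_eventually], so the
    tails [V k] decrease to the empty set; continuity of the measure from above concludes. Tails
    start beyond [n0], where [upper_partP] holds. *)
Lemma inner_vanish (e : R) : 0 < e -> \forall n \near \oo, (mu (S n) <= mu out + e%:E)%E.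
Proof.
move=> e0; pose V (k : nat) := \bigcup_(n in [set n | (maxn k n0.+1 <= n)%N]) (S n `\` out).
have mS n : measurable (S n : set (borelC R)) by apply: borelC_closed; exact: upper_part_closed.
have mo : measurable (out : set (borelC R)) by exact: frontier_borel.
have mV k : measurable (V k : set (borelC R)).
  by apply: bigcup_measurable => n _; exact: measurableD.
have V0 : \bigcap_k V k = set0.
  rewrite -subset0 => w Vw; have [n0' _ [[fw _] nout]] := Vw 0%N I.
  have [N0 _ HN] := inner_eventually fw nout.
  have [n /= hn [Sw _]] := Vw N0 I; move: hn; rewrite geq_max => /andP[n1 n2].
  have := HN n n1; have := (upper_partP n2 fw).1 Sw.
  have [_ ha hb _] := Hn0 (ltnW n2); have := a'1; have := b1; lra.
have Vd : nonincreasing_seq V.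
  move=> i j ij; apply/subsetPset => w [n /= hn hw]; exists n => //=.
  by apply: leq_trans hn; rewrite geq_max leq_max ij /= leq_maxr.
have := @nonincreasing_cvg_mu _ _ _ mu V _ mV _ Vd.
rewrite V0 measure0 => H.
have {}H : mu \o V @ \oo --> (0 : \bar R)%E.
  apply: H => //.
  by apply: le_lt_trans (probability_le1 mu (mV 0%N)) _; exact: ltry.
have : \forall k \near \oo, (mu (V k) < e%:E)%E.
  have : nbhs (0%E : \bar R) [set y | (y < e%:E)%E].
    by apply: open_nbhs_nbhs; split; [exact: open_ereal_lt_ereal|rewrite /= lte_fin].
  by move/H.
move=> [k _ Hk]; exists (maxn k n0.+1) => // n /= hn.
have hk := Hk k (leqnn k).
apply: (@le_trans _ _ (mu (out `|` V k))).
  apply: le_measure; rewrite ?inE //; first exact: measurableU.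
  move=> w Sw; have [ow|nout] := pselect (out w); first by left.
  by right; exists n.
have h1 : (mu (out `|` V k) <= mu out + mu (V k))%E by apply: measureU2 => //; exact: mV.
by apply: (le_trans h1); apply: leeD2l; exact: ltW.
Qed.

(** One inequality comes from the inclusion of the outer boundary in [S n] and [perron_upper], the
    other from [perron_lower] and [inner_vanish]. *)
Lemma harmonic_finite (x : R) : b = x%:E -> h z = a + (x - a) * fine (mu out).
Proof.
move=> bx; have a1 := limit_a_lt1.
have x1 : 1 < x by move: b_gt1; rewrite bx lte_fin.
have d0 : 0 < x - a by lra.
have mo : measurable (out : set (borelC R)) by exact: frontier_borel.
have m0 : 0 <= fine (mu out) by apply: fine_ge0; exact: measure_ge0.
apply: eq_eps => e e0; have e2 : 0 < e / 2 by rewrite divr_gt0.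
rewrite ler_norml; apply/andP; split.
  have lt : ((x - e / 2)%:E < b)%E by rewrite bx lte_fin; lra.
  have [n [[h1 h2] hn]] := filter_ex (filterI (filterI (outer_bound e2) (near_b lt)) (nbhs_infty_gt n0)).
  have d1 : 0 < b_ n - a + e / 2 by lra.
  rewrite ler_pdivlMr // in h1.
  have : fine (mu out) * (x - a) <= fine (mu out) * (b_ n - a + e / 2) by rewrite ler_wpM2l //; lra.
  lra.
pose e' := e / 2 / (x - a).
have e'0 : 0 < e' by rewrite divr_gt0.
have [n [[h1 h2] hn]] := filter_ex (filterI (filterI (perron_lower bx e2) (inner_vanish e'0)) (nbhs_infty_gt n0)).
have := h1 z Uz; rewrite -harmonic_upper // => /le_trans/(_ h2).
rewrite (mu_fin mo) -EFinD lee_fin ler_pdivrMr // mulrDl /e' divfK ?gt_eqF //; lra.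
Qed.

Lemma harmonic_infinite : b = +oo%E -> mu out = 0%E.
Proof.
move=> bx; have a1 := limit_a_lt1.
have mo : measurable (out : set (borelC R)) by exact: frontier_borel.
have m0 : 0 <= fine (mu out) by apply: fine_ge0; exact: measure_ge0.
rewrite (mu_fin mo); congr EFin; apply/eqP; rewrite eq_le m0 andbT.
apply/ler_addgt0Pr => e e0; rewrite add0r.
(* Beyond this threshold for [b_ n] the bound of [outer_bound] is at most [e]. *)
have lt : (((h z + 1 - a + 1) / e + a)%:E < b)%E by rewrite bx ltry.
have [n [[h1 h2] hn]] := filter_ex (filterI (filterI (outer_bound ltr01) (near_b lt)) (nbhs_infty_gt n0)).
apply: le_trans h1 _.
have [_ _ hb _] := Hn0 (ltnW hn); have b1' := b1.
have d1 : 0 < b_ n - a + 1 by lra.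
rewrite ler_pdivrMr // mulrC -ler_pdivrMr //; lra.
Qed.

End HarmonicMeasure.

Lemma wandering_conclusion (omega : C -> probability (borelC R) R) :
  (forall z, U z -> is_harmonic_measure U z (omega z)) ->
  [/\ a%:E = ereal_inf [set (h z)%:E | z in U] /\ b = ereal_sup [set (h z)%:E | z in U],
    exists g : C -> R,
      [/\ {within U `|` (frontier U `\` outer_boundary U), continuous g},
          (forall z, U z -> g z = h z) &
          (forall zeta, (frontier U `\` outer_boundary U) zeta -> g zeta = a)],
    dirichlet_regular U &
    ((b < +oo)%E -> forall z, U z ->
       (h z)%:E = (a%:E + (b - a%:E) * omega z (outer_boundary U))%E) /\
    (b = +oo%E -> forall z, U z -> omega z (outer_boundary U) = 0%E)].
Proof.
move=> homega; split.
- by split; [exact: limit_inf|exact: limit_sup].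
- exact: limit_extends.
- exact: domain_regular.
split=> [bfin z Uz|binf z Uz]; last exact: (harmonic_infinite Uz (homega z Uz) binf).
have [x bx] : exists x : R, b = x%:E.
  by move: bfin b_gt1; case: b => [x| |] //; exists x.
rewrite (harmonic_finite Uz (homega z Uz) bx) bx.
by rewrite (mu_fin (omega z) (frontier_borel _)) -EFinB -EFinM -EFinD.
Qed.

End WanderingDomain.

Theorem theorem1p6 (R : realType) (f : R[i] -> R[i]) (U : set R[i]) (z0 : R[i])
    (h : R[i] -> R) (a_ b_ : nat -> R) (a : R) (b : \bar R)
    (omega : R[i] -> probability (borelC R) R)
    (f_te : transcendental_entire f)
    (U_wd : wandering_domain f U)
    (U_mc : multiply_connected U)
    (U_z0 : U z0)
    (h_lim : forall z, U z ->
       (fun n => ln (Normc.normc (iter n f z)) / ln (Normc.normc (iter n f z0)))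
         @ \oo --> h z)
    (h_harm : harmonic_on U h)
    (h_pos : forall z, U z -> 0 < h z)
    (h_ncst : ~ exists c, forall z, U z -> h z = c)
    (ab_max : \forall n \near \oo,
       maximal_annulus (fatou_iter f U n) (iter n f z0)
         (Normc.normc (iter n f z0) `^ a_ n) (Normc.normc (iter n f z0) `^ b_ n))
    (a_lim : a_ @ \oo --> a)
    (b_lim : (fun n => (b_ n)%:E) @ \oo --> b)
    (a_int : 0 <= a < 1)
    (b_int : (1 < b)%E)
    (omega_harm : forall z, U z -> is_harmonic_measure U z (omega z)) :
  [/\
    a%:E = ereal_inf [set (h z)%:E | z in U] /\
    b = ereal_sup [set (h z)%:E | z in U],

    exists g : R[i] -> R,
      [/\ {within U `|` (frontier U `\` outer_boundary U), continuous g},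
          (forall z, U z -> g z = h z) &
          (forall zeta, (frontier U `\` outer_boundary U) zeta -> g zeta = a)],

    dirichlet_regular U &

    ((b < +oo)%E -> forall z, U z ->
       (h z)%:E = (a%:E + (b - a%:E) * omega z (outer_boundary U))%E) /\
    (b = +oo%E -> forall z, U z -> omega z (outer_boundary U) = 0%E)
  ].
Proof.
have df z : cdiff f z by apply: derivable_cdiff; case: f_te.
have nc : nonconstant f.
  by move=> [c fc]; case: f_te => _; apply; exists c%:P => z; rewrite hornerC.
have QE := fatou_iterE df nc U_wd U_z0.
(* A real number strictly between 1 and [b], which may be [+oo]: the uniform growth ratio of
   [log r_n]. *)
have [b' b'1 b'b] := lt_EFin_between b_int.
have a1 : a < 1 by case/andP: a_int.
pose a' := (1 + a) / 2; have a'1 : a' < 1 by rewrite /a'; lra.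
have na : \forall n \near \oo, a_ n < a'.
  have d0 : 0 < (1 - a) / 2 by lra.
  by apply: filterS (near_a a_lim d0) => n; rewrite ltr_norml /a' => /andP[h1 _]; lra.
have [n0 _ Hn] := filterI na (filterI (near_b b_lim b'b) ab_max).
have Hr n : (n0 <= n)%N -> [/\ 0 < orbit_log f z0 n, a_ n < a', b' < b_ n &
    maximal_annulus (orbit_comp f z0 n) (orbit_pt f z0 n)
      (expR (ring_lo f z0 a_ n)) (expR (ring_hi f z0 b_ n))].
  move=> hn; have [an [bn mx]] := Hn n hn; rewrite QE in mx.
  have powE (r x : R) : 0 < r -> r `^ x = expR (x * ln r) by move=> r0; rewrite /powR gt_eqF.
  have [r12 _ /andP[r1 r2] _] := mx.
  have r0 : 0 < N (iter n f z0).
    by case/andP: r12 => p0 _; apply: lt_trans p0 r1.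
  rewrite !powE // in mx; rewrite powE // -[ltRHS]lnK ?posrE // ltr_expR in r1.
  split => //; rewrite /orbit_log /orbit_pt.
  (* The orbit point lies in its annulus, so [a_ n * l n < l n]; as [a_ n < 1], this forces [l n] to
     be positive. *)
  by move: r1; rewrite -subr_gt0 -[X in X - _]mul1r -mulrBl pmulr_rgt0 // subr_gt0 (lt_trans an).
apply: (wandering_conclusion df nc U_wd U_z0 a'1 b'1 _ h_lim _ a_lim b_lim b_int omega_harm).
  by move=> n /Hr[l0 an bn [_ sub _ _]].
by move=> n /Hr[].
Qed.
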